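(* Suppose $f_0\in W^\alpha[0,1]$ or $f_0\in H^\alpha[0,1]$ for some $\alpha>3/2$. If the kernel $K_\alpha$ is used in the Gaussian process prior with regularization parameter $\lambda\asymp(\log n/n)^{\frac{2\alpha}{2\alpha+1}}$, then for any $k\in\mathbb N_0$ with $k<\alpha-3/2$ the posterior distribution $\Pi_{n,k}(\cdot\mid\mathbb D_n)$ contracts at $f_0^{(k)}$ at the nearly minimax optimal rate $\epsilon_n=(\log n/n)^{\frac{\alpha-k}{2\alpha+1}}$ under the $L_2$ norm; that is, for any $M_n\to\infty$, $$\Pi_{n,k}\left(\|f^{(k)}-f_0^{(k)}\|_2>M_n\epsilon_n\,\big|\,\mathbb D_n\right)\to0\quad\text{in }\mathbb P_0^{(n)}\text{-probability}.$$
   Context: Model: $\mathbb D_n=\{(X_i,Y_i)\}_{i=1}^n$ are i.i.d. with $X_i\sim\mathrm{Unif}[0,1]$ and $Y_i=f_0(X_i)+\varepsilon_i$, $\varepsilon_i\sim N(0,\sigma^2)$ independent of $X_i$; $\mathbb P_0^{(n)}$ is the law of $\mathbb D_n$. $X=(X_1,\dots,X_n)^T$, $Y=(Y_1,\dots,Y_n)^T$. $\|\cdot\|_2$ is the $L^2[0,1]$ norm and $\langle f,g\rangle_2=\int_0^1fg$. $a_n\asymp b_n$ means each is bounded by a constant multiple of the other. $\mathbb N_0=\mathbb N\cup\{0\}$. Fourier basis: $\psi_1(x)=1$, $\psi_{2i}(x)=\sqrt2\cos(2\pi ix)$, $\psi_{2i+1}(x)=\sqrt2\sin(2\pi ix)$,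 $i\in\mathbb N$. Function classes, with $f_i=\langle f,\psi_i\rangle_2$: $W^\alpha[0,1]=\{f:\sum_{i\ge1}i^{2\alpha}f_i^2<\infty\}$ and $H^\alpha[0,1]=\{f:\sum_{i\ge1}i^\alpha|f_i|<\infty\}$. Kernel: $K_\alpha(x,x')=\sum_{i\ge1}\mu_i\psi_i(x)\psi_i(x')$ with $\mu_1\ge\mu_2\ge\cdots>0$ and $\mu_i\asymp i^{-2\alpha}$. Posterior: with $K=K_\alpha$ and the prior $f\sim\mathrm{GP}(0,\sigma^2(n\lambda)^{-1}K)$, the posterior $\Pi_{n,k}(\cdot\mid\mathbb D_n)$ of $f^{(k)}$ is $\mathrm{GP}(\hat f_n^{(k)},\tilde V_n^k)$, where $$\hat f_n^{(k)}(x)=K_{k0}(x,X)[K(X,X)+n\lambda I_n]^{-1}Y,$$ $$\tilde V_n^k(x,x')=\sigma^2(n\lambda)^{-1}\{K_{kk}(x,x')-K_{k0}(x,X)[K(X,X)+n\lambda I_n]^{-1}K_{0k}(X,x')\},$$ with $K(X,X)=(K(X_i,X_j))_{i,j}$, $K_{k0}(x,X)=(\partial_x^kK(x,X_i))_{i=1}^n$ (row), $K_{0k}(X,x')=(\partial_{x'}^kK(X_i,x'))_{i=1}^n$ (column), $K_{kk}(x,x')=\partial_x^k\partial_{x'}^kK(x,x')$. *)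

(* Defs.v *)
From HB Require Import structures.
From mathcomp Require Import all_boot all_order all_algebra.
From mathcomp Require Import all_classical all_reals all_analysis.

Set Implicit Arguments.
Unset Strict Implicit.
Unset Printing Implicit Defensive.

Import Order.TTheory GRing.Theory Num.Theory.
Import numFieldTopology.Exports numFieldNormedType.Exports.

Local Open Scope classical_set_scope.
Local Open Scope ring_scope.

(* Functions on [0,1] are represented by functions R -> R, of which only the
   restriction to [0,1] is used. *)

(* Both bounds are required eventually, so that sequences such as log n / n,
   which vanishes at n = 1, can be compared. *)
Definition asymp (R : realType) (a b : nat -> R) : Prop :=
  exists2 C : R, 0 < C &
    \forall n \near \oo, a n <= C * b n /\ b n <= C * a n.

(* The basis is indexed from 1; fourier_basis 0 is never used. *)
Definition fourier_basis (R : realType) (i : nat) (x : R) : R :=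
  if i == 1%N then 1
  else if odd i then Num.sqrt 2 * sin (2 * pi * (i./2)%:R * x)
  else Num.sqrt 2 * cos (2 * pi * (i./2)%:R * x).

Definition fourier_coef (R : realType) (f : R -> R) (i : nat) : R :=
  \int[lebesgue_measure]_(x in `[0, 1]) (f x * fourier_basis i x).

Definition L2norm (R : realType) (f : R -> R) : \bar R :=
  ((\int[lebesgue_measure]_(x in `[0%R, 1%R]) ((f x) ^+ 2)%:E) `^ 2^-1)%E.

Definition in_L2 (R : realType) (f : R -> R) : Prop :=
  measurable_fun (`[0, 1] : set R) f /\ (L2norm f < +oo)%E.

Definition W_class (R : realType) (alpha : R) (f : R -> R) : Prop :=
  in_L2 f /\
  (\sum_(1 <= i <oo)
     (i%:R `^ (2 * alpha) * fourier_coef f i ^+ 2)%:E < +oo)%E.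

Definition H_class (R : realType) (alpha : R) (f : R -> R) : Prop :=
  in_L2 f /\
  (\sum_(1 <= i <oo) (i%:R `^ alpha * `|fourier_coef f i|)%:E < +oo)%E.

(* Elements of the two classes are L^2 functions. For alpha > 1/2 each has a
   continuous version on [0,1], unique there; derivatives are those of this
   version. The value f is a default for when there is no such version. *)
Definition continuous_version (R : realType) (f : R -> R) : R -> R :=
  xget f [set h : R -> R | {within `[0, 1], continuous h} /\
    {ae lebesgue_measure, forall x, x \in `[0, 1] -> h x = f x}].

(* At the endpoints 0 and 1 the value is irrelevant: only the class modulo
   null sets matters below. *)
Definition deriv_class (R : realType) (k : nat) (f : R -> R) : R -> R :=
  derive1n k (continuous_version f).

Definition series_kernel (R : realType) (mu : nat -> R) (x x' : R) : R :=
  \big[+%R/0]_(1 <= i <oo) (mu i * fourier_basis i x * fourier_basis i x').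

(* d^j/dx^j d^l/dx'^l K(x, x'); the series kernel is defined and 1-periodic on
   all of R x R, so two-sided derivatives make sense at 0 and 1 as well. *)
Definition kernel_deriv (R : realType) (K : R -> R -> R) (j l : nat)
    (x x' : R) : R :=
  derive1n j (fun u => derive1n l (K u) x') x.

Section posterior.
Variables (R : realType) (K : R -> R -> R) (sigma lam : R) (k n : nat).
Implicit Types X Y : 'cV[R]_n.

Definition regularized_gram X : 'M[R]_n :=
  (\matrix_(i < n, j < n) K (X i ord0) (X j ord0)) + (n%:R * lam)%:M.

Definition kernel_row X (x : R) : 'rV[R]_n :=
  \row_(i < n) kernel_deriv K k 0 x (X i ord0).

Definition kernel_col X (x' : R) : 'cV[R]_n :=
  \col_(i < n) kernel_deriv K 0 k (X i ord0) x'.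

Definition posterior_mean X Y (x : R) : R :=
  (kernel_row X x *m invmx (regularized_gram X) *m Y) ord0 ord0.

Definition posterior_cov X (x x' : R) : R :=
  sigma ^+ 2 / (n%:R * lam) *
  (kernel_deriv K k k x x' -
   (kernel_row X x *m invmx (regularized_gram X) *m kernel_col X x')
     ord0 ord0).

End posterior.

(* Normal law with mean m and variance v, a point mass when v = 0. *)
Definition normal_law (R : realType) (m v : R) (A : set R) : \bar R :=
  if v == 0 then dirac m A else normal_prob m (Num.sqrt v) A.

(* A Gaussian process on [0,1] with mean function m and covariance function V:
   all finite linear combinations of its values are normal with the prescribed
   mean and variance. Joint measurability makes the L^2 norms of paths
   measurable and determines their law from m and V. *)
Record gaussian_process (R : realType) (m : R -> R) (V : R -> R -> R) :=
  GaussianProcess {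
  gp_display : measure_display;
  gp_space : measurableType gp_display;
  gp_prob : probability gp_space R;
  gp_path : gp_space -> R -> R;
  gp_measurable : measurable_fun ((`[0, 1] : set R) `*` [set: gp_space])
    (fun p : R * gp_space => gp_path p.2 p.1);
  gp_normal : forall (p : nat) (t c : 'I_p -> R),
    (forall i, t i \in `[0, 1]) ->
    forall A : set R, measurable A ->
      gp_prob [set w | A (\sum_(i < p) c i * gp_path w (t i))] =
      normal_law (\sum_(i < p) c i * m (t i))
        (\sum_(i < p) \sum_(j < p) c i * c j * V (t i) (t j)) A }.

(* Taking some of the sets A i to be the whole space gives the product rule
   for every subfamily. *)
Definition mutually_independent (R : realType) (d : measure_display)
    (T : measurableType d) (P : probability T R) (I : finType)
    (Z : I -> T -> R) : Prop :=
  forall A : I -> set R, (forall i, measurable (A i)) ->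
    P (\bigcap_i (Z i @^-1` A i)) = (\big[*%E/1%E]_i P (Z i @^-1` A i))%E.

Definition has_law (R : realType) (d : measure_display)
    (T : measurableType d) (P : probability T R) (Z : T -> R)
    (Q : set R -> \bar R) : Prop :=
  forall A : set R, measurable A -> P (Z @^-1` A) = Q A.

Definition regression_design (R : realType) (d : measure_display)
    (Omega : measurableType d) (P : probability Omega R) (sigma : R) (n : nat)
    (X eps : 'I_n -> {RV P >-> R}) : Prop :=
  [/\ forall i, has_law P (X i) (uniform_prob (@ltr01 R)),
      forall i, has_law P (eps i) (normal_prob 0 sigma) &
      mutually_independent P
        (fun s : 'I_n + 'I_n =>
           match s with inl i => X i : Omega -> R | inr i => eps i end)].

Definition covariates (R : realType) (d : measure_display)
    (Omega : measurableType d) (P : probability Omega R) (n : nat)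
    (X : 'I_n -> {RV P >-> R}) (w : Omega) : 'cV[R]_n :=
  \col_(i < n) X i w.

Definition responses (R : realType) (d : measure_display)
    (Omega : measurableType d) (P : probability Omega R) (n : nat)
    (f0 : R -> R) (X eps : 'I_n -> {RV P >-> R}) (w : Omega) : 'cV[R]_n :=
  \col_(i < n) (f0 (X i w) + eps i w).

(* (P n)^* is the outer measure of P n, equal to P n on measurable sets; with it
   the measurability of p n need not be discussed. *)
Definition cvg0_in_probability (R : realType) (d : nat -> measure_display)
    (Omega : forall n, measurableType (d n))
    (P : forall n, probability (Omega n) R)
    (p : forall n, Omega n -> \bar R) : Prop :=
  forall eta : R, 0 < eta ->
    (fun n => (P n)^*%mu [set w | (eta%:E < p n w)%E]) @ \oo --> 0%E.

Definition rate (R : realType) (s : R) (n : nat) : R :=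
  (ln n%:R / n%:R) `^ s.

(* Main.v *)
Require Import Defs.
From HB Require Import structures.
From mathcomp Require Import all_boot all_order all_algebra.
From mathcomp Require Import all_classical all_reals all_analysis.
From mathcomp Require Import measurable_realfun.
From mathcomp Require Import zify ring lra.

Set Implicit Arguments.
Unset Strict Implicit.
Unset Printing Implicit Defensive.

Import Order.TTheory GRing.Theory Num.Theory.
Import numFieldTopology.Exports numFieldNormedType.Exports.

Local Open Scope classical_set_scope.
Local Open Scope ring_scope.

(** The posterior is Gaussian, so it contracts at the rate r as soon as its
    variance and the squared error of its mean, integrated over the unit
    interval, are both of order r ^ 2. Both are read off the coefficients in
    the Fourier basis, where differentiation multiplies a coefficient by a power
    of its frequency.

    Let m be the eigenvalues of the kernel and w = m / (m + lam). The posterior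
    mean is a kernel ridge fit with coefficients c; writing g = c - b for its
    error against the coefficients b of f0, the normal equations tested against
    g itself give an energy identity [ridge_energy]. Were the empirical inner
    product the population one, its left side would be the sum of g ^ 2 / w,
    which is the squared L2 norm of the error plus lam times its squared norm in
    the reproducing kernel space. The empirical Gram matrix of the basis is
    close enough to the identity in the Hilbert-Schmidt norm weighted by w for
    half of this quantity to survive [empirical_norm_ge], and the right side is
    controlled by a bias, lam times the sum of b ^ 2 / m, and by a noise term, the
    w-weighted energy of the empirical Fourier coefficients of the noise
    [weighted_error_le]. The random quantities are w-weighted sums of squares, so
    second moments and Markov's inequality control them [noise_event, gram_event].

    The same identity bounds the posterior variance at a point t, which is the
    noiseless ridge error of fitting the representer of the evaluation of the k-th
    derivative at t [posterior_cov_bounds].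

    What remains is the size of the spectral sums. With the cutoff
    z = lam ^ (- 1 / (2 alpha)), the weights w are at most 1 below frequency z
    and decay fast beyond, so the sum of w is at most of order z and each
    derivative costs a further factor z ^ 2 [weighted_shrinkage_le]. For the given
    lam one has z / n = O(lam), so that variance and bias are both at most of order
    z ^ (2 k) lam, which is the square of the contraction rate, and z ^ 2 / n
    tends to 0, which is the condition for the Gram matrix to be close to the
    identity.

    The link with f0 is Fourier inversion: f0 agrees almost everywhere with its
    absolutely convergent Fourier series, and the k-th derivative of the
    continuous version is the series of the differentiated terms
    [fourier_inversion, deriv_classE]. This uses the completeness of the
    trigonometric system, obtained from polynomials of cosine bumps that
    approximate indicators of intervals [fourier_complete]. *)

(** * Expectations through simple functions *)

Import HBNNSimple.

(** The right-hand side sees Z only through integrals over the events Z = r. *)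
Lemma integral_simple_limit (R : realType) d (T : measurableType d)
    (m : {measure set T -> \bar R}) (Z W : T -> R)
    (f : R -> \bar R) (mf : measurable_fun setT f) :
  measurable_fun setT Z -> measurable_fun setT W ->
  (forall x, 0 <= W x) -> (forall x, 0 <= f x)%E ->
  (\int[m]_x ((W x)%:E * f (Z x)) =
  limn (fun n => \sum_(r \in range (nnsfun_approx measurableT mf n))
     r%:E * \int[m]_x ((W x)%:E *
        (\1_(nnsfun_approx measurableT mf n @^-1` [set r]) (Z x))%:E)))%E.
Proof.
move=> mZ mW W0 f0.
pose h := nnsfun_approx measurableT mf.
have mhZ n : measurable_fun setT (fun x => h n (Z x)).
  by apply: measurableT_comp.
transitivity (limn (fun n => \int[m]_x ((W x)%:E * (h n (Z x))%:E))%E).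
  rewrite -monotone_convergence//=.
  - apply: eq_integral => x _; apply/esym/cvg_lim => //=.
    apply: cvgeZl => //.
    exact: (cvg_nnsfun_approx measurableT mf (fun x _ => f0 x) (x := Z x)).
  - move=> n; apply: emeasurable_funM => //; exact/measurable_EFinP.
  - by move=> n x _; rewrite mule_ge0// lee_fin.
  - move=> x _ a b ab; apply: lee_wpmul2l; rewrite lee_fin //.
    exact/lefP/nd_nnsfun_approx.
apply: congr_lim; apply/funext => n.
under eq_integral.
  move=> x _; rewrite fimfunE -fsumEFin// ge0_mule_fsumr; last first.
    by move=> r; rewrite EFinM nnfun_muleindic_ge0.
  over.
rewrite ge0_integral_fsum//; last 2 first.
  move=> r; apply: emeasurable_funM; first exact/measurable_EFinP.
  apply/measurable_EFinP/measurable_funM => //.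
  by apply: measurableT_comp.
  move=> r x _; rewrite mule_ge0 ?lee_fin//.
  by have := nnfun_muleindic_ge0 (h n) r (Z x); rewrite -EFinM lee_fin.
apply: eq_fsbigr => r _.
have [r0|r0] := leP 0 r.
  rewrite -ge0_integralZl//; last 2 first.
  - apply: emeasurable_funM; first exact/measurable_EFinP.
    by apply/measurable_EFinP; apply: measurableT_comp.
  - by move=> x _; rewrite mule_ge0 ?lee_fin.
  by apply: eq_integral => x _; rewrite EFinM muleCA.
have I0 a : (\int[m]_x ((W x)%:E * (a * \1_(h n @^-1` [set r]) (Z x))%:E) = 0)%E.
  rewrite preimage_nnfun0//; apply: integral0_eq => x _.
  by rewrite indicE in_set0 mulr0 mule0.
rewrite I0; have := I0 1; under eq_integral do rewrite mul1r.
by move=> ->; rewrite mule0.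
Qed.

(** Every nonnegative measurable function is an increasing limit of simple
    functions, so a weighted integral of functions of Z is determined by its
    values on the events Z in A. This transports expectations between a random
    variable, its law and a density, and is the extension step from events to
    functions in the product formula for independent variables. *)
Lemma integral_transport (R : realType) d1 d2
    (T1 : measurableType d1) (T2 : measurableType d2)
    (m1 : {measure set T1 -> \bar R}) (m2 : {measure set T2 -> \bar R})
    (Z1 W1 : T1 -> R) (Z2 W2 : T2 -> R) :
  measurable_fun setT Z1 -> measurable_fun setT W1 -> (forall x, 0 <= W1 x) ->
  measurable_fun setT Z2 -> measurable_fun setT W2 -> (forall x, 0 <= W2 x) ->
  (forall A : set R, measurable A ->
    \int[m1]_x ((W1 x)%:E * (\1_A (Z1 x))%:E) =
    \int[m2]_x ((W2 x)%:E * (\1_A (Z2 x))%:E))%E ->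
  forall f : R -> \bar R, measurable_fun setT f -> (forall x, 0 <= f x)%E ->
  (\int[m1]_x ((W1 x)%:E * f (Z1 x)) = \int[m2]_x ((W2 x)%:E * f (Z2 x)))%E.
Proof.
move=> mZ1 mW1 W10 mZ2 mW2 W20 h f mf f0.
rewrite (integral_simple_limit m1 mf mZ1 mW1 W10 f0).
rewrite (integral_simple_limit m2 mf mZ2 mW2 W20 f0).
apply: congr_lim; apply/funext => n; apply: eq_fsbigr => r _.
by rewrite h.
Qed.

Lemma markov_ge0 (R : realType) d (T : measurableType d)
    (P : {measure set T -> \bar R}) (J : T -> \bar R) (c : R) :
  measurable_fun setT J -> (forall w, 0 <= J w)%E -> 0 < c ->
  (c%:E * P [set w | (c%:E < J w)%E] <= \int[P]_w J w)%E.
Proof.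
move=> mJ J0 c0.
have mS : measurable [set w | (c%:E < J w)%E].
  by rewrite -[X in measurable X]setTI; exact: emeasurable_fun_o_infty.
rewrite -[in leLHS](setIT [set w | _]) -integral_indic// -ge0_integralZl//; last 2 first.
- exact/measurable_EFinP/measurable_indic.
- by rewrite lee_fin ltW.
apply: ge0_le_integral => //.
- by move=> x _; rewrite mule_ge0 ?lee_fin// ltW.
- by apply: measurable_funeM; exact/measurable_EFinP/measurable_indic.
- move=> x _; rewrite indicE; case: (boolP (x \in _)).
    by rewrite inE/= mule1; exact: ltW.
  by rewrite mule0.
Qed.

(** For a nondecreasing sequence a uniform bound on the expectations controls
    all the terms at once, without passing to the limit of the sequence. *)
Lemma markov_nondecreasing (R : realType) d (T : measurableType d)
    (P : {measure set T -> \bar R}) (U : nat -> T -> R) (B c : R) :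
  (forall n, measurable_fun setT (U n)) -> (forall n w, 0 <= U n w) ->
  (forall w, nondecreasing_seq (fun n => U n w)) -> 0 < c ->
  (forall n, \int[P]_w (U n w)%:E <= B%:E)%E ->
  measurable (\bigcup_n [set w | c < U n w]) /\
  (P (\bigcup_n [set w | (c < U n w)%R]) <= (B / c)%:E)%E.
Proof.
move=> mU U0 ndU c0 EU.
have mS n : measurable [set w | c < U n w].
  have := mU n measurableT `]c, +oo[%classic (measurable_itv _).
  by rewrite setTI preimage_itvoy.
split; first exact: bigcup_measurable.
have cv : (P \o (fun n => [set w | c < U n w])) @ \oo -->
    P (\bigcup_n [set w | c < U n w]).
  apply: nondecreasing_cvg_mu => //; first exact: bigcup_measurable.
  move=> a b ab; apply/subsetPset => w /= cw.
  by apply: (lt_le_trans cw); exact: ndU.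
rewrite -(cvg_lim _ cv)//.
apply: lime_le; first by apply/cvg_ex; eexists; exact: cv.
apply: nearW => n /=.
have := EU n.
have : (c%:E * P [set w | (c < U n w)%R] <= \int[P]_w (U n w)%:E)%E.
  have := @markov_ge0 _ _ _ P (fun w => (U n w)%:E) c.
  by apply => //; [exact/measurable_EFinP|move=> w; rewrite lee_fin].
move=> /le_trans h /h.
by rewrite EFinM lee_pdivlMr// muleC.
Qed.

(** * Series of numbers and of functions *)

Lemma dominated_cvg_series (R : realType) (u v : nat -> R) :
  (forall i, `|u i| <= v i) -> cvgn (series v) -> cvgn (series u).
Proof.
move=> uv cv; apply: normed_cvg; apply: (series_le_cvg _ _ _ cv) => //= i.
exact: le_trans (uv i).
Qed.

Lemma dominated_series_tail (R : realType) (u v : nat -> R) (N : nat) :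
  (forall i, `|u i| <= v i) -> cvgn (series v) ->
  `|limn (series u) - series u N| <= limn (series v) - series v N.
Proof.
move=> uv cv; have cu := dominated_cvg_series uv cv.
have c1 : (fun n => `|series u n - series u N|) @ \oo -->
    `|limn (series u) - series u N|.
  by apply: cvg_norm; apply: cvgB => //; exact: cvg_cst.
have c2 : (fun n => series v n - series v N) @ \oo -->
    limn (series v) - series v N.
  by apply: cvgB => //; exact: cvg_cst.
rewrite -(cvg_lim _ c1)// -(cvg_lim _ c2)//; apply: ler_lim.
- by apply/cvg_ex; eexists; exact: c1.
- by apply/cvg_ex; eexists; exact: c2.
near=> n; have Nn : (N <= n)%N by near: n; exact: nbhs_infty_ge.
rewrite !sub_series_geq//; apply: le_trans (ler_norm_sum _ _ _) _.
exact: ler_sum.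
Unshelve. all: by end_near. Qed.

Lemma mvt_lipschitz (R : realType) (f f' : R -> R) (B : R) :
  (forall x : R, is_derive x 1 f (f' x)) -> (forall x, `|f' x| <= B) ->
  forall x y, `|f y - f x| <= B * `|y - x|.
Proof.
move=> df bf.
have cf : continuous f.
  by move=> x; apply/differentiable_continuous/derivable1_diffP/ex_derive.
have H x y : x <= y -> `|f y - f x| <= B * `|y - x|.
  move=> xy; have [|c _ ->] := @MVT_segment _ f f' x y xy (fun z _ => df z).
    exact/continuous_subspaceT.
  by rewrite normrM ler_wpM2r.
move=> x y; have [xy|/ltW yx] := leP x y; first exact: H.
by rewrite distrC (distrC y); exact: H.
Qed.

(** A series of differentiable functions whose derivatives have summable bounds
    is differentiated term by term: by the mean value theorem the difference
    quotients obey the same bounds, so outside a finite sum both the quotient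
    and the candidate derivative are uniformly small. *)
Lemma is_derive_series (R : realType) (f f' : nat -> R -> R) (B : nat -> R) :
  (forall i (x : R), is_derive x 1 (f i) (f' i x)) ->
  (forall i x, `|f' i x| <= B i) -> cvgn (series B) ->
  (forall x, cvgn (series (f ^~ x))) ->
  forall x : R, is_derive x 1 (fun y => limn (series (f ^~ y)))
    (limn (series (f' ^~ x))).
Proof.
move=> df bf cB cf x.
pose F y := limn (series (f ^~ y)).
suff cq : h^-1 *: (F (h *: (1 : R) + x) - F x) @[h --> 0^'] -->
    limn (series (f' ^~ x)).
  apply: DeriveDef; first by apply/cvg_ex; eexists; exact: cq.
  exact/cvg_lim.
apply/cvgrPdist_le => e e0.
have e3 : 0 < e / 3 by rewrite divr_gt0.
have [N _ HN] : \forall N \near \oo, limn (series B) - series B N <= e / 3.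
  have /cvgrPdist_le/(_ _ e3) := cB; apply: filterS => N.
  by apply: le_trans; exact: ler_norm.
have {}HN := HN N (leqnn N).
have dS : is_derive x 1 (fun y => series (f ^~ y) N) (series (f' ^~ x) N).
  have := @is_derive_sum R R R N (fun i => f i) x 1 (fun i => f' i x)
    (fun i => df i x).
  rewrite /series /=; rewrite big_mkord; congr is_derive.
  by apply/funext => y; rewrite big_mkord fct_sumE.
have := @ex_derive _ _ _ _ _ _ _ dS.
move=> /cvg_ex[l cl]; have ll : l = series (f' ^~ x) N.
  by rewrite -(@derive_val _ _ _ _ _ _ _ dS); apply/esym/cvg_lim.
move: cl; rewrite ll => /cvgrPdist_le/(_ _ e3).
apply: filter_app; near=> h => /= Hh.
have h0 : h != 0 by near: h; exact: nbhs_dnbhs_neq.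
pose q i := h^-1 * (f i (h *: (1 : R) + x) - f i x).
have qB i : `|q i| <= B i.
  rewrite normrM; have := mvt_lipschitz (df i) (bf i) x (h *: (1 : R) + x).
  rewrite addrK [_ *: _]mulr1 normfV => /(ler_wpM2l (_ : 0 <= `|h|^-1)).
  rewrite invr_ge0 normr_ge0 => /(_ isT) /le_trans -> //.
  by rewrite mulrCA mulVf ?mulr1 ?normr_eq0.
have qE M : series q M =
    h^-1 * (series (f ^~ (h *: (1 : R) + x)) M - series (f ^~ x) M).
  by rewrite /series /= -sumrB mulr_sumr.
have Q : limn (series q) = h^-1 * (F (h *: (1 : R) + x) - F x).
  rewrite (_ : series q = fun M => h^-1 *
     (series (f ^~ (h *: (1 : R) + x)) M - series (f ^~ x) M)).
    apply/cvg_lim => //; apply: cvgZl_tmp; apply: cvgB; exact: cf.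
  exact/funext.
have T1 := dominated_series_tail N (fun i => bf i x) cB.
have T2 := dominated_series_tail N qB cB.
rewrite [X in `|_ - X|](_ : _ = limn (series q)); last by rewrite Q.
have {}Hh : `|series (f' ^~ x) N - series q N| <= e / 3 by rewrite qE.
have -> : limn (series (f' ^~ x)) - limn (series q) =
  (limn (series (f' ^~ x)) - series (f' ^~ x) N) +
  (series (f' ^~ x) N - series q N) - (limn (series q) - series q N) by ring.
rewrite (le_trans (ler_normB _ _))// (le_trans (lerD (ler_normD _ _) (lexx _)))//.
lra.
Unshelve. all: by end_near. Qed.

Section series_lemmas.
Variable R : realType.
Implicit Types u v : nat -> R.

Lemma eq_cvg_series u v : (forall i, u i = v i) ->
  cvgn (series u) -> cvgn (series v).
Proof. by move=> /funext ->. Qed.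

Lemma nonneg_series_le u N M : (forall i, 0 <= u i) -> (N <= M)%N ->
  series u N <= series u M.
Proof.
move=> u0 NM; rewrite -subr_ge0 sub_series_geq//.
by apply: sumr_ge0 => i _; exact: u0.
Qed.

Lemma bounded_cvg_series u (B : R) : (forall i, 0 <= u i) ->
  (forall N, series u N <= B) -> cvgn (series u).
Proof.
move=> u0 uB; apply: nondecreasing_is_cvgn.
  by move=> m n; exact: nonneg_series_le.
by exists B => _ [N _ <-].
Qed.

Lemma series_le_lim u N : (forall i, 0 <= u i) -> cvgn (series u) ->
  series u N <= limn (series u).
Proof.
by move=> u0 cu; apply: nondecreasing_cvgn_le => // m n; exact: nonneg_series_le.
Qed.

(** The bound telescopes: 1 / (a + 1) ^ 2 <= 1 / a - 1 / (a + 1). *)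
Lemma sum_shifted_inv_sqr (z : R) N : 0 < z ->
  series (fun i => (z + i.+1%:R) ^- 2) N <= z^-1.
Proof.
move=> z0; suff H : series (fun i => (z + i.+1%:R) ^- 2) N <= z^-1 - (z + N%:R)^-1.
  by apply: le_trans H _; rewrite gerBl invr_ge0 addr_ge0// ltW.
elim: N => [|N IH]; first by rewrite /series /= big_geq// addr0 subrr.
rewrite seriesSr; apply: le_trans (lerD IH (lexx _)) _.
rewrite -natr1 addrA; have : 0 < z + N%:R by rewrite ltr_pwDl.
move: (z + N%:R) => a a0; have b0 : 0 < a + 1 by rewrite ltr_wpDl// ltW.
rewrite -subr_ge0 (_ : _ - _ = (a * (a + 1) ^+ 2)^-1).
  by rewrite invr_ge0 mulr_ge0 ?exprn_ge0// ltW.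
by field; rewrite !gt_eqF.
Qed.

Lemma cvg_series_inv_sqr : cvgn (series (fun i => i.+1%:R ^- 2 : R)).
Proof.
apply: (@bounded_cvg_series _ 4) => [i|N]; first by rewrite invr_ge0 exprn_ge0.
apply: (@le_trans _ _ (4 * series (fun i => (1 + i.+1%:R) ^- 2) N)); last first.
  by rewrite -[leRHS]mulr1 ler_wpM2l// -[leRHS]invr1 sum_shifted_inv_sqr.
rewrite /series /= mulr_sumr; apply: ler_sum => i _.
have i1 : 1 <= i.+1%:R :> R by rewrite ler1n.
have i0 : 0 < i.+1%:R :> R by rewrite ltr0n.
move: (i.+1%:R) i1 i0 => a a1 a0.
rewrite ler_pdivlMr ?exprn_gt0 ?addr_gt0// mulrC ler_pdivrMr ?exprn_gt0//.
rewrite -subr_ge0 (_ : _ - _ = (a - 1) * (3 * a + 1)); last by ring.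
by rewrite mulr_ge0//; lra.
Qed.

(** A finite sum is continuous and the tails are uniformly small. *)
Lemma continuous_series (f : nat -> R -> R) (B : nat -> R) :
  (forall i, continuous (f i)) -> (forall i x, `|f i x| <= B i) ->
  cvgn (series B) -> continuous (fun x => limn (series (f ^~ x))).
Proof.
move=> cf fB cB x; apply/cvgrPdist_le => e e0.
have e3 : 0 < e / 3 by rewrite divr_gt0.
have [N _ HN] : \forall N \near \oo, limn (series B) - series B N <= e / 3.
  have /cvgrPdist_le/(_ _ e3) := cB; apply: filterS => N.
  by apply: le_trans; exact: ler_norm.
have {}HN := HN N (leqnn N).
have cN : continuous (fun y => series (f ^~ y) N).
  elim: (N) => [|n IH] y.
    by rewrite /series; under eq_fun do rewrite /= big_geq//; exact: cvg_cst.
  by under eq_fun do rewrite seriesSr; apply: cvgD; [exact: IH|exact: cf].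
have /cvgrPdist_le/(_ _ e3) := cN x; apply: filterS => y Hy.
have T1 := dominated_series_tail N (fun i => fB i x) cB.
have T2 := dominated_series_tail N (fun i => fB i y) cB.
have -> : limn (series (f ^~ x)) - limn (series (f ^~ y)) =
  (limn (series (f ^~ x)) - series (f ^~ x) N) +
  (series (f ^~ x) N - series (f ^~ y) N) - (limn (series (f ^~ y)) - series (f ^~ y) N) by ring.
rewrite (le_trans (ler_normB _ _))// (le_trans (lerD (ler_normD _ _) (lexx _)))//.
lra.
Qed.

Lemma lim_series_mull (a : R) u : cvgn (series u) ->
  limn (series (fun i => a * u i)) = a * limn (series u).
Proof.
move=> cu; rewrite (_ : series _ = fun N => a * series u N).
  by apply/cvg_lim => //; apply: cvgM; [exact: cvg_cst|exact: cu].
by apply/funext => N; rewrite /series /= mulr_sumr.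
Qed.

Lemma is_cvg_series_mull (a : R) u : cvgn (series u) ->
  cvgn (series (fun i => a * u i)).
Proof.
move=> cu; rewrite (_ : series _ = fun N => a * series u N).
  by apply: is_cvgM => //; exact: is_cvg_cst.
by apply/funext => N; rewrite /series /= mulr_sumr.
Qed.

Lemma is_cvg_series_add u v : cvgn (series u) -> cvgn (series v) ->
  cvgn (series (fun i => u i + v i)).
Proof.
move=> cu cv; rewrite (_ : series _ = fun N => series u N + series v N).
  exact: is_cvgD.
by apply/funext => N; rewrite /series /= big_split.
Qed.

Lemma lim_series_add u v : cvgn (series u) -> cvgn (series v) ->
  limn (series (fun i => u i + v i)) = limn (series u) + limn (series v).
Proof.
move=> cu cv; rewrite (_ : series _ = fun N => series u N + series v N).
  by rewrite limD.
by apply/funext => N; rewrite /series /= big_split.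
Qed.

End series_lemmas.

(** * The trigonometric system *)

Section fourier_derivatives.
Variable R : realType.
Implicit Types (k i j : nat) (x : R).
Local Notation leb := (@lebesgue_measure R).

Definition freq i : R := 2 * pi * (i.+1./2)%:R.

Definition amplitude i : R := if i == 0%N then 1 else Num.sqrt 2.

Definition phase i : R := if (i == 0%N) || odd i then 0 else - (pi / 2).

(** The k-th derivative of the basis function of index i.+1. Writing sines as
    shifted cosines makes a derivative a further shift by pi / 2, so that one
    formula serves all k and i. *)
Definition fourier_deriv k i x : R :=
  amplitude i * freq i ^+ k * cos (freq i * x + phase i + k%:R * (pi / 2)).

Lemma fourier_deriv0 i x : fourier_deriv 0 i x = fourier_basis i.+1 x.
Proof.
rewrite /fourier_deriv /fourier_basis expr0 mulr1 mul0r addr0 eqSS.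
rewrite /amplitude /phase /freq; case: i => [|i] /=.
  by rewrite mulr0 mul0r addr0 cos0 mul1r.
rewrite negbK; case: (odd i) => /=; first by rewrite cosBpihalf.
by rewrite addr0.
Qed.

Lemma is_derive_fourier_deriv k i x :
  is_derive x 1 (fourier_deriv k i) (fourier_deriv k.+1 i x).
Proof.
pose f (y : R) := freq i * y + (phase i + k%:R * (pi / 2)).
have df : is_derive x 1 f (freq i).
  have -> : f = (freq i *: (@idfun R) + cst (phase i + k%:R * (pi / 2))).
    by apply/funext => y; rewrite !fctE.
  apply: is_derive_eq; by rewrite addr0 [_ *: _]mulr1.
have dc := is_derive1_comp (is_derive_cos (f x)) df.
have := @is_deriveZ _ _ _ _ (amplitude i * freq i ^+ k) _ _ _ dc.
rewrite [X in is_derive _ _ X](_ : _ = fourier_deriv k i); last first.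
  by apply/funext => y; rewrite /fourier_deriv -addrA.
rewrite [X in is_derive _ _ _ X](_ : _ = fourier_deriv k.+1 i x) //.
rewrite /fourier_deriv exprS -natr1 mulrDl mul1r !addrA cosDpihalf -addrA -/(f x).
by rewrite [LHS](_ : _ = amplitude i * freq i ^+ k * (- sin (f x) * freq i)) //; ring.
Qed.

Lemma continuous_fourier_deriv k i : continuous (fourier_deriv k i).
Proof.
move=> x; apply/differentiable_continuous/derivable1_diffP.
exact: (@ex_derive _ _ _ _ _ _ _ (is_derive_fourier_deriv k i x)).
Qed.

Lemma freq_ge0 i : 0 <= freq i.
Proof. by rewrite !mulr_ge0// pi_ge0. Qed.

Lemma freq_le i : freq i <= 4 * i.+1%:R.
Proof.
have pi4 : pi <= 4 :> R by have := @pihalf_lt2 R; lra.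
have h : 2 * (i.+1./2)%:R <= i.+1%:R :> R.
  by rewrite -natrM ler_nat mul2n -[leqRHS](odd_double_half i.+1) leq_addl.
rewrite /freq mulrAC mulrC; apply: ler_pM => //; exact: pi_ge0.
Qed.

Lemma normr_fourier_deriv k i x :
  `|fourier_deriv k i x| <= 2 * freq i ^+ k.
Proof.
rewrite !normrM (ger0_norm (exprn_ge0 _ (freq_ge0 _))).
have s2 : Num.sqrt 2 <= 2 :> R.
  by rewrite -(ler_pXn2r (n:=2))// ?nnegrE ?sqrtr_ge0// sqr_sqrtr//; lra.
have a2 : `|amplitude i| <= 2.
  by rewrite /amplitude; case: ifP => _; rewrite ger0_norm// ?sqrtr_ge0//; lra.
rewrite -[leRHS]mulr1; apply: ler_pM => //.
- by rewrite mulr_ge0// exprn_ge0// freq_ge0.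
- by rewrite ler_wpM2r// exprn_ge0// freq_ge0.
- by rewrite ler_norml cos_geN1 cos_le1.
Qed.

Lemma normr_fourier_deriv_le k i x :
  `|fourier_deriv k i x| <= 2 * 4 ^+ k * i.+1%:R ^+ k.
Proof.
apply: (le_trans (normr_fourier_deriv k i x)).
by rewrite -mulrA -exprMn ler_wpM2l// lerXn2r ?nnegrE ?freq_ge0 ?freq_le// mulr_ge0.
Qed.

Lemma normr_fourier_basis_le i x : `|fourier_deriv 0 i x| <= 2.
Proof. by have := normr_fourier_deriv 0 i x; rewrite expr0 mulr1. Qed.

Lemma continuous_integrable01 (f : R -> R) : continuous f ->
  leb.-integrable `[0, 1] (EFin \o f).
Proof.
move=> cf; apply: continuous_compact_integrable; first exact: segment_compact.
exact: continuous_subspaceT.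
Qed.

Lemma Rintegral_cos_period (m : nat) (c : R) : (0 < m)%N ->
  \int[leb]_(x in `[0, 1]) cos (2 * pi * m%:R * x + c) = 0.
Proof.
move=> m0; pose w : R := 2 * pi * m%:R.
have w0 : w != 0 by rewrite /w !mulf_neq0 ?gt_eqF ?pi_gt0 ?ltr0n.
pose G (x : R) := w^-1 * sin (w * x + c).
have dG (x : R) : is_derive x 1 G (cos (w * x + c)).
  pose f (y : R) := w * y + c.
  have df : is_derive x 1 f w.
    have -> : f = (w *: (@idfun R) + cst c).
      by apply/funext => y; rewrite !fctE.
    apply: is_derive_eq; by rewrite addr0 [_ *: _]mulr1.
  have dc := is_derive1_comp (is_derive_sin (f x)) df.
  have := @is_deriveZ _ _ _ _ w^-1 _ _ _ dc.
  rewrite [X in is_derive _ _ X](_ : _ = G) //.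
  rewrite [X in is_derive _ _ _ X](_ : _ = cos (f x)) //.
  by rewrite [LHS](_ : _ = w^-1 * (cos (f x) * w)) // mulrCA mulVf ?mulr1.
have cG : continuous G.
  move=> x; apply/differentiable_continuous/derivable1_diffP.
  exact: (@ex_derive _ _ _ _ _ _ _ (dG x)).
rewrite /Rintegral (@continuous_FTC2 _ _ G) //.
- suff -> : G 1 = G 0 by rewrite subee.
  rewrite /G mulr0 add0r mulr1 addrC.
  have -> : w = pi *+ 2 *+ m by rewrite /w -[_ *+ m]mulr_natr -[pi *+ 2]mulr_natr; ring.
  by rewrite (periodicn (@sinD2pi R)).
- apply: continuous_subspaceT => x; apply: continuous_comp; last exact: continuous_cos.
  apply: cvgD; last exact: cvg_cst.
  by apply: cvgM; [exact: cvg_cst|exact: cvg_id].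
- split; first by move=> x _; exact: (@ex_derive _ _ _ _ _ _ _ (dG x)).
  + exact/cvg_at_right_filter/cG.
  + exact/cvg_at_left_filter/cG.
- by move=> x _; rewrite derive1E (@derive_val _ _ _ _ _ _ _ (dG x)).
Qed.

End fourier_derivatives.

Section orthogonality.
Variable R : realType.
Implicit Types (k i j : nat) (x : R).
Local Notation leb := (@lebesgue_measure R).

Lemma Rintegral01_cst (c : R) : \int[leb]_(x in `[0, 1]) c = c.
Proof.
rewrite Rintegral_cst//= lebesgue_measure_itv/= lte_fin ltr01.
by rewrite -EFinB/= subr0 mulr1.
Qed.

Lemma Rintegral01D (f g : R -> R) : continuous f -> continuous g ->
  \int[leb]_(x in `[0, 1]) (f x + g x) =
  \int[leb]_(x in `[0, 1]) f x + \int[leb]_(x in `[0, 1]) g x.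
Proof. by move=> cf cg; rewrite RintegralD//; exact: continuous_integrable01. Qed.

Lemma Rintegral01Z (c : R) (f : R -> R) : continuous f ->
  \int[leb]_(x in `[0, 1]) (c * f x) = c * \int[leb]_(x in `[0, 1]) f x.
Proof. by move=> cf; rewrite RintegralZl//; exact: continuous_integrable01. Qed.

Lemma continuous_cos_affine (a b : R) : continuous (fun x : R => cos (a * x + b)).
Proof.
move=> x; apply: continuous_comp; last exact: continuous_cos.
apply: cvgD; last exact: cvg_cst.
by apply: cvgM; [exact: cvg_cst|exact: cvg_id].
Qed.

Lemma continuous_mulR (f g : R -> R) : continuous f -> continuous g ->
  continuous (fun x : R => f x * g x).
Proof. by move=> cf cg x; apply: cvgM; [exact: cf|exact: cg]. Qed.

Lemma fourier_derivM k i j x : fourier_deriv k i x * fourier_deriv k j x =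
  amplitude R i * amplitude R j * (freq R i * freq R j) ^+ k / 2 *
  (cos ((freq R i - freq R j) * x + (phase R i - phase R j)) +
   cos ((freq R i + freq R j) * x + (phase R i + phase R j + k%:R * pi))).
Proof.
rewrite /fourier_deriv (exprMn _ (freq R i)).
set a := freq R i * x + phase R i + _; set b := freq R j * x + phase R j + _.
have -> : (freq R i - freq R j) * x + (phase R i - phase R j) = a - b.
  by rewrite /a /b; ring.
have -> : (freq R i + freq R j) * x + (phase R i + phase R j + k%:R * pi) = a + b.
  rewrite /a /b (_ : k%:R * pi = k%:R * (pi / 2) + k%:R * (pi / 2) :> R); first ring.
  by rewrite -mulrDr -splitr.
rewrite (cosB a) (cosD a); move: (freq R i ^+ k) (freq R j ^+ k) (cos a)
  (cos b) (sin a) (sin b) (amplitude R i) (amplitude R j).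
by move=> *; field.
Qed.

(** Distinct basis functions of equal frequency are a cosine and the sine with
    the same argument. *)
Lemma half_eq_cases i j : i != j -> i.+1./2 = j.+1./2 ->
  (0 < i)%N /\ (0 < j)%N /\ odd i = ~~ odd j.
Proof.
move=> ij e; have := odd_double_half i.+1; have := odd_double_half j.+1.
by move: ij; rewrite e /=; case: (odd i); case: (odd j) => /= /eqP; lia.
Qed.

(** Differentiation only shifts phases and rescales, so the derivatives of the
    basis stay orthogonal and norms of differentiated series are weighted
    square sums of the coefficients. *)
Lemma fourier_deriv_orthogonal k i j :
  \int[leb]_(x in `[0, 1]) (fourier_deriv k i x * fourier_deriv k j x) =
  if i == j then freq R i ^+ (2 * k) else 0.
Proof.
under eq_Rintegral do rewrite fourier_derivM.
rewrite Rintegral01Z; last first.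
  by move=> x; apply: cvgD; exact: continuous_cos_affine.
rewrite Rintegral01D; [|exact: continuous_cos_affine..].
have fE l : freq R l = 2 * pi * (l.+1./2)%:R by [].
have plus c : (0 < i.+1./2 + j.+1./2)%N ->
    \int[leb]_(x in `[0, 1]) cos ((freq R i + freq R j) * x + c) = 0.
  move=> ij; rewrite -[RHS](Rintegral_cos_period c ij).
  by apply: eq_Rintegral => x _; rewrite natrD mulrDr -!fE.
have [<-{j plus fE}|ij] := eqVneq i j.
  rewrite subrr; under eq_Rintegral do rewrite mul0r add0r subrr cos0.
  rewrite Rintegral01_cst.
  case: i => [|i].
    rewrite /freq /phase /amplitude /= !mulr0.
    under eq_Rintegral do rewrite addr0 mul0r !add0r.
    rewrite Rintegral01_cst; case: k => [|k]; last by rewrite mulnS !expr0n/= !(mulr0, mul0r).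
    by rewrite muln0 mul0r cos0 !expr0; lra.
  have fE l : freq R l = 2 * pi * (l.+1./2)%:R by [].
  have -> : \int[leb]_(x in `[0, 1]) cos ((freq R i.+1 + freq R i.+1) * x +
      (phase R i.+1 + phase R i.+1 + k%:R * pi)) = 0.
    have ii : (0 < i.+2./2 + i.+2./2)%N by [].
    rewrite -[RHS](Rintegral_cos_period (phase R i.+1 + phase R i.+1 + k%:R * pi) ii).
    by apply: eq_Rintegral => x _; congr (cos (_ * x + _)); rewrite (natrD _ i.+2./2) mulrDr.
  rewrite addr0 mulr1 /amplitude /= -expr2 sqr_sqrtr// -expr2 -exprM mulrC mulrA mulVf//.
  by rewrite mul1r.
have [pq|pq] := eqVneq i.+1./2 j.+1./2.
  have [i0 [j0 o]] := half_eq_cases ij pq.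
  rewrite plus; last by case: (i) i0.
  rewrite addr0 !fE pq subrr.
  under eq_Rintegral do rewrite mul0r add0r.
  suff -> : cos (phase R i - phase R j) = 0 by rewrite Rintegral01_cst mulr0.
  rewrite /phase o !gtn_eqF//=; case: (odd j) => /=; first by rewrite subr0 cosN cos_pihalf.
  by rewrite sub0r opprK cos_pihalf.
rewrite plus; last by move: pq; case: (i.+1./2) (j.+1./2) => [|a] [|b].
rewrite addr0; set d := phase R i - phase R j.
suff -> : \int[leb]_(x in `[0, 1]) cos ((freq R i - freq R j) * x + d) = 0.
  by rewrite mulr0.
case: (ltnP j.+1./2 i.+1./2) => ltpq.
  rewrite -subn_gt0 in ltpq; rewrite -[RHS](Rintegral_cos_period d ltpq).
  apply: eq_Rintegral => x _; congr (cos (_ * _ + _)).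
  by rewrite !fE natrB ?mulrBr//; rewrite subn_gt0 in ltpq; exact: ltnW.
have {}ltpq : (i.+1./2 < j.+1./2)%N by rewrite ltn_neqAle pq.
rewrite -subn_gt0 in ltpq; rewrite -[RHS](Rintegral_cos_period (- d) ltpq).
apply: eq_Rintegral => x _; rewrite -cosN; congr cos.
rewrite !fE natrB ?mulrBr; first ring.
by rewrite subn_gt0 in ltpq; exact: ltnW.
Qed.

Lemma continuous_fourier_sum k (c : nat -> R) N :
  continuous (fun x => series (fun i => c i * fourier_deriv k i x) N).
Proof.
elim: N => [|N IH].
  by move=> x; rewrite /series; under eq_fun do rewrite /= big_geq//; exact: cvg_cst.
move=> x; under eq_fun do rewrite seriesSr.
apply: cvgD; first exact: IH.
by apply: cvgM; [exact: cvg_cst|exact: continuous_fourier_deriv].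
Qed.

Lemma Rintegral_fourier_sum_orthogonal k (c : nat -> R) N M : (N <= M)%N ->
  \int[leb]_(x in `[0, 1])
    (series (fun i => c i * fourier_deriv k i x) N * fourier_deriv k M x) = 0.
Proof.
elim: N => [_|N IH NM].
  under eq_Rintegral do rewrite /series/= big_geq// mul0r.
  exact: Rintegral01_cst.
under eq_Rintegral do rewrite seriesSr mulrDl -mulrA.
rewrite Rintegral01D; last 2 first.
- by apply: continuous_mulR; [exact: continuous_fourier_sum|exact: continuous_fourier_deriv].
- apply: continuous_mulR; first by move=> x; exact: cvg_cst.
  by apply: continuous_mulR; exact: continuous_fourier_deriv.
rewrite IH ?(ltnW NM)// add0r Rintegral01Z; last first.
  by apply: continuous_mulR; exact: continuous_fourier_deriv.
by rewrite fourier_deriv_orthogonal ltn_eqF// mulr0.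
Qed.

Lemma Rintegral_sqr_fourier_sum k (c : nat -> R) N :
  \int[leb]_(x in `[0, 1]) (series (fun i => c i * fourier_deriv k i x) N) ^+ 2
  = series (fun i => c i ^+ 2 * freq R i ^+ (2 * k)) N.
Proof.
elim: N => [|N IH].
  rewrite /series/= big_geq//; under eq_Rintegral do rewrite big_geq// expr0n/=.
  exact: Rintegral01_cst.
rewrite seriesSr -IH.
have E x : series (fun i => c i * fourier_deriv k i x) N.+1 ^+ 2 =
    series (fun i => c i * fourier_deriv k i x) N ^+ 2 +
    (2 * c N * (series (fun i => c i * fourier_deriv k i x) N * fourier_deriv k N x) +
    c N ^+ 2 * (fourier_deriv k N x * fourier_deriv k N x)).
  by rewrite seriesSr; ring.
under eq_Rintegral do rewrite E.
have c1 : continuous (fun x =>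
    series (fun i => c i * fourier_deriv k i x) N * fourier_deriv k N x).
  by apply: continuous_mulR; [exact: continuous_fourier_sum|exact: continuous_fourier_deriv].
have c2 : continuous (fun x : R => fourier_deriv k N x * fourier_deriv k N x).
  by apply: continuous_mulR; exact: continuous_fourier_deriv.
have cc (a : R) : continuous (fun _ : R => a) by move=> x; exact: cvg_cst.
have c0 : continuous (fun x => series (fun i => c i * fourier_deriv k i x) N ^+ 2).
  under eq_fun do rewrite expr2; by apply: continuous_mulR; exact: continuous_fourier_sum.
have c3 := continuous_mulR (cc (2 * c N)) c1.
have c4 := continuous_mulR (cc (c N ^+ 2)) c2.
rewrite Rintegral01D//; last first.
  by move=> x; apply: cvgD; [exact: c3|exact: c4].
rewrite Rintegral01D//.
rewrite !Rintegral01Z// Rintegral_fourier_sum_orthogonal//.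
by rewrite fourier_deriv_orthogonal eqxx mulr0 add0r.
Qed.

(** Half of Parseval's identity: Fatou's lemma passes from the partial sums to
    the limit. *)
Lemma integral_sqr_fourier_series_le k (c : nat -> R) (B : R) (D : set R) :
  measurable D -> D `<=` `[0, 1] ->
  (forall x, cvgn (series (fun i => c i * fourier_deriv k i x))) ->
  (forall N, series (fun i => c i ^+ 2 * freq R i ^+ (2 * k)) N <= B) ->
  (\int[leb]_(x in D)
     ((limn (series (fun i => (c i * fourier_deriv k i x)%R))) ^+ 2)%:E <= B%:E)%E.
Proof.
move=> mD D01 cv le_B.
pose s N x := series (fun i => c i * fourier_deriv k i x) N.
have cs N : continuous (s N) by exact: continuous_fourier_sum.
have ms N : measurable_fun setT (fun x => ((s N x) ^+ 2)%:E).
  by apply/measurable_EFinP/measurable_funX; exact: continuous_measurable_fun.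
have c2 N : continuous (fun x => s N x ^+ 2).
  by move=> x; apply: (@cvgM _ _ _ _ (s N) (s N)); exact: cs.
have F := @fatou _ _ _ leb D mD (fun N x => ((s N x) ^+ 2)%:E)
  (fun N => measurable_funTS (ms N))
  (fun N x _ => sqr_ge0 (s N x) : (0 <= (s N x ^+ 2)%:E)%E).
apply: le_trans (le_trans F _).
  rewrite le_eqVlt; apply/orP; left; apply/eqP; apply: eq_integral => x _.
  have cx : (fun N => ((s N x) ^+ 2)%:E) @ \oo -->
      ((limn (series (fun i => c i * fourier_deriv k i x))) ^+ 2)%:E.
    apply/cvg_EFin; first exact: nearW.
    by apply: (@cvgM _ _ _ _ (s ^~ x) (s ^~ x)); exact: cv.
  by rewrite (cvg_limn_einf_sup cx).1.
rewrite limn_einf_lim; apply: lime_le; first exact: is_cvg_einfs.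
apply: nearW => N; apply: (@le_trans _ _ (\int[leb]_(x in D) ((s N x) ^+ 2)%:E)%E).
  by apply: ereal_inf_lbound; exists N => //=.
have I01 : (\int[leb]_(x in `[0%R, 1%R]) ((s N x) ^+ 2)%:E)%E =
    (series (fun i => c i ^+ 2 * freq R i ^+ (2 * k)) N)%:E.
  rewrite -Rintegral_sqr_fourier_sum /Rintegral fineK//.
  apply: integrable_fin_num => //; exact: continuous_integrable01 (c2 N).
apply: (@le_trans _ _ (\int[leb]_(x in `[0%R, 1%R]) ((s N x) ^+ 2)%:E)%E).
  apply: ge0_subset_integral => //; first exact: (measurable_funTS (ms N)).
  by move=> x _; rewrite lee_fin sqr_ge0.
by rewrite I01 lee_fin.
Qed.

End orthogonality.

(** * Completeness of the trigonometric system *)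

Section completeness.
Variable R : realType.
Local Notation leb := (@lebesgue_measure R).

(** Iterates of t |-> (3 t - t ^ 3) / 2, which push [-1, 1] towards the signs:
    polynomials that converge boundedly to the sign function. *)
Fixpoint sign_poly (n : nat) : {poly R} :=
  if n is m.+1 then (3 / 2) *: sign_poly m - 2^-1 *: sign_poly m ^+ 3 else 'X.

Lemma horner_sign_polyS n (t : R) : (sign_poly n.+1).[t] =
  (3 * (sign_poly n).[t] - (sign_poly n).[t] ^+ 3) / 2.
Proof. by rewrite /= !hornerE /=; field. Qed.

Lemma horner_sign_polyN n (t : R) : (sign_poly n).[- t] = - (sign_poly n).[t].
Proof.
elim: n => [|n IH]; first by rewrite /= !hornerE.
by rewrite !horner_sign_polyS IH; field.
Qed.

Lemma sign_poly_gt0 n (t : R) : 0 < t <= 1 ->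
  t <= (sign_poly n).[t] <= 1 /\ 1 - (sign_poly n).[t] <= (1 - t / 2) ^+ n.
Proof.
move=> /andP[t0 t1]; elim: n => [|n [/andP[a b] c]].
  by rewrite /= hornerX expr0 lexx t1; split => //; lra.
rewrite horner_sign_polyS; set s := (sign_poly n).[t] in a b c *.
have e : 1 - (3 * s - s ^+ 3) / 2 = (1 - s) * (1 - s) * (2 + s) / 2 by field.
have d : s <= (3 * s - s ^+ 3) / 2.
  have -> : (3 * s - s ^+ 3) / 2 = s + s * (1 - s) * (1 + s) / 2 by field.
  by rewrite lerDl !mulr_ge0//; lra.
split.
  apply/andP; split; first exact: le_trans d.
  by rewrite -subr_ge0 e !mulr_ge0//; lra.
rewrite e exprS mulrC.
have -> : 2^-1 * ((1 - s) * (1 - s) * (2 + s)) =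
  ((1 - s) * (2 + s) / 2) * (1 - s) by field.
apply: ler_pM => //; [|lra|nra].
by rewrite !mulr_ge0//; lra.
Qed.

Lemma normr_sign_poly n (t : R) : `|t| <= 1 -> `|(sign_poly n).[t]| <= 1.
Proof.
move=> t1; wlog t0 : t t1 / 0 <= t.
  move=> H; have [/H|/ltW t0] := leP 0 t; first exact.
  by rewrite -normrN -horner_sign_polyN; apply: H; rewrite ?normrN ?oppr_ge0.
move: t0; rewrite le_eqVlt => /orP[/eqP<-|t0].
  elim: n => [|n IH]; first by rewrite /= hornerX normr0.
  suff -> : (sign_poly n.+1).[0] = 0 by rewrite normr0.
  have := horner_sign_polyN n.+1 0; rewrite oppr0; lra.
have [|/andP[a b] _] := @sign_poly_gt0 n t.
  by rewrite t0/= -(ger0_norm (ltW t0)).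
by rewrite ger0_norm//; lra.
Qed.

Lemma cvg_sign_poly (t : R) : 0 < t <= 1 -> (sign_poly n).[t] @[n --> \oo] --> (1 : R).
Proof.
move=> t01; have /andP[t0 t1] := t01.
apply/cvgrPdist_le => e e0.
have : `|1 - t / 2| < 1 by rewrite ger0_norm; lra.
move=> /cvg_expr/cvgrPdist_le/(_ e e0); apply: filterS => n.
have [/andP[a b] c] := sign_poly_gt0 n t01.
rewrite sub0r normrN !ger0_norm ?exprn_ge0//; [exact: le_trans|lra|lra].
Qed.

Variable r : R -> R.
Hypothesis ir : leb.-integrable `[0, 1] (EFin \o r).

Lemma integrable_mul_continuous (h : R -> R) : continuous h ->
  leb.-integrable `[0, 1] (EFin \o (fun x => r x * h x)).
Proof.
move=> ch.
have cn : {within `[0, 1], continuous (fun x : R => `|h x|)}.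
  apply: continuous_subspaceT => x; apply: cvg_norm; exact: ch.
have [c _ hc] := EVT_max (@ler01 R) cn.
rewrite (_ : EFin \o _ = ((EFin \o h) \* (EFin \o r))%E); last first.
  by apply/funext => x /=; rewrite -EFinM mulrC.
apply: integrableMr => //.
  by apply: measurable_funTS; exact: continuous_measurable_fun.
exists `|h c|; split; first by rewrite num_real.
by move=> M cM x /= x01; apply: le_trans (ltW cM); exact: hc.
Qed.

Hypothesis r0 : forall i, (1 <= i)%N -> fourier_coef r i = 0.

Lemma annihilates_cos (j : nat) (c : R) :
  \int[leb]_(x in `[0, 1]) (r x * cos (2 * pi * j%:R * x + c)) = 0.
Proof.
have s2 : Num.sqrt 2 != 0 :> R by rewrite gt_eqF// sqrtr_gt0.
have cC (a : R) : continuous (fun x => cos (a * x)).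
  have := @continuous_cos_affine R a 0; rewrite (_ : (fun x => _) = fun x => cos (a * x)) //.
  by apply/funext => x; rewrite addr0.
have cS (a : R) : continuous (fun x => sin (a * x)).
  have := @continuous_cos_affine R a (- (pi / 2)).
  rewrite (_ : (fun x => _) = fun x => sin (a * x)) //.
  by apply/funext => x; rewrite cosBpihalf.
have iZ (a : R) (h : R -> R) : continuous h ->
    \int[leb]_(x in `[0, 1]) (r x * (a * h x)) =
    a * \int[leb]_(x in `[0, 1]) (r x * h x).
  move=> ch; rewrite -RintegralZl//; last exact: integrable_mul_continuous.
  by apply: eq_Rintegral => x _; rewrite mulrCA.
case: j => [|j].
  under eq_Rintegral do rewrite mulr0 mul0r add0r.
  under eq_Rintegral do rewrite -[cos c]mulr1.
  rewrite (iZ _ (fun=> 1)); last by move=> x; exact: cvg_cst.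
  by have := r0 (leqnn 1); rewrite /fourier_coef /fourier_basis /= => ->; rewrite mulr0.
set a : R := 2 * pi * j.+1%:R.
have hC : \int[leb]_(x in `[0, 1]) (r x * cos (a * x)) = 0.
  apply: (mulfI s2); rewrite mulr0 -iZ//.
  rewrite -[RHS](r0 (_ : 1 <= j.+1.*2)%N)// /fourier_coef /fourier_basis.
  by apply: eq_Rintegral => x _; rewrite odd_double doubleK.
have hS : \int[leb]_(x in `[0, 1]) (r x * sin (a * x)) = 0.
  apply: (mulfI s2); rewrite mulr0 -iZ//.
  rewrite -[RHS](r0 (_ : 1 <= j.+1.*2.+1)%N)// /fourier_coef /fourier_basis.
  by apply: eq_Rintegral => x _; rewrite /= odd_double /= uphalf_double.
under eq_Rintegral do rewrite cosD mulrBr (mulrC (cos _)) (mulrC (sin _)).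
rewrite RintegralB//; last 2 first.
- apply: integrable_mul_continuous; apply: continuous_mulR => //.
  by move=> x; exact: cvg_cst.
- apply: integrable_mul_continuous; apply: continuous_mulR => //.
  by move=> x; exact: cvg_cst.
by rewrite !iZ// hC hS !mulr0 subrr.
Qed.

(** Asking for all cosine multiples of h, not only for h itself, makes the
    property stable under the induction on the degree of polynomials below. *)
Definition annihilated (h : R -> R) : Prop := continuous h /\
  forall (j : nat) (c : R),
  \int[leb]_(x in `[0, 1]) (r x * (h x * cos (2 * pi * j%:R * x + c))) = 0.

(** Products of cosines are sums of cosines, so the functions orthogonal to r
    together with all their cosine multiples are stable under multiplication by
    such a bump. *)
Lemma annihilatedM (h : R -> R) (b e a : R) : annihilated h ->
  annihilated (fun x => h x * ((cos (2 * pi * x + b) - e) / 2) + a).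
Proof.
move=> [ch Ah].
have cb : continuous (fun x : R => (cos (2 * pi * x + b) - e) / 2).
  apply: continuous_mulR; last by move=> x; exact: cvg_cst.
  by move=> x; apply: cvgB; [exact: continuous_cos_affine|exact: cvg_cst].
split.
  move=> x; apply: cvgD; last exact: cvg_cst.
  exact: (continuous_mulR ch cb).
move=> j c.
have prev : \int[leb]_(x in `[0, 1])
    (r x * (h x * cos (2 * pi * j%:R * x + c - (2 * pi * x + b)))) = 0.
  case: j => [|j].
    rewrite -[RHS](Ah 1%N (b - c)); apply: eq_Rintegral => x _.
    by rewrite -cosN; congr (_ * (_ * cos _)); ring.
  rewrite -[RHS](Ah j (c - b)); apply: eq_Rintegral => x _.
  by congr (_ * (_ * cos _)); rewrite -natr1; ring.
have next : \int[leb]_(x in `[0, 1])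
    (r x * (h x * cos (2 * pi * j%:R * x + c + (2 * pi * x + b)))) = 0.
  rewrite -[RHS](Ah j.+1 (c + b)); apply: eq_Rintegral => x _.
  by congr (_ * (_ * cos _)); rewrite -natr1; ring.
have E x : r x * ((h x * ((cos (2 * pi * x + b) - e) / 2) + a) *
     cos (2 * pi * j%:R * x + c)) =
  4^-1 * (r x * (h x * cos (2 * pi * j%:R * x + c - (2 * pi * x + b)))) +
  (4^-1 * (r x * (h x * cos (2 * pi * j%:R * x + c + (2 * pi * x + b)))) +
  ((- e / 2) * (r x * (h x * cos (2 * pi * j%:R * x + c))) +
   a * (r x * cos (2 * pi * j%:R * x + c)))).
  rewrite (cosB (2 * pi * j%:R * x + c)) (cosD (2 * pi * j%:R * x + c)).
  by field.
under eq_Rintegral do rewrite E.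
have cA (u v : R) : continuous (fun x : R => cos (u * x + v)) by exact: continuous_cos_affine.
have eqc (f g : R -> R) : f =1 g -> continuous f -> continuous g.
  by move=> /funext ->.
have i1 : leb.-integrable `[0, 1] (EFin \o (fun x : R =>
    r x * (h x * cos (2 * pi * j%:R * x + c - (2 * pi * x + b))))).
  apply: integrable_mul_continuous; apply: continuous_mulR => //.
  apply: (eqc _ _ _ (cA (2 * pi * (j%:R - 1)) (c - b))) => x.
  by congr cos; ring.
have i2 : leb.-integrable `[0, 1] (EFin \o (fun x : R =>
    r x * (h x * cos (2 * pi * j%:R * x + c + (2 * pi * x + b))))).
  apply: integrable_mul_continuous; apply: continuous_mulR => //.
  apply: (eqc _ _ _ (cA (2 * pi * (j%:R + 1)) (c + b))) => x.
  by congr cos; ring.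
have i3 : leb.-integrable `[0, 1] (EFin \o (fun x : R =>
    r x * (h x * cos (2 * pi * j%:R * x + c)))).
  by apply: integrable_mul_continuous; exact: continuous_mulR.
have i4 : leb.-integrable `[0, 1] (EFin \o (fun x : R =>
    r x * cos (2 * pi * j%:R * x + c))).
  exact: integrable_mul_continuous.
have iZ (u : R) (f : R -> R) : leb.-integrable `[0, 1] (EFin \o f) ->
    leb.-integrable `[0, 1] (EFin \o (fun x => u * f x)).
  move=> fi; rewrite (_ : EFin \o _ = fun x => (u%:E * (EFin \o f) x)%E).
    exact: integrableZl.
  by apply/funext => x /=; rewrite EFinM.
have iD (f g : R -> R) : leb.-integrable `[0, 1] (EFin \o f) ->
    leb.-integrable `[0, 1] (EFin \o g) ->
    leb.-integrable `[0, 1] (EFin \o (fun x : R => f x + g x : R)).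
  move=> fi gi; rewrite (_ : EFin \o _ = ((EFin \o f) \+ (EFin \o g))%E).
    exact: integrableD.
  by apply/funext => x /=; rewrite EFinD.
have k3 := iZ (- e / 2) _ i3; have k4 := iZ a _ i4.
have k2 := iZ 4^-1 _ i2; have k1 := iZ 4^-1 _ i1.
have k34 := iD _ _ k3 k4; have k234 := iD _ _ k2 k34.
rewrite (RintegralD _ k1 k234)// (RintegralD _ k2 k34)// (RintegralD _ k3 k4)//.
rewrite !RintegralZl// prev next Ah annihilates_cos.
by rewrite !mulr0 !addr0.
Qed.

Lemma annihilated_poly (p : {poly R}) (b e : R) :
  annihilated (fun x => p.[(cos (2 * pi * x + b) - e) / 2]).
Proof.
elim/poly_ind: p => [|p c IH].
  split; first by move=> x; under eq_fun do rewrite horner0; exact: cvg_cst.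
  move=> j c; under eq_Rintegral do rewrite horner0 mul0r mulr0.
  exact: Rintegral01_cst.
have := annihilatedM b e c IH; congr annihilated.
by apply/funext => x; rewrite hornerMXaddC.
Qed.

End completeness.

Section completeness_conclusion.
Variable R : realType.
Local Notation leb := (@lebesgue_measure R).

Lemma ltr_cos_turn (d u : R) : 0 < d -> d < u -> u < 1 - d ->
  cos (2 * pi * u) < cos (2 * pi * d).
Proof.
move=> d0 du ud; have p0 := @pi_gt0 R.
have H v : d < v <= 2^-1 -> cos (2 * pi * v) < cos (2 * pi * d).
  move=> /andP[dv v2]; rewrite ltr_cos ?in_itv/=.
  - by rewrite ltr_pM2l// mulr_gt0.
  - by apply/andP; split; [rewrite !mulr_ge0; lra|nra].
  - by apply/andP; split; [rewrite !mulr_ge0; lra|nra].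
have [u2|u2] := leP u 2^-1; first by apply: H; rewrite du.
have -> : 2 * pi * u = pi *+ 2 - 2 * pi * (1 - u).
  by rewrite -[pi *+ 2]mulr_natr; ring.
rewrite cosB cos2pi sin2pi mul1r mul0r addr0; apply: H.
by apply/andP; split; lra.
Qed.

Lemma ltr_cos_turn_in (d u : R) : 0 <= u -> u < d -> d <= 2^-1 ->
  cos (2 * pi * d) < cos (2 * pi * u).
Proof.
move=> u0 ud d2; have p0 := @pi_gt0 R.
rewrite ltr_cos ?in_itv/=; first by rewrite ltr_pM2l// mulr_gt0.
- by apply/andP; split; [rewrite !mulr_ge0; lra|nra].
- by apply/andP; split; [rewrite !mulr_ge0; lra|nra].
Qed.

Lemma ae_neq (a : R) : {ae leb, forall x, x != a}.
Proof.
exists [set a]; split; rewrite ?lebesgue_measure_set1//.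
by move=> x /= /negP; rewrite negbK => /eqP.
Qed.

Variable r : R -> R.
Hypothesis ir : leb.-integrable `[0, 1] (EFin \o r).
Hypothesis r0 : forall i, (1 <= i)%N -> fourier_coef r i = 0.

(** A cosine bump centred in the middle of the interval, shifted down to vanish
    at the end points, is positive exactly inside; sign polynomials of it turn
    into the indicator function in the limit. *)
Lemma annihilated_interval (x y : R) : 0 < x -> x < y -> y < 1 ->
  \int[leb]_(t in `[0, 1]) (r t * \1_`]x, y] t) = 0.
Proof.
move=> x0 xy y1.
pose c := (x + y) / 2; pose d := (y - x) / 2.
pose q t : R := (cos (2 * pi * t + (- (2 * pi * c))) - cos (2 * pi * d)) / 2.
have qE t : q t = (cos (2 * pi * `|t - c|) - cos (2 * pi * d)) / 2.
  rewrite /q; congr ((_ - _) / _); have [ct|ct] := ger0P (t - c).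
    by congr cos; ring.
  by rewrite -cosN; congr cos; ring.
have q1 t : `|q t| <= 1.
  have := @cos_le1 R (2 * pi * t + (- (2 * pi * c))).
  have := @cos_geN1 R (2 * pi * t + (- (2 * pi * c))).
  have := @cos_le1 R (2 * pi * d).
  have := @cos_geN1 R (2 * pi * d).
  by rewrite /q => *; rewrite ler_norml; apply/andP; split; lra.
pose f n t := r t * ((1 + (sign_poly R n).[q t]) / 2).
have I n : \int[leb]_(t in `[0, 1]) f n t = 0.
  have [cs /(_ 0%N 0)] := annihilated_poly ir r0
    ((1 + sign_poly R n) * 2^-1%:P) (- (2 * pi * c)) (cos (2 * pi * d)).
  move=> H; rewrite -[RHS]H; apply: eq_Rintegral => t _.
  rewrite mulr0 mul0r add0r cos0 mulr1 hornerM hornerD !hornerC.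
  by [].
have iF n : leb.-integrable `[0, 1] (EFin \o f n).
  have [cs _] := annihilated_poly ir r0
    ((1 + sign_poly R n) * 2^-1%:P) (- (2 * pi * c)) (cos (2 * pi * d)).
  have := integrable_mul_continuous ir cs.
  rewrite (_ : EFin \o _ = EFin \o f n)//.
  by apply/funext => t /=; rewrite hornerM hornerD !hornerC.
have mr : measurable_fun (`[0, 1] : set R) r.
  by have /integrableP[/measurable_EFinP] := ir.
have lim_f t : 0 <= t <= 1 -> t != x -> t != y ->
    f ^~ t @ \oo --> (r t * \1_`]x, y] t).
  move=> /andP[t0 t1] tx ty; apply: cvgM; first exact: cvg_cst.
  have d2 : d <= 2^-1 by rewrite /d; lra.
  have d0 : 0 < d by rewrite /d; lra.
  have [tin|tout] := boolP (x < t < y).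
    have -> : \1_`]x, y] t = (1 + 1) / 2 :> R.
      rewrite indicE mem_set; first by rewrite divff.
      by rewrite /= in_itv/=; case/andP: tin => -> /ltW.
    apply: cvgM; last exact: cvg_cst.
    apply: cvgD; first exact: cvg_cst.
    apply: cvg_sign_poly; rewrite (le_trans (ler_norm _) (q1 t)) andbT.
    rewrite qE; have : cos (2 * pi * d) < cos (2 * pi * `|t - c|).
      apply: ltr_cos_turn_in => //; case/andP: tin => *.
      by rewrite ltr_norml /c /d; apply/andP; split; lra.
    lra.
  have -> : \1_`]x, y] t = (1 - 1) / 2 :> R.
    rewrite indicE memNset ?subrr ?mul0r//=; rewrite in_itv/= => /andP[a b].
    by move: tout; rewrite a lt_neqAle ty b.
  apply: cvgM; last exact: cvg_cst.
  apply: cvgD; first exact: cvg_cst.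
  rewrite [X in X @ _](_ : _ = fun n => - (sign_poly R n).[- q t]); last first.
    by apply/funext => n; rewrite horner_sign_polyN opprK.
  apply: cvgN; apply: cvg_sign_poly.
  rewrite (le_trans (ler_norm _))// ?normrN// andbT.
  rewrite qE; have : cos (2 * pi * `|t - c|) < cos (2 * pi * d).
    have [lt|lt] : t < x \/ y < t.
      move: tout; rewrite negb_and -!leNgt => /orP[tx'|ty'].
        by left; rewrite lt_neqAle tx tx'.
      by right; rewrite lt_neqAle eq_sym ty ty'.
    - apply: ltr_cos_turn => //; rewrite ltr0_norm /c /d; lra.
    - apply: ltr_cos_turn => //; rewrite gtr0_norm /c /d; lra.
  lra.
have mf : measurable_fun (`[0, 1] : set R) (fun t => (r t * \1_`]x, y] t)%:E).
  by apply/measurable_EFinP/measurable_funM => //; exact: measurable_indic.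
have cf : {ae leb, forall t, `[0, 1]%classic t ->
    (fun n => (f n t)%:E) @ \oo --> (r t * \1_`]x, y] t)%:E}.
  have := ae_neq y; have := ae_neq x.
  apply: filterS2; first exact: (ae_filter_ringOfSetsType leb).
  move=> t tx ty; rewrite /= in_itv/= => t01.
  by apply/cvg_EFin; [exact: nearW|exact: lim_f].
have bf : {ae leb, forall t n, `[0, 1]%classic t ->
    (`|(f n t)%:E| <= `|(r t)%:E|)%E}.
  apply: aeW => t n t01; rewrite /= lee_fin normrM ler_piMr//.
  have := normr_sign_poly n (q1 t); rewrite !ler_norml => /andP[? ?].
  by apply/andP; split; lra.
have [_ _ cv] := @dominated_convergence _ _ R leb _ (measurable_itv `[0, 1])
  (fun n t => (f n t)%:E) _ _ (fun n => measurable_int _ (iF n)) mf cf (integrable_abse ir) bf.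
rewrite /Rintegral -(cvg_lim _ cv)//.
rewrite [X in limn X](_ : _ = fun=> 0%E) ?lim_cst//.
apply/funext => n; rewrite -[LHS]fineK; last first.
  by apply: integrable_fin_num => //; exact: iF.
by rewrite [fine _]I.
Qed.

(** The trigonometric system is complete: the primitive of r is constant on
    the open unit interval, and its derivative is r at almost every point. *)
Lemma fourier_complete :
  {ae leb, forall x, x \in `]0, 1[ -> r x = 0}.
Proof.
pose g := r \_ `[0, 1].
have ig : leb.-integrable setT (EFin \o g).
  by move: ir; rewrite integrable_mkcond// restrict_EFin.
have lg : locally_integrable setT g.
  by apply: open_integrable_locally => //; exact: openT.
pose F x := (\int[leb]_(t in `]-oo, x]) g t).
have iN y : leb.-integrable `]-oo, y] (EFin \o g) by exact: integrableS ig.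
have := FTC1Ny iN lg; apply: filterS; first exact: (ae_filter_ringOfSetsType leb).
move=> x /= [_ F'x] x01.
move: x01; rewrite in_itv/= => /andP[x0 x1].
have g0 : forall a b, 0 < a -> a < b -> b < 1 -> F b - F a = 0.
  move=> a b a0 ab b1.
  rewrite /F Rintegral_itvB ?bnd_simp ?ltW//.
  rewrite -[RHS](annihilated_interval a0 ab b1) [RHS]Rintegral_mkcond.
  rewrite [LHS]Rintegral_mkcond; apply: eq_Rintegral => t _.
  rewrite !patchE indicE; case: (boolP (t \in `]a, b]%classic)) => tab.
    by rewrite mulr1.
  by rewrite mulr0; case: ifP.
have Fc : \forall y \near x, F y = cst (F x) y.
  near=> y; have y01 : y \in `]0, 1[.
    near: y; apply: near_in_itvoo; by rewrite in_itv/= x0.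
  move: y01; rewrite in_itv/= => /andP[y0 y1]; apply/eqP; rewrite -subr_eq0.
  have [xy|yx|->] := ltgtP x y; last by rewrite subrr.
  - by rewrite g0.
  - by rewrite -oppr_eq0 opprB g0.
have F0 : derive1 F x = 0.
  by rewrite derive1E (near_eq_derive _ Fc)// derive_cst.
move: F'x; rewrite -/F F0 /g patchE mem_set//=.
by rewrite in_itv/= !ltW.
Unshelve. all: by end_near. Qed.

End completeness_conclusion.

(** * Fourier series and the smoothness classes *)

Section fourier_series.
Variable R : realType.
Implicit Types (c : nat -> R) (k j : nat).
Local Notation leb := (@lebesgue_measure R).

Definition fourier_series k c (x : R) : R :=
  limn (series (fun i => c i * fourier_deriv k i x)).

Definition summable_order k c : Prop :=
  cvgn (series (fun i => `|c i| * i.+1%:R ^+ k)).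

Lemma summable_orderW k c : summable_order k.+1 c -> summable_order k c.
Proof.
apply: dominated_cvg_series => i; rewrite ger0_norm ?mulr_ge0 ?exprn_ge0//.
by rewrite ler_wpM2l// exprS ler_peMl ?exprn_ge0// ler1n.
Qed.

Lemma normr_fourier_term k c i x : `|c i * fourier_deriv k i x| <=
  2 * 4 ^+ k * (`|c i| * i.+1%:R ^+ k).
Proof.
rewrite normrM mulrCA ler_wpM2l//; exact: normr_fourier_deriv_le.
Qed.

Lemma cvg_fourier_bound k c : summable_order k c ->
  cvgn (series (fun i => 2 * 4 ^+ k * (`|c i| * i.+1%:R ^+ k))).
Proof. exact: is_cvg_series_mull. Qed.

Lemma cvg_fourier_series k c x : summable_order k c ->
  cvgn (series (fun i => c i * fourier_deriv k i x)).
Proof.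
move=> /cvg_fourier_bound; apply: dominated_cvg_series => i.
exact: normr_fourier_term.
Qed.

Lemma continuous_fourier_series k c : summable_order k c ->
  continuous (fourier_series k c).
Proof.
move=> sc; apply: (continuous_series _ _ (cvg_fourier_bound sc)) => i.
  by apply: continuous_mulR; [move=> x; exact: cvg_cst|exact: continuous_fourier_deriv].
by move=> x; exact: normr_fourier_term.
Qed.

Lemma derive1n_fourier_series k c : summable_order k c ->
  derive1n k (fourier_series 0 c) = fourier_series k c.
Proof.
elim: k => [//|k IH] sc; have sk := summable_orderW sc.
rewrite derive1nS IH//; apply/funext => x; rewrite derive1E.
have D : is_derive x 1 (fourier_series k c) (fourier_series k.+1 c x).
  apply: (@is_derive_series _ (fun i y => c i * fourier_deriv k i y)
    (fun i y => c i * fourier_deriv k.+1 i y)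
    (fun i => 2 * 4 ^+ k.+1 * (`|c i| * i.+1%:R ^+ k.+1))).
  - move=> i y; have := @is_deriveZ _ _ _ _ (c i) _ _ _ (is_derive_fourier_deriv k i y).
    by [].
  - by move=> i y; exact: normr_fourier_term.
  - exact: cvg_fourier_bound.
  - by move=> y; exact: cvg_fourier_series.
exact: (@derive_val _ _ _ _ _ _ _ D).
Qed.

Lemma Rintegral_fourier_sumM c N j :
  \int[leb]_(x in `[0, 1])
    (series (fun i => c i * fourier_deriv 0 i x) N * fourier_deriv 0 j x) =
  if (j < N)%N then c j else 0.
Proof.
elim: N => [|N IH].
  under eq_Rintegral do rewrite /series/= big_geq// mul0r.
  exact: Rintegral01_cst.
under eq_Rintegral do rewrite seriesSr mulrDl -mulrA.
have c2 : continuous (fun x : R => fourier_deriv 0 N x * fourier_deriv 0 j x).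
  by apply: continuous_mulR; exact: continuous_fourier_deriv.
rewrite Rintegral01D; last 2 first.
- by apply: continuous_mulR; [exact: continuous_fourier_sum|exact: continuous_fourier_deriv].
- by apply: continuous_mulR => // x; exact: cvg_cst.
rewrite IH Rintegral01Z// fourier_deriv_orthogonal muln0 expr0 ltnS.
by case: ltngtP => // [jN|Nj|->]; rewrite ?mulr0 ?mulr1 ?addr0 ?add0r.
Qed.

Lemma fourier_coef_series c j : summable_order 0 c ->
  fourier_coef (fourier_series 0 c) j.+1 = c j.
Proof.
move=> sc; pose s N x := series (fun i => c i * fourier_deriv 0 i x) N.
pose C := limn (series (fun i => 2 * 4 ^+ 0 * (`|c i| * i.+1%:R ^+ 0))).
have cs N : continuous (fun x => s N x * fourier_deriv 0 j x).
  by apply: continuous_mulR; [exact: continuous_fourier_sum|exact: continuous_fourier_deriv].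
have sC N x : `|s N x| <= C.
  rewrite /s /series /=; apply: le_trans (ler_norm_sum _ _ _) _.
  apply: le_trans (ler_sum _ (fun i _ => normr_fourier_term 0 c i x)) _.
  apply: (series_le_lim (u := fun i => 2 * 4 ^+ 0 * (`|c i| * i.+1%:R ^+ 0))).
    by move=> i; rewrite !mulr_ge0.
  exact: cvg_fourier_bound.
have := @dominated_cvg _ _ _ leb _ (measurable_itv `[0, 1])
  (fun N x => (s N x * fourier_deriv 0 j x)%:E)
  (fun x => (fourier_series 0 c x * fourier_deriv 0 j x)%:E) (cst (C * 2)%:E).
have m1 N : measurable_fun (`[0, 1] : set R) (fun x => (s N x * fourier_deriv 0 j x)%:E).
  apply/measurable_EFinP; apply: measurable_funTS; exact: (continuous_measurable_fun (cs N)).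
have cv (x : R) : `[0, 1]%classic x -> (s N x * fourier_deriv 0 j x)%:E @[N --> \oo] -->
     (fourier_series 0 c x * fourier_deriv 0 j x)%:E.
  move=> _; apply/cvg_EFin; first exact: nearW.
  by apply: cvgM; [exact: cvg_fourier_series|exact: cvg_cst].
have ic : leb.-integrable (`[0, 1] : set R) (cst (C * 2)%:E).
  by apply: (@continuous_integrable01 _ (cst (C * 2))) => x; exact: cvg_cst.
move=> /(_ m1 cv (fun _ _ => isT) ic) /(_ _)/wrap[].
  move=> N x _; rewrite /= lee_fin normrM; apply: ler_pM => //.
  exact: normr_fourier_basis_le.
move=> H; rewrite /fourier_coef.
under eq_Rintegral do rewrite -fourier_deriv0.
rewrite /Rintegral -(cvg_lim _ H)// (_ : limn _ = (c j)%:E)//.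
apply: lim_near_cst => //; exists j.+1 => // N /= jN.
rewrite -[LHS]fineK; last first.
  by apply: integrable_fin_num => //; exact: continuous_integrable01.
by have := Rintegral_fourier_sumM c N j; rewrite jN /Rintegral => ->.
Qed.

End fourier_series.

Section sobolev.
Variable R : realType.
Local Notation leb := (@lebesgue_measure R).

Lemma sqr_powR (a x : R) : 0 <= a -> (a `^ x) ^+ 2 = a `^ (2 * x).
Proof. by move=> a0; rewrite -powR_mulrn ?powR_ge0// -powRrM mulrC. Qed.

Lemma cvg_series_of_nneseries (u : nat -> R) : (forall i, 0 <= u i) ->
  (\sum_(1 <= i <oo) (u i)%:E < +oo)%E -> cvgn (series (fun i => u i.+1)).
Proof.
move=> u0 ufin; set S := (\sum_(1 <= i <oo) (u i)%:E)%E in ufin.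
apply: (@bounded_cvg_series _ _ (fine S)) => // N.
have S0 : (0 <= S)%E by apply: nneseries_ge0 => i _ _; rewrite lee_fin.
rewrite -lee_fin fineK; last by rewrite ge0_fin_numE.
apply: le_trans (nneseries_lim_ge N.+1 _); last first.
  by move=> i _ _; rewrite lee_fin.
by rewrite sumEFin lee_fin /series /= big_add1.
Qed.

(** Both smoothness classes give square-summable weighted coefficients: the
    terms of a convergent series are bounded, so the absolutely weighted class
    is contained in the quadratic one. *)
Lemma sobolev_coef_summable (alpha : R) (f : R -> R) :
  W_class alpha f \/ H_class alpha f ->
  in_L2 f /\
  cvgn (series (fun i => i.+1%:R `^ (2 * alpha) * fourier_coef f i.+1 ^+ 2)).
Proof.
case=> -[f2]; first by move=> /cvg_series_of_nneseries cW; split => //;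
  apply: cW => i; rewrite mulr_ge0 ?powR_ge0 ?sqr_ge0.
move=> /cvg_series_of_nneseries cH; split => //.
have {}cH : cvgn (series (fun i => i.+1%:R `^ alpha * `|fourier_coef f i.+1|)).
  by apply: cH => i; rewrite mulr_ge0 ?powR_ge0.
pose v i := i.+1%:R `^ alpha * `|fourier_coef f i.+1|.
have v0 i : 0 <= v i by rewrite mulr_ge0 ?powR_ge0.
have vC i : v i <= limn (series v).
  apply: le_trans (series_le_lim i.+1 v0 cH).
  by rewrite seriesSr lerDr /series /= sumr_ge0.
have c2 := is_cvg_series_mull (a := limn (series v)) cH.
apply: (@dominated_cvg_series _ _ _ _ c2) => i.
rewrite ger0_norm; last by rewrite mulr_ge0 ?powR_ge0 ?sqr_ge0.
rewrite -sqr_powR// -exprMn.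
rewrite -real_normK ?num_real// normrM ger0_norm ?powR_ge0// expr2.
by apply: ler_wpM2r; [exact: v0|exact: vC].
Qed.

Lemma coef_summable_order (alpha : R) (b : nat -> R) k :
  cvgn (series (fun i => i.+1%:R `^ (2 * alpha) * b i ^+ 2)) ->
  k%:R <= alpha - 1 -> summable_order k b.
Proof.
move=> cb ka.
have c2 := is_cvg_series_add cb (@cvg_series_inv_sqr R).
apply: (@dominated_cvg_series _ _ _ _ c2) => i.
rewrite ger0_norm; last by rewrite mulr_ge0 ?exprn_ge0.
rewrite -sqr_powR//.
set n : R := i.+1%:R; have n1 : 1 <= n by rewrite ler1n.
have n0 : 0 < n by exact: lt_le_trans n1.
have -> : n ^+ k = n `^ alpha * n `^ (k%:R - alpha).
  by rewrite -powRD ?(gt_eqF n0) ?implybT// addrC subrK powR_mulrn// ltW.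
have y1 : n `^ (k%:R - alpha) <= n^-1.
  by rewrite -(powR_inv1 (ltW n0)) ler_powR//; lra.
have y0 := powR_ge0 n (k%:R - alpha).
set x := n `^ alpha; set y := n `^ _ in y0 y1 *.
have y2 : y ^+ 2 <= n ^- 2 by rewrite -exprVn lerXn2r ?nnegrE// invr_ge0 ltW.
have -> : x ^+ 2 * b i ^+ 2 = (`|b i| * x) ^+ 2.
  by rewrite exprMn real_normK ?num_real// mulrC.
rewrite mulrA; apply: le_trans (lerD (lexx _) y2); set z := `|b i| * x.
nra.
Qed.

Lemma in_L2_integrable (f : R -> R) : in_L2 f ->
  leb.-integrable `[0, 1] (EFin \o f).
Proof.
move=> [mf]; rewrite /L2norm => f2.
have mf2 : measurable_fun (`[0, 1] : set R) (fun x => (f x ^+ 2)%:E).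
  by apply/measurable_EFinP; apply: measurable_funX.
have i2 : leb.-integrable `[0, 1] (fun x => (f x ^+ 2)%:E).
  apply/integrableP; split => //.
  under eq_integral do rewrite gee0_abs ?lee_fin ?sqr_ge0//.
  by apply: lty_poweRy f2; rewrite invr_neq0.
have i12 : leb.-integrable `[0, 1] (EFin \o (fun x => 1 + f x ^+ 2)).
  rewrite (_ : EFin \o _ = ((EFin \o (cst 1%R : R -> R)) \+ (EFin \o (fun x => (f x ^+ 2)%R)))%E).
    apply: integrableD => //; apply: continuous_integrable01 => x.
    exact: cvg_cst.
  by apply/funext => x /=; rewrite EFinD.
apply: (@le_integrable _ _ _ leb _ (measurable_itv `[0, 1]) _ _ _ _ i12) => //.
  exact/measurable_EFinP.
move=> x _; rewrite /= lee_fin [leRHS]ger0_norm; last first.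
  by rewrite addr_ge0 ?sqr_ge0.
rewrite -[X in _ + X]real_normK ?num_real//; set z := `|f x|.
have z0 : 0 <= z by exact: normr_ge0.
nra.
Qed.

Lemma ae_eq_continuous (h s : R -> R) (x : R) : 0 < x < 1 ->
  {for x, continuous h} -> {for x, continuous s} ->
  {ae leb, forall y, y \in `[0, 1] -> h y = s y} -> h x = s x.
Proof.
move=> x01 ch cs [N [mN N0 hN]]; apply/eqP; apply: contrapT => /negP hs.
have cd : {for x, continuous (fun y => h y - s y)}.
  by apply: cvgB; [exact: ch|exact: cs].
have n0 : \forall y \near x, h y - s y != 0.
  move: hs; rewrite -subr_eq0 => hs.
  by move: cd => /cvgr_neq0/(_ hs).
have nin : \forall y \near x, y \in `]0, 1[.
  by apply: near_in_itvoo; rewrite in_itv.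
have /nbhs_ballP[e /= e0 be] : \forall y \near x, N y.
  apply: filterS2 n0 nin => y hy; rewrite in_itv/= => /andP[y0 y1].
  apply: hN => /= H; move: hy; rewrite subr_eq0 H ?eqxx//.
  by rewrite in_itv/= !ltW.
have : (leb (ball x e) <= leb N)%E.
  by apply: le_measure => //; rewrite inE//; exact: measurable_ball.
rewrite [leb N]N0 lebesgue_measure_ball; last exact: ltW.
by rewrite leNgt lte_fin mulrn_wgt0.
Qed.

Section version.
Variables (alpha : R) (f : R -> R).
Hypothesis alpha32 : 3 / 2 < alpha.
Hypothesis fWH : W_class alpha f \/ H_class alpha f.
Let b i := fourier_coef f i.+1.

Let sb0 : summable_order 0 b.
Proof.
have [_ cb] := sobolev_coef_summable fWH.
by apply: (coef_summable_order cb); rewrite mulr0n; move: alpha32; lra.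
Qed.

Lemma fourier_inversion :
  {ae leb, forall x, x \in `[0, 1] -> fourier_series 0 b x = f x}.
Proof.
have [f2 cb] := sobolev_coef_summable fWH.
have fi := in_L2_integrable f2.
have cs := continuous_fourier_series sb0.
have si := continuous_integrable01 cs.
have ri : leb.-integrable `[0, 1] (EFin \o (fun x => f x - fourier_series 0 b x)).
  rewrite (_ : EFin \o _ = ((EFin \o f) \- (EFin \o fourier_series 0 b))%E).
    exact: integrableB.
  by apply/funext => x /=; rewrite EFinB.
have fb i : continuous (fun x : R => fourier_basis i x).
  case: i => [|i].
    have := @continuous_cos_affine R (2 * pi * 0%:R) 0 => c0.
    have -> : (fun x : R => fourier_basis 0 x) =
      (fun x => Num.sqrt 2 * cos (2 * pi * 0%:R * x + 0)).
      by apply/funext => x; rewrite /fourier_basis /= addr0.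
    by apply: continuous_mulR => // x; exact: cvg_cst.
  have -> : (fun x : R => fourier_basis i.+1 x) = fourier_deriv 0 i.
    by apply/funext => x; rewrite fourier_deriv0.
  exact: continuous_fourier_deriv.
have r0 i : (1 <= i)%N ->
    fourier_coef (fun x => f x - fourier_series 0 b x) i = 0.
  case: i => // i _; rewrite /fourier_coef.
  under eq_Rintegral do rewrite mulrBl.
  rewrite RintegralB//; last 2 first.
  - exact: integrable_mul_continuous.
  - exact: integrable_mul_continuous.
  by have := fourier_coef_series i sb0; rewrite /fourier_coef => ->; rewrite subrr.
have := ae_neq (1 : R); have := ae_neq (0 : R).
have := fourier_complete ri r0.
apply: filterS3; first exact: (ae_filter_ringOfSetsType leb).
move=> x H x0 x1; rewrite in_itv/= => /andP[a c].
apply/esym/eqP; rewrite -subr_eq0; apply/eqP/H.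
by rewrite in_itv/= !lt_neqAle eq_sym x0 a x1.
Qed.

Lemma continuous_versionE x : 0 < x < 1 ->
  continuous_version f x = fourier_series 0 b x.
Proof.
move=> x01; rewrite /continuous_version.
have cs := continuous_fourier_series sb0.
case: xgetP => [h -> [ch hf]|]; last first.
  move=> /(_ (fourier_series 0 b))[]; split; last exact: fourier_inversion.
  exact: continuous_subspaceT.
apply: ae_eq_continuous => //.
- have /continuous_within_itvP[] := ch; first exact: ltr01.
  by move=> + _ _; apply; rewrite in_itv.
- exact: cs.
have := fourier_inversion; move: hf.
apply: filterS2; first exact: (ae_filter_ringOfSetsType leb).
by move=> y h1 h2 y01; rewrite h1// h2.
Qed.

Lemma deriv_classE k x : k%:R < alpha - 3 / 2 -> 0 < x < 1 ->
  deriv_class k f x = fourier_series k b x.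
Proof.
move=> ka x01; have [_ cb] := sobolev_coef_summable fWH.
have sk : summable_order k b by apply: (coef_summable_order cb); lra.
rewrite -derive1n_fourier_series// /deriv_class.
elim: (k) x x01 => [|j IH] x x01; first exact: continuous_versionE.
rewrite !derive1nS !derive1E; apply: near_eq_derive.
have nin : \forall y \near x, y \in `]0, 1[.
  by apply: near_in_itvoo; rewrite in_itv.
by apply: filterS nin => y; rewrite in_itv/= => /IH.
Qed.

End version.

End sobolev.

(** * Second moments of normal variables *)

Section normal_moments.
Variables (R : realType) (m s : R).
Hypothesis s0 : s != 0.
Local Notation leb := (@lebesgue_measure R).

Lemma integral_normal_prob (f : R -> \bar R) : measurable_fun setT f ->
  (forall x, 0 <= f x)%E ->
  (\int[normal_prob m s]_x f x = \int[leb]_x ((normal_pdf m s x)%:E * f x))%E.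
Proof.
move=> mf f0.
transitivity (\int[normal_prob m s]_x ((cst 1 x)%:E * f (idfun x)))%E.
  by apply: eq_integral => x _; rewrite mul1e.
have := @integral_transport R _ _ _ _ (normal_prob m s) leb idfun (cst 1) idfun
  (normal_pdf m s).
apply => //=; [exact: measurable_id|exact: measurable_id
  |exact: measurable_normal_pdf|exact: normal_pdf_ge0|].
move=> A mA; under eq_integral do rewrite mul1e.
rewrite integral_indic// setIT /normal_prob [LHS]integral_mkcond.
by apply: eq_integral => x _; rewrite patchE indicE; case: ifP => _;
  rewrite ?mule1 ?mule0.
Qed.

Let is_derive_center (x : R) : is_derive x 1 (fun y : R => y - m) 1.
Proof.
have := is_deriveD (is_derive_id x (1 : R)) (is_derive_cst (- m) x (1 : R)).
by rewrite addr0.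
Qed.

Lemma is_derive_normal_pdf (x : R) :
  is_derive x 1 (normal_pdf m s) (- (x - m) / s ^+ 2 * normal_pdf m s x).
Proof.
pose f (y : R) := - (y - m) ^+ 2 / (s ^+ 2 *+ 2).
have df : is_derive x 1 f (- (x - m) / s ^+ 2).
  pose g (y : R) := y - m.
  have dg : is_derive x 1 g 1 by exact: is_derive_center.
  have dgg := is_deriveM dg dg.
  have := @is_deriveZ _ _ _ _ (- (s ^+ 2 *+ 2)^-1) _ _ _ dgg.
  rewrite [X in is_derive _ _ X](_ : _ = f); last first.
    apply/funext => y; rewrite /f /g !fctE.
    by rewrite [LHS](_ : _ = - (s ^+ 2 *+ 2)^-1 * ((y - m) * (y - m)))//; ring.
  rewrite [X in is_derive _ _ _ X](_ : _ = - (x - m) / s ^+ 2)//.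
  rewrite [LHS](_ : _ = - (s ^+ 2 *+ 2)^-1 * ((x - m) * 1 + (x - m) * 1))//.
  by field.
have de := is_derive1_comp (is_derive_expR (f x)) df.
have := @is_deriveZ _ _ _ _ (normal_peak s) _ _ _ de.
rewrite [X in is_derive _ _ X](_ : _ = normal_pdf m s); last first.
  by apply/funext => y; rewrite normal_pdfE.
rewrite [X in is_derive _ _ _ X](_ : _ = - (x - m) / s ^+ 2 * normal_pdf m s x)//.
rewrite normal_pdfE// [LHS](_ : _ = normal_peak s * (expR (f x) * (- (x - m) / s ^+ 2)))//.
by rewrite /normal_fun -/(f x); ring.
Qed.

(** Integrating the derivative of (x - m) p(x), with p the density, over a large
    symmetric interval trades the second moment for the total mass, up to a
    boundary term of favourable sign. *)
Lemma normal_second_moment_le :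
  (\int[normal_prob m s]_x ((x - m) ^+ 2)%:E <= (s ^+ 2)%:E)%E.
Proof.
have mq : measurable_fun [set: R] (fun x : R => ((x - m) ^+ 2)%:E).
  apply/measurable_EFinP; apply: continuous_measurable_fun => x.
  by apply: (@cvgM _ _ _ _ (fun y : R => y - m) (fun y : R => y - m));
    apply: cvgB; [exact: cvg_id|exact: cvg_cst|exact: cvg_id|exact: cvg_cst].
rewrite integral_normal_prob//; last by move=> x; rewrite lee_fin sqr_ge0.
pose p := normal_pdf m s.
have cp : continuous p by exact: continuous_normal_pdf.
have cxm : continuous (fun x : R => x - m).
  by move=> x; apply: cvgB; [exact: cvg_id|exact: cvg_cst].
pose q (x : R) := (x - m) * ((x - m) * p x).
have cq : continuous q by do 2 apply: continuous_mulR => //.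
have q0 x : 0 <= q x.
  by rewrite /q mulrA -expr2 mulr_ge0 ?sqr_ge0// normal_pdf_ge0.
under eq_integral.
  move=> x _; rewrite -EFinM (_ : _ * _ = q x); last by rewrite /q /p; ring.
  over.
pose I (N : nat) : set R := `[m - N.+1%:R, m + N.+1%:R]%classic.
have UI : \bigcup_N I N = setT.
  apply/seteqP; split => // x _; exists (Num.truncn `|x - m|) => //=.
  have := truncnS_gt `|x - m|; rewrite ltr_norml => /andP[a b].
  by rewrite /I /= in_itv/=; apply/andP; split; lra.
have cv : (\int[leb]_(x in I N) (q x)%:E)%E @[N --> \oo] --> (\int[leb]_x (q x)%:E)%E.
  rewrite -UI; apply: ge0_nondecreasing_set_cvg_integral => //.
  - move=> a b ab; apply/subsetPset; apply: subset_itv; rewrite bnd_simp.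
      by rewrite lerB// ler_nat ltnS.
    by rewrite lerD// ler_nat ltnS.
  - by move=> N; exact: measurable_itv.
  - move=> N; apply/measurable_EFinP; apply: measurable_funTS; exact: continuous_measurable_fun.
  - by move=> N x _; rewrite lee_fin.
rewrite -(cvg_lim _ cv)//; apply: lime_le; first by apply/cvg_ex; eexists; exact: cv.
apply: nearW => N; clear UI cv.
pose F (x : R) := (x - m) * p x.
have cF : continuous F by apply: continuous_mulR.
have dF (x : R) : is_derive x 1 F (p x - s ^- 2 * q x).
  pose g (y : R) := y - m.
  have dg : is_derive x 1 g 1 by exact: is_derive_center.
  have := is_deriveM dg (is_derive_normal_pdf x).
  rewrite [X in is_derive _ _ _ X](_ : _ = p x - s ^- 2 * q x)//.
  rewrite [LHS](_ : _ = (x - m) * (- (x - m) / s ^+ 2 * p x) + p x * 1)//.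
  by rewrite /q; field.
have ab : m - N.+1%:R < m + N.+1%:R.
  by rewrite ltrD2l gtrN// ltr0n.
have cpq : continuous (fun x => p x - s ^- 2 * q x).
  move=> x; apply: cvgB; first exact: cp.
  by apply: cvgM; [exact: cvg_cst|exact: cq].
have ii f : continuous f -> leb.-integrable (I N) (EFin \o f).
  move=> cf; apply: continuous_compact_integrable; first exact: segment_compact.
  exact: continuous_subspaceT.
have := @continuous_FTC2 R (fun x => p x - s ^- 2 * q x) F _ _ ab.
move=> /(_ (continuous_subspaceT cpq)) H.
have {H} : (\int[leb]_(x in I N) (p x - s ^- 2 * q x)%:E =
    (F (m + N.+1%:R))%:E - (F (m - N.+1%:R))%:E)%E.
  apply: H.
    split; first by move=> x _; exact: (@ex_derive _ _ _ _ _ _ _ (dF x)).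
    + exact/cvg_at_right_filter/cF.
    + exact/cvg_at_left_filter/cF.
  by move=> x _; rewrite derive1E (@derive_val _ _ _ _ _ _ _ (dF x)).
have mI : measurable (I N) by exact: measurable_itv.
have iq := ii _ cq; have ip := ii _ cp.
have isq : leb.-integrable (I N) (EFin \o (fun x => s ^- 2 * q x)).
  by apply: ii; apply: continuous_mulR => // x; exact: cvg_cst.
under eq_integral do rewrite EFinB.
rewrite integralB_EFin//.
have -> : (\int[leb]_(x in I N) (s ^- 2 * q x)%:E =
    (s ^- 2)%:E * \int[leb]_(x in I N) (q x)%:E)%E.
  by rewrite -integralZl//; apply: eq_integral => x _; rewrite EFinM.
have qf : (\int[leb]_(x in I N) (q x)%:E)%E \is a fin_num.
  exact: integrable_fin_num.
have pf : (\int[leb]_(x in I N) (p x)%:E)%E \is a fin_num.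
  exact: integrable_fin_num.
have p1 : (\int[leb]_(x in I N) (p x)%:E <= 1)%E.
  rewrite -(integral_normal_pdf m s); apply: ge0_subset_integral => //.
    apply/measurable_EFinP; exact: measurable_normal_pdf.
  by move=> x _; rewrite lee_fin normal_pdf_ge0.
move: p1; rewrite -(fineK qf) -(fineK pf) -!EFinM -!EFinB !lee_fin => p1 [e].
have F1 : 0 <= F (m + N.+1%:R).
  by rewrite /F addrAC subrr add0r mulr_ge0 ?normal_pdf_ge0.
have F2 : F (m - N.+1%:R) <= 0.
  by rewrite /F addrAC subrr add0r mulNr oppr_le0 mulr_ge0 ?normal_pdf_ge0.
have s2 : 0 < s ^+ 2 by rewrite exprn_even_gt0.
have : s ^- 2 * fine (\int[leb]_(x in I N) (q x)%:E) <= 1 by lra.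
by rewrite mulrC ler_pdivrMr// mul1r.
Qed.

End normal_moments.

Lemma integral_lebesgueN (R : realType) (f : R -> \bar R) :
  measurable_fun setT f -> (forall x, 0 <= f x)%E ->
  (\int[lebesgue_measure]_x f x = \int[lebesgue_measure]_x f (- x)%R)%E.
Proof.
move=> mf f0.
have H := @integral_transport R _ _ _ _ lebesgue_measure lebesgue_measure
  idfun (cst 1) -%R (cst 1).
have T : (\int[lebesgue_measure]_x ((cst 1 x)%:E * f (idfun x)) =
    \int[lebesgue_measure]_x ((cst 1 x)%:E * f (- x)%R))%E.
  apply: H => //=; [exact: measurable_id|move=> A mA].
  under eq_integral do rewrite mul1e.
  under [in RHS]eq_integral do rewrite mul1e.
  rewrite integral_indic// setIT -[LHS](lebesgue_measureN mA) /pushforward.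
  rewrite -[X in lebesgue_measure X]setIT -integral_indic//.
  by rewrite -[X in measurable X]setTI; exact: oppr_measurable.
transitivity (\int[lebesgue_measure]_x ((cst 1 x)%:E * f (idfun x)))%E.
  by apply: eq_integral => x _; rewrite mul1e.
by rewrite T; apply: eq_integral => x _; rewrite mul1e.
Qed.

Lemma normal_pdf_sym (R : realType) (s x : R) : s != 0 ->
  normal_pdf 0 s (- x) = normal_pdf 0 s x.
Proof. by move=> s0; rewrite !normal_pdfE// /normal_fun !subr0 sqrrN. Qed.

Lemma integral_normal_sym (R : realType) (s : R) (f : R -> \bar R) : s != 0 ->
  measurable_fun setT f -> (forall x, 0 <= f x)%E ->
  (\int[normal_prob 0 s]_x f x = \int[normal_prob 0 s]_x f (- x)%R)%E.
Proof.
move=> s0 mf f0; have mp := @measurable_normal_pdf R 0 s.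
have mN : measurable_fun setT (fun x : R => f (- x)).
  exact: (measurableT_comp mf (@oppr_measurable R setT)).
rewrite !integral_normal_prob// integral_lebesgueN.
- by apply: eq_integral => x _; rewrite normal_pdf_sym.
- by apply: emeasurable_funM => //; exact/measurable_EFinP.
- by move=> x; rewrite mule_ge0// lee_fin normal_pdf_ge0.
Qed.

(** * Independence and moments under the random design *)

Section independence.
Variables (R : realType) (d : measure_display) (T : measurableType d).
Variables (P : probability T R) (I : finType) (Z : I -> T -> R).
Hypothesis mZ : forall s, measurable_fun setT (Z s).
Hypothesis indepZ : mutually_independent P Z.
Implicit Types (F : I -> R -> R) (s t : I).

Local Notation subst F s f := (fun t => if t == s then f else F t).

Let prodD1 F s (f : R -> R) w : \prod_t (subst F s f) t (Z t w) =
  f (Z s w) * \prod_(t | t != s) F t (Z t w).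
Proof.
rewrite (bigD1 s)//= eqxx; congr (_ * _).
by apply: eq_bigr => t /negPf ->.
Qed.

Let prodRD1 F s (f : R -> R) :
  \prod_t \int[P]_w (subst F s f) t (Z t w) =
  \int[P]_w f (Z s w) * \prod_(t | t != s) \int[P]_w F t (Z t w).
Proof.
rewrite (bigD1 s)//=; congr (_ * _); first by rewrite eqxx.
by apply: eq_bigr => t /negPf ->.
Qed.

Lemma integrable_indic_comp s (A : set R) : measurable A ->
  P.-integrable setT (EFin \o (\1_A \o Z s)).
Proof.
move=> mA; have mAZ : measurable (Z s @^-1` A).
  by rewrite -[X in measurable X]setTI; exact: mZ.
rewrite (_ : \1_A \o Z s = \1_(Z s @^-1` A)) //.
exact: integrable_indic.
Qed.

(** Indices outside r carry indicators, for which this is the definition of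
    independence; the induction extends one index at a time from indicators to
    nonnegative functions. *)
Lemma indep_integral_ge0 (r : seq I) F :
  (forall s, measurable_fun setT (F s)) -> (forall s x, 0 <= F s x) ->
  (forall s, P.-integrable setT (EFin \o (F s \o Z s))) ->
  (forall s, s \notin r -> exists2 A, measurable A & F s = \1_A) ->
  (\int[P]_w (\prod_s F s (Z s w))%:E =
   (\prod_s (\int[P]_w F s (Z s w))%R)%:E)%E.
Proof.
elim: r F => [|s r IH] F mF F0 iF HF.
  have /choice[A HA] : forall s, exists A, measurable A /\ F s = \1_A.
    by move=> s; have [//|A mA e] := HF s; exists A.
  have mA s : measurable (A s) by case: (HA s).
  have mAZ s : measurable (Z s @^-1` A s).
    by rewrite -[X in measurable X]setTI; exact: mZ.
  have -> : (fun w => (\prod_s F s (Z s w))%:E) =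
      (fun w => (\1_(\bigcap_s (Z s @^-1` A s)) w)%:E).
    apply/funext => w; congr EFin; rewrite indicE.
    have [wA|wA] := pselect ((\bigcap_s (Z s @^-1` A s)) w).
      rewrite mem_set// big1// => s _; case: (HA s) => _ ->.
      by rewrite indicE mem_set//; exact: wA.
    rewrite memNset//=; have [s sA] : exists s, ~ (Z s @^-1` A s) w.
      by apply/existsNP => H; apply: wA => s _; exact: H.
    rewrite (bigD1 s)//=; case: (HA s) => _ ->.
    by rewrite indicE memNset// mul0r.
  rewrite integral_indic//; last first.
    by apply: fin_bigcap_measurable => //; exact: finite_finset.
  rewrite setIT [LHS](indepZ mA) (big_morph EFin EFinM erefl).
  apply: eq_bigr => s _; case: (HA s) => _ ->.
  rewrite /Rintegral fineK; last first.
    by apply: integrable_fin_num => //; exact: integrable_indic_comp.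
  transitivity (\int[P]_w (\1_(Z s @^-1` A s) w)%:E)%E => //.
  by rewrite integral_indic// setIT.
pose c := \prod_(t | t != s) \int[P]_w F t (Z t w).
pose W1 w := \prod_(t | t != s) F t (Z t w).
have c0 : 0 <= c by apply: prodr_ge0 => t _; apply: Rintegral_ge0.
have W10 w : 0 <= W1 w by apply: prodr_ge0.
have mW1 : measurable_fun setT W1.
  rewrite (_ : W1 = fun w => \prod_t (if t != s then F t (Z t w) else 1)).
    apply: measurable_prod => t _; case: (t != s) => //.
    exact: measurableT_comp.
  by apply/funext => w; rewrite /W1 big_mkcond.
have K (f : R -> \bar R) : measurable_fun setT f -> (forall x, 0 <= f x)%E ->
    (\int[P]_w ((W1 w)%:E * f (Z s w)) = \int[P]_w ((cst c w)%:E * f (Z s w)))%E.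
  apply: integral_transport => // A mA.
  have mAi : measurable_fun setT (\1_A : R -> R) by exact: measurable_indic.
  have iA := integrable_indic_comp s mA.
  have := IH (subst F s (\1_A : R -> R)) _ _ _ _.
  rewrite prodRD1 => H.
  under eq_integral do rewrite -EFinM mulrC -prodD1.
  rewrite H; last first.
  - move=> t tr; case: eqP => [_|/eqP ts]; first by exists A.
    by apply: HF; rewrite inE negb_or ts.
  - by move=> t; case: eqP => // ->.
  - by move=> t x; case: eqP.
  - by move=> t; case: eqP.
  rewrite -/c EFinM muleC.
  transitivity (c%:E * \int[P]_w (\1_A (Z s w))%:E)%E.
    by rewrite /Rintegral fineK//; exact: integrable_fin_num iA.
  rewrite -ge0_integralZl//=.
  by apply/measurable_EFinP; apply: measurableT_comp.
have -> : (fun w => (\prod_s F s (Z s w))%:E) =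
    (fun w => ((W1 w)%:E * (EFin \o F s) (Z s w)))%E.
  by apply/funext => w; rewrite (bigD1 s)//= mulrC EFinM.
rewrite K; last 2 first.
- exact/measurable_EFinP.
- by move=> x; rewrite lee_fin.
rewrite (bigD1 s)//= -/c mulrC EFinM.
transitivity (c%:E * \int[P]_w (F s (Z s w))%:E)%E.
  rewrite -ge0_integralZl//=.
    by apply/measurable_EFinP; exact: measurableT_comp.
  by move=> x _; rewrite lee_fin.
rewrite /Rintegral fineK//; exact: integrable_fin_num (iF s).
Qed.

(** Indices in r carry signed functions; each in turn is split into its
    positive and negative parts. *)
Lemma indep_integral (r : seq I) F :
  (forall s, measurable_fun setT (F s)) ->
  (forall s, P.-integrable setT (EFin \o (F s \o Z s))) ->
  (forall s, s \notin r -> forall x, 0 <= F s x) ->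
  P.-integrable setT (fun w => (\prod_s F s (Z s w))%:E) /\
  \int[P]_w (\prod_s F s (Z s w)) = \prod_s \int[P]_w F s (Z s w).
Proof.
elim: r F => [|s r IH] F mF iF F0.
  have E : (\int[P]_w (\prod_s F s (Z s w))%:E =
      (\prod_s (\int[P]_w F s (Z s w))%R)%:E)%E.
    apply: (indep_integral_ge0 (r := enum I)) => //.
    - by move=> s x; exact: F0.
    - by move=> s; rewrite mem_enum.
  split; last by rewrite {1}/Rintegral E.
  apply/integrableP; split.
    by apply/measurable_EFinP; apply: measurable_prod => t _; exact: measurableT_comp.
  have P0 w : 0 <= \prod_s F s (Z s w) by apply: prodr_ge0 => s _; exact: F0.
  under eq_integral do rewrite gee0_abs ?lee_fin ?P0//.
  by rewrite E ltry.
have mp : measurable_fun setT (F s)^\+ by exact: measurable_funrpos.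
have mn : measurable_fun setT (F s)^\- by exact: measurable_funrneg.
have ip : P.-integrable setT (EFin \o ((F s)^\+ \o Z s)) by exact: integrable_funrpos (iF s).
have inn : P.-integrable setT (EFin \o ((F s)^\- \o Z s)) by exact: integrable_funrneg (iF s).
have step (f : R -> R) : measurable_fun setT f -> (forall x, 0 <= f x) ->
    P.-integrable setT (EFin \o (f \o Z s)) ->
    P.-integrable setT (fun w => (f (Z s w) * \prod_(t | t != s) F t (Z t w))%:E) /\
    \int[P]_w (f (Z s w) * \prod_(t | t != s) F t (Z t w)) =
    \int[P]_w f (Z s w) * \prod_(t | t != s) \int[P]_w F t (Z t w).
  move=> mf f0 if_; have [|||] := IH (subst F s f).
  - by move=> t; case: eqP.
  - by move=> t; case: eqP => // ->.
  - move=> t tr x; case: eqP => // /eqP ts.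
    by apply: F0; rewrite inE negb_or ts.
  move=> H1 H2; rewrite -prodRD1 -H2; split.
    by under eq_fun do rewrite -prodD1.
  by apply: eq_Rintegral => w _; rewrite prodD1.
have [p1 p2] := step _ mp (fun x => funrpos_ge0 _ x) ip.
have [n1 n2] := step _ mn (fun x => funrneg_ge0 _ x) inn.
have E w : \prod_t F t (Z t w) =
    (F s)^\+ (Z s w) * \prod_(t | t != s) F t (Z t w) -
    (F s)^\- (Z s w) * \prod_(t | t != s) F t (Z t w).
  by rewrite (bigD1 s)//= -mulrBl -[in LHS](funrposBneg (F s)).
have E' : \int[P]_w F s (Z s w) =
    \int[P]_w (F s)^\+ (Z s w) - \int[P]_w (F s)^\- (Z s w).
  rewrite -RintegralB//; apply: eq_Rintegral => w _.
  by rewrite -[in LHS](funrposBneg (F s)).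
under eq_fun do rewrite E.
under eq_Rintegral do rewrite E.
split; first by under eq_fun do rewrite EFinB; exact: integrableB.
by rewrite RintegralB// p2 n2 [RHS](bigD1 s)//= E' mulrBl.
Qed.

Lemma expectation_prod F :
  (forall s, measurable_fun setT (F s)) ->
  (forall s, P.-integrable setT (EFin \o (F s \o Z s))) ->
  P.-integrable setT (fun w => (\prod_s F s (Z s w))%:E) /\
  \int[P]_w (\prod_s F s (Z s w)) = \prod_s \int[P]_w F s (Z s w).
Proof.
move=> mF iF; apply: (indep_integral (r := enum I)) => // s.
by rewrite mem_enum.
Qed.

End independence.

Section design_moments.
Variables (R : realType) (d : measure_display) (Omega : measurableType d).
Variables (P : probability Omega R) (sigma : R) (n : nat).
Variables (X eps : 'I_n -> {RV P >-> R}).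
Hypothesis design : regression_design sigma X eps.

Lemma prod_pair_support (I : finType) (l m : I) (h : I -> R) : l != m ->
  \prod_i (if (i == l) || (i == m) then h i else 1) = h l * h m.
Proof.
move=> lm; rewrite (bigD1 l)//= eqxx (bigD1 m)/=; last by rewrite eq_sym.
rewrite eqxx orbT big1 ?mulr1// => i /andP[/negPf -> /negPf ->].
by [].
Qed.

Lemma integrable_bounded (h : Omega -> R) (c : R) : measurable_fun setT h ->
  (forall w, `|h w| <= c) -> P.-integrable setT (EFin \o h).
Proof.
move=> mh hc; apply: (@le_integrable _ _ _ P setT measurableT _ (cst c%:E)).
- exact/measurable_EFinP.
- by move=> w _; rewrite /= lee_fin (le_trans (hc w))// ler_norm.
- exact: finite_measure_integrable_cst.
Qed.

Lemma integrable_of_sqr (h : Omega -> R) (v : R) : measurable_fun setT h ->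
  (\int[P]_w ((h w) ^+ 2)%:E <= v%:E)%E -> P.-integrable setT (EFin \o h).
Proof.
move=> mh h2; have ih2 : P.-integrable setT (EFin \o (fun w => (h w) ^+ 2)).
  apply/integrableP; split.
    by apply/measurable_EFinP; exact: measurable_funX.
  under eq_integral do rewrite gee0_abs ?lee_fin ?sqr_ge0//.
  exact: le_lt_trans h2 (ltry _).
have i1 : P.-integrable setT (EFin \o (fun w => 1 + (h w) ^+ 2)).
  rewrite (_ : EFin \o _ = ((EFin \o (cst 1%R : Omega -> R)) \+
      (EFin \o (fun w => (h w ^+ 2)%R)))%E); last first.
    by apply/funext => w /=; rewrite EFinD.
  by apply: integrableD => //; exact: finite_measure_integrable_cst.
apply: (@le_integrable _ _ _ P setT measurableT _ _ _ _ i1).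
  by apply/measurable_EFinP; exact: mh.
move=> x _; rewrite /= lee_fin [leRHS]ger0_norm; last by rewrite addr_ge0 ?sqr_ge0.
rewrite -[X in _ + X]real_normK ?num_real//; set z := `|_|.
have z0 : 0 <= z by exact: normr_ge0.
nra.
Qed.

Section product_statistic.
Variables (f g : R -> R) (b v : R).
Hypotheses (mf : measurable_fun setT f) (mg : measurable_fun setT g).
Hypothesis fb : forall x, `|f x| <= b.
Hypothesis g2 : forall l, (\int[P]_w ((g (eps l w)) ^+ 2)%:E <= v%:E)%E.

Let Z l w := f (X l w) * g (eps l w).

Let b0 : 0 <= b. Proof. exact: le_trans (fb 0). Qed.

Let mfX l : measurable_fun setT (fun w => f (X l w)).
Proof. by apply: measurableT_comp => //; exact: measurable_funPT. Qed.

Let mge l : measurable_fun setT (fun w => g (eps l w)).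
Proof. by apply: measurableT_comp => //; exact: measurable_funPT. Qed.

Let ig2 l : P.-integrable setT (EFin \o (fun w => (g (eps l w)) ^+ 2)).
Proof.
apply/integrableP; split.
  by apply/measurable_EFinP; exact: measurable_funX.
under eq_integral do rewrite gee0_abs ?lee_fin ?sqr_ge0//.
exact: le_lt_trans (g2 l) (ltry _).
Qed.

Let ig l : P.-integrable setT (EFin \o (g \o eps l)).
Proof. by apply: integrable_of_sqr; [exact: mge|exact: g2]. Qed.

Let if_ l : P.-integrable setT (EFin \o (f \o X l)).
Proof. by apply: (@integrable_bounded _ b); [exact: mfX|move=> w; exact: fb]. Qed.

Let cross l m : l != m ->
  P.-integrable setT (fun w => (Z l w * Z m w)%:E) /\
  \int[P]_w (Z l w * Z m w) =
  (\int[P]_w f (X l w) * \int[P]_w g (eps l w)) *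
  (\int[P]_w f (X m w) * \int[P]_w g (eps m w)).
Proof.
move=> lm; have [_ _ ind] := design.
pose F (s : 'I_n + 'I_n) : R -> R := match s with
  | inl i => if (i == l) || (i == m) then f else cst 1
  | inr i => if (i == l) || (i == m) then g else cst 1 end.
pose V (s : 'I_n + 'I_n) : Omega -> R :=
  match s with inl i => X i : Omega -> R | inr i => eps i end.
have mV s : measurable_fun setT (V s) by case: s => i; exact: measurable_funPT.
have [||] := @expectation_prod R _ Omega P _ V mV ind F.
- by case=> i /=; case: ifP => // _; exact: measurable_cst.
- by case=> i /=; case: ifP => _ //; exact: finite_measure_integrable_cst.
have E w : \prod_s F s (V s w) = Z l w * Z m w.
  rewrite big_sumType /F /V.
  rewrite -[Z l w * Z m w]mulrACA.
  rewrite -(@prod_pair_support _ l m (fun i => f (X i w)))//.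
  rewrite -(@prod_pair_support _ l m (fun i => g (eps i w)))//.
  by congr (_ * _); apply: eq_bigr => i _; case: ifP.
have E' : \prod_s \int[P]_w F s (V s w) =
    (\int[P]_w f (X l w) * \int[P]_w g (eps l w)) *
    (\int[P]_w f (X m w) * \int[P]_w g (eps m w)).
  rewrite big_sumType /F /V mulrACA.
  rewrite -(@prod_pair_support _ l m (fun i => \int[P]_w f (X i w)))//.
  rewrite -(@prod_pair_support _ l m (fun i => \int[P]_w g (eps i w)))//.
  have c1 : \int[P]_w (1 : R) = 1.
    by rewrite Rintegral_cst//= mul1r probability_setT.
  by congr (_ * _); apply: eq_bigr => i _; case: ifP.
rewrite E' => i1 i2; split; first by under eq_fun do rewrite -E.
by rewrite -i2; apply: eq_Rintegral => w _; rewrite E.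
Qed.

Let diag l : P.-integrable setT (fun w => (Z l w * Z l w)%:E) /\
  \int[P]_w (Z l w * Z l w) <= b ^+ 2 * v.
Proof.
have le w : Z l w * Z l w <= b ^+ 2 * (g (eps l w)) ^+ 2.
  rewrite -expr2 exprMn ler_wpM2r ?sqr_ge0// -[leLHS]real_normK ?num_real//.
  by rewrite lerXn2r ?nnegrE.
have ib : P.-integrable setT (EFin \o (fun w => b ^+ 2 * (g (eps l w)) ^+ 2)).
  rewrite (_ : EFin \o _ =
    fun w => ((b ^+ 2)%:E * (EFin \o (fun w => ((g (eps l w)) ^+ 2)%R)) w)%E).
    exact: integrableZl.
  by apply/funext => w /=; rewrite EFinM.
have iZ : P.-integrable setT (fun w => (Z l w * Z l w)%:E).
  apply: (@le_integrable _ _ _ P setT measurableT _ _ _ _ ib).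
    apply/measurable_EFinP; apply: measurable_funM; exact: measurable_funM.
  move=> w _; rewrite /= lee_fin ger0_norm -?expr2 ?sqr_ge0//.
  by rewrite (le_trans _ (ler_norm _))// expr2.
split => //; apply: le_trans (le_Rintegral measurableT iZ ib (fun w _ => le w)) _.
rewrite (RintegralZl _ measurableT (ig2 l)).
rewrite ler_wpM2l ?sqr_ge0// -lee_fin /Rintegral fineK; first exact: g2.
exact: integrable_fin_num (ig2 l).
Qed.

Lemma Rintegral_sum (I : eqType) (s : seq I) (h : I -> Omega -> R) :
  (forall i, P.-integrable setT (EFin \o h i)) ->
  P.-integrable setT (EFin \o (fun w => \sum_(i <- s) h i w)) /\
  \int[P]_w (\sum_(i <- s) h i w) = \sum_(i <- s) \int[P]_w h i w.
Proof.
move=> ih; have E : EFin \o (fun w => \sum_(i <- s) h i w) =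
    (fun w => \sum_(i <- s) (EFin \o h i) w)%E.
  by apply/funext => w /=; rewrite sumEFin.
split; first by rewrite E; apply: integrable_sum => // i _; exact: ih.
rewrite {1}/Rintegral; have := integral_sum measurableT ih s xpredT.
rewrite -E => ->; rewrite (eq_bigr (fun i => (\int[P]_w h i w)%:E)) ?sumEFin//.
by move=> i _; rewrite /Rintegral fineK//; exact: integrable_fin_num (ih i).
Qed.

(** Distinct summands are uncorrelated as soon as each has one centred factor, so
    only the diagonal terms remain. The alternative lets the same bound serve the
    noise, where g is centred, and the Gram matrix of the basis, where f is. *)
Lemma empirical_mean_sqr_le :
  (forall l, \int[P]_w f (X l w) = 0 \/ \int[P]_w g (eps l w) = 0) ->
  (\int[P]_w (((\sum_l f (X l w) * g (eps l w)) / n%:R) ^+ 2)%:E <=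
   (b ^+ 2 * v / n%:R)%:E)%E.
Proof.
move=> cen.
have iZZ (p : 'I_n * 'I_n) : P.-integrable setT (EFin \o (fun w => Z p.1 w * Z p.2 w)).
  case: p => l m /=; have [->|lm] := eqVneq l m; first by have [] := diag m.
  by have [] := cross lm.
have [iS ES] := @Rintegral_sum _ (index_enum _) _ iZZ.
have E w : ((\sum_l f (X l w) * g (eps l w)) / n%:R) ^+ 2 =
    n%:R ^- 2 * \sum_(p : 'I_n * 'I_n) (Z p.1 w * Z p.2 w).
  rewrite exprMn mulrC -exprVn; congr (_ * _).
  rewrite expr2 mulr_suml -(pair_big xpredT xpredT (fun l m => Z l w * Z m w))/=.
  by apply: eq_bigr => l _; rewrite mulr_sumr.
under eq_integral do rewrite E EFinM.
rewrite (integralZl measurableT iS).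
rewrite -[X in (_ * X)%E]fineK; last exact: integrable_fin_num iS.
rewrite -EFinM lee_fin [fine _]ES.
rewrite -(pair_big xpredT xpredT (fun l m => \int[P]_w (Z l w * Z m w)))/=.
have D l : \sum_m \int[P]_w (Z l w * Z m w) <= b ^+ 2 * v.
  rewrite (bigD1 l)//= big1 ?addr0; first by have [] := diag l.
  move=> m ml; have [|_ ->] := @cross l m; first by rewrite eq_sym.
  by case: (cen l) => ->; rewrite ?(mul0r, mulr0).
apply: (@le_trans _ _ (n%:R ^- 2 * (n%:R * (b ^+ 2 * v)))).
  rewrite ler_wpM2l ?invr_ge0 ?exprn_ge0//.
  apply: le_trans (ler_sum _ (fun l _ => D l)) _.
  by rewrite sumr_const card_ord mulr_natl.
have [->|n0] := eqVneq n 0%N; first by rewrite invr0 !mulr0 mul0r mulr0.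
rewrite le_eqVlt; apply/orP; left; apply/eqP; field.
by rewrite pnatr_eq0.
Qed.

End product_statistic.

End design_moments.

Section design_laws.
Variables (R : realType) (d : measure_display) (Omega : measurableType d).
Variables (P : probability Omega R).
Local Notation leb := (@lebesgue_measure R).

Lemma integral_has_law (Q : {measure set (measurableTypeR R) -> \bar R}) (Z : Omega -> R) :
  measurable_fun setT Z -> has_law P Z Q ->
  forall h : R -> \bar R, measurable_fun setT h -> (forall x, 0 <= h x)%E ->
  (\int[P]_w h (Z w) = \int[Q]_x h x)%E.
Proof.
move=> mZ lZ h mh h0.
have H := @integral_transport R _ _ _ _ P Q Z (cst 1) idfun (cst 1).
have T : (\int[P]_w ((cst 1 w)%:E * h (Z w)) =
    \int[Q]_x ((cst 1 x)%:E * h (idfun x)))%E.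
  apply: H => //=; [exact: measurable_id|move=> A mA].
  under eq_integral do rewrite mul1e.
  under [in RHS]eq_integral do rewrite mul1e.
  rewrite [RHS]integral_indic// setIT -(lZ _ mA).
  have mAZ : measurable (Z @^-1` A) by rewrite -[X in measurable X]setTI; exact: mZ.
  transitivity (\int[P]_w (\1_(Z @^-1` A) w)%:E)%E => //.
  by rewrite integral_indic// setIT.
transitivity (\int[P]_w ((cst 1 w)%:E * h (Z w)))%E.
  by apply: eq_integral => w _; rewrite mul1e.
by rewrite T; apply: eq_integral => x _; rewrite mul1e.
Qed.

Section uniform.
Variable X : {RV P >-> R}.
Hypothesis lX : has_law P X (uniform_prob (@ltr01 R)).

Lemma integral_uniform_law (h : R -> \bar R) :
  measurable_fun setT h -> (forall x, 0 <= h x)%E ->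
  (\int[P]_w h (X w) = \int[leb]_(x in `[0%R, 1%R]) h x)%E.
Proof.
move=> mh h0.
rewrite (@integral_has_law (uniform_prob (@ltr01 R)) X)//.
  by rewrite integral_uniform// subr0 invr1 mul1e.
Qed.

(** Adding the bound b reduces to the nonnegative case. *)
Lemma expectation_uniform_law (f : R -> R) (b : R) : continuous f ->
  (forall x, `|f x| <= b) ->
  \int[P]_w f (X w) = \int[leb]_(x in `[0, 1]) f x.
Proof.
move=> cf fb.
have mf : measurable_fun setT f by exact: continuous_measurable_fun.
have mX : measurable_fun setT X by exact: measurable_funPT.
have iX : P.-integrable setT (EFin \o (f \o X)).
  apply: (@integrable_bounded _ _ _ P _ b); first exact: measurableT_comp.
  by move=> w; exact: fb.
have ib : P.-integrable setT (EFin \o (cst b : Omega -> R)).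
  exact: finite_measure_integrable_cst.
have cb : continuous (cst b : R -> R) by move=> x; exact: cvg_cst.
have E : \int[P]_w (f (X w) + b) = \int[leb]_(x in `[0, 1]) (f x + b).
  rewrite /Rintegral; congr fine.
  apply: (@integral_uniform_law (fun x => (f x + b)%:E)).
    by apply/measurable_EFinP; apply: measurable_funD.
  by move=> x; rewrite lee_fin -lerBlDr sub0r; have := fb x; rewrite ler_norml => /andP[].
move: E; rewrite Rintegral01D// Rintegral01_cst RintegralD//.
by rewrite Rintegral_cst//= probability_setT mulr1 => /addIr.
Qed.

Lemma uniform_law_ae (Q : R -> Prop) :
  {ae leb, forall x, x \in `[0, 1] -> Q x} ->
  exists B : set Omega, [/\ measurable B, P B = 0%E & forall w, ~ B w -> Q (X w)].
Proof.
move=> [N [mN N0 hN]].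
have mX : measurable_fun setT X by exact: measurable_funPT.
have mB : measurable (N `|` ~` `[0, 1]%classic) by apply: measurableU => //; exact: measurableC.
exists (X @^-1` (N `|` ~` `[0, 1]%classic)); split.
- by rewrite -[X in measurable X]setTI; exact: mX.
- rewrite lX// /uniform_prob integral_uniform_pdf setIUl setICl setU0.
  apply: null_set_integral => //; first exact: measurableI.
    by apply/measurable_EFinP; apply: measurable_funTS; exact: measurable_uniform_pdf.
  apply/eqP; rewrite eq_le measure_ge0 andbT -N0.
  by apply: le_measure; rewrite ?inE//; exact: measurableI.
- move=> w /not_orP[nN /contrapT w01].
  by apply: contrapT => nQ; apply: nN; apply: hN => /= /(_ w01).
Qed.

End uniform.

Section gaussian.
Variables (sigma : R) (eps : {RV P >-> R}).
Hypothesis s0 : 0 < sigma.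
Hypothesis le : has_law P eps (normal_prob 0 sigma).

Lemma noise_second_moment : (\int[P]_w ((eps w) ^+ 2)%:E <= (sigma ^+ 2)%:E)%E.
Proof.
have me : measurable_fun setT eps by exact: measurable_funPT.
have mq : measurable_fun setT (fun x : R => (x ^+ 2)%:E).
  by apply/measurable_EFinP; exact: measurable_funX.
rewrite (@integral_has_law (normal_prob 0 sigma) eps me le (fun x => (x ^+ 2)%:E))//; last first.
  by move=> x; rewrite lee_fin sqr_ge0.
have := normal_second_moment_le 0 (lt0r_neq0 s0).
by under eq_integral do rewrite subr0.
Qed.

(** By symmetry the positive and negative parts have the same expectation. *)
Lemma noise_mean0 : \int[P]_w (eps w) = 0.
Proof.
have me : measurable_fun setT eps by exact: measurable_funPT.
have ie : P.-integrable setT (EFin \o eps).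
  exact: integrable_of_sqr noise_second_moment.
have ip : P.-integrable setT (EFin \o (eps^\+)%R) by exact: integrable_funrpos.
have inn : P.-integrable setT (EFin \o (eps^\-)%R) by exact: integrable_funrneg.
have mp : measurable_fun setT (fun x : R => (Num.max x 0)%:E).
  by apply/measurable_EFinP; apply: measurable_maxr.
have E : (\int[P]_w ((eps^\+)%R w)%:E = \int[P]_w ((eps^\-)%R w)%:E)%E.
  rewrite (@integral_has_law (normal_prob 0 sigma) eps me le (fun x => (Num.max x 0)%:E))//; last first.
    by move=> x; rewrite lee_fin le_max lexx orbT.
  rewrite integral_normal_sym ?gt_eqF//; last first.
    by move=> x; rewrite lee_fin le_max lexx orbT.
  rewrite -(@integral_has_law (normal_prob 0 sigma) eps me le (fun x => (Num.max (- x) 0)%:E))//.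
  - by apply/measurable_EFinP; apply: measurable_maxr => //; exact: oppr_measurable.
  - by move=> x; rewrite lee_fin le_max lexx orbT.
transitivity (\int[P]_w ((eps^\+)%R w - (eps^\-)%R w)).
  by apply: eq_Rintegral => w _; rewrite -[in LHS](funrposBneg eps).
by rewrite RintegralB// /Rintegral E subrr.
Qed.

End gaussian.

End design_laws.

(** * Kernel ridge regression in frequency coordinates *)

Section finite_sums.
Variable R : realType.

Lemma cauchy_schwarz_sum (I : Type) (r : seq I) (u v : I -> R) :
  (\sum_(i <- r) u i * v i) ^+ 2 <=
  (\sum_(i <- r) u i ^+ 2) * (\sum_(i <- r) v i ^+ 2).
Proof.
suff H : 0 <= \sum_(i <- r) \sum_(j <- r) (u i * v j - u j * v i) ^+ 2.
  rewrite -subr_ge0 -(pmulr_rge0 _ (ltr0n R 2)).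
  apply: le_trans H _; rewrite le_eqVlt; apply/orP; left; apply/eqP.
  transitivity (\sum_(i <- r) \sum_(j <- r) (u i ^+ 2 * v j ^+ 2 +
      v i ^+ 2 * u j ^+ 2 - 2 * ((u i * v i) * (u j * v j)))).
    by apply: eq_bigr => i _; apply: eq_bigr => j _; ring.
  transitivity (\sum_(i <- r) (u i ^+ 2 * (\sum_(j <- r) v j ^+ 2) +
      v i ^+ 2 * (\sum_(j <- r) u j ^+ 2) -
      2 * ((u i * v i) * (\sum_(j <- r) u j * v j)))).
    apply: eq_bigr => i _.
    by rewrite sumrB big_split /= -mulr_sumr -mulr_sumr -mulr_sumr -mulr_sumr.
  by rewrite sumrB big_split /= -!mulr_suml -mulr_sumr -mulr_suml; ring.
by apply: sumr_ge0 => i _; apply: sumr_ge0 => j _; exact: sqr_ge0.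
Qed.

Lemma cauchy_schwarz_weighted (I : Type) (r : seq I) (u v w : I -> R) :
  (forall i, 0 < w i) ->
  (\sum_(i <- r) u i * v i) ^+ 2 <=
  (\sum_(i <- r) w i * v i ^+ 2) * (\sum_(i <- r) u i ^+ 2 / w i).
Proof.
move=> w0; pose s i := Num.sqrt (w i).
have s0 i : s i != 0 by rewrite gt_eqF// sqrtr_gt0.
have s2 i : s i ^+ 2 = w i by rewrite sqr_sqrtr// ltW.
have -> : \sum_(i <- r) u i * v i = \sum_(i <- r) (s i * v i) * (u i / s i).
  by apply: eq_bigr => i _; field.
apply: le_trans (cauchy_schwarz_sum _ _ _) _.
rewrite le_eqVlt; apply/orP; left; apply/eqP; congr (_ * _).
  by apply: eq_bigr => i _; rewrite exprMn s2.
by apply: eq_bigr => i _; rewrite exprMn exprVn s2.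
Qed.

Lemma lim_series_lincomb (I : Type) (r : seq I) (a : I -> R) (u : I -> nat -> R) :
  (forall j, cvgn (series (u j))) ->
  series (fun i => \sum_(j <- r) a j * u j i) @ \oo -->
  \sum_(j <- r) a j * limn (series (u j)).
Proof.
move=> cu; elim: r => [|j r IH].
  rewrite big_nil (_ : series _ = cst 0); first exact: cvg_cst.
  by apply/funext => N; rewrite /series /= big1// => i _; rewrite big_nil.
rewrite big_cons (_ : series _ = fun N => a j * series (u j) N +
    series (fun i => \sum_(j0 <- r) a j0 * u j0 i) N).
  by apply: cvgD => //; apply: cvgM; [exact: cvg_cst|exact: cu].
apply/funext => N; rewrite /series /= mulr_sumr -big_split /=.
by apply: eq_bigr => i _; rewrite big_cons.
Qed.

End finite_sums.

Section ridge.
Variable R : realType.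
Variables (m : nat -> R) (K : R -> R -> R).
Hypothesis m0 : forall i, 0 < m i.
Hypothesis cm : cvgn (series m).
Local Notation psi i x := (fourier_deriv 0 i x).
Hypothesis KE : forall x x',
  K x x' = limn (series (fun i => m i * psi i x * psi i x')).

Let cK x x' : cvgn (series (fun i => m i * psi i x * psi i x')).
Proof.
have c4 := is_cvg_series_mull (a := 4) cm.
apply: (@dominated_cvg_series _ _ _ _ c4) => i.
rewrite (normrM (_ * _)) (normrM (m i)) (ger0_norm (ltW (m0 i))) -mulrA [leLHS]mulrC.
apply: ler_wpM2r; first exact: ltW.
have -> : 4 = 2 * 2 :> R by ring.
by apply: ler_pM => //; exact: normr_fourier_basis_le.
Qed.

Variables (n : nat) (x : 'cV[R]_n) (lam : R).
Hypothesis n0 : (0 < n)%N.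
Hypothesis lam0 : 0 < lam.
Local Notation xs l := (x l ord0).
Local Notation G := (regularized_gram K lam x).

Let nl0 : 0 < n%:R * lam. Proof. by rewrite mulr_gt0// ltr0n. Qed.

(** In frequency coordinates the quadratic form is a series of squares. *)
Lemma gram_quadratic_ge0 (v : 'I_n -> R) :
  0 <= \sum_l \sum_j v l * v j * K (xs l) (xs j).
Proof.
have -> : \sum_l \sum_j v l * v j * K (xs l) (xs j) =
    \sum_(p : 'I_n * 'I_n) v p.1 * v p.2 *
      limn (series (fun i => m i * psi i (xs p.1) * psi i (xs p.2))).
  rewrite -(pair_big xpredT xpredT (fun l j => v l * v j *
      limn (series (fun i => m i * psi i (xs l) * psi i (xs j)))))/=.
  by apply: eq_bigr => l _; apply: eq_bigr => j _; rewrite KE.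
have H := @lim_series_lincomb _ _ (index_enum _)
  (fun p : 'I_n * 'I_n => v p.1 * v p.2)
  (fun p i => m i * psi i (xs p.1) * psi i (xs p.2)) (fun p => @cK _ _).
rewrite -(cvg_lim _ H)//; apply: limr_ge; first by apply/cvg_ex; eexists; exact: H.
apply: nearW => N; apply: sumr_ge0 => i _.
rewrite -(pair_big xpredT xpredT (fun l j => v l * v j *
      (m i * psi i (xs l) * psi i (xs j))))/=.
have -> : \sum_l \sum_j v l * v j * (m i * psi i (xs l) * psi i (xs j)) =
    m i * (\sum_l v l * psi i (xs l)) ^+ 2.
  rewrite expr2 mulr_suml mulr_sumr; apply: eq_bigr => l _.
  by rewrite !mulr_sumr; apply: eq_bigr => j _; ring.
by rewrite mulr_ge0 ?sqr_ge0// ltW.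
Qed.

Lemma regularized_gramE l j : G l j = K (xs l) (xs j) + (n%:R * lam) *+ (l == j).
Proof. by rewrite !mxE. Qed.

Lemma regularized_gram_unit : G \in unitmx.
Proof.
rewrite -row_free_unit; apply/inj_row_free => v vG.
have : (v *m G *m v^T) ord0 ord0 = 0 by rewrite vG mul0mx mxE.
rewrite mxE.
have -> : \sum_j (v *m G) ord0 j * v^T j ord0 =
   \sum_l \sum_j v ord0 l * v ord0 j * K (xs l) (xs j) +
   n%:R * lam * \sum_l v ord0 l ^+ 2.
  rewrite [X in _ = X + _]exchange_big /= mulr_sumr -big_split /=.
  apply: eq_bigr => j _; rewrite !mxE mulr_suml.
  transitivity (\sum_l (v ord0 l * v ord0 j * K (xs l) (xs j) +
    v ord0 l * v ord0 j * (n%:R * lam) *+ (l == j))).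
    apply: eq_bigr => l _; rewrite regularized_gramE.
    by case: (l == j); rewrite ?mulr1n ?mulr0n; ring.
  rewrite big_split /=; congr (_ + _).
  rewrite (bigD1 j)//= eqxx mulr1n big1 ?addr0; first by ring.
  by move=> l /negPf ->; rewrite mulr0n.
move=> /eqP; rewrite paddr_eq0 ?gram_quadratic_ge0//; last first.
  by rewrite mulr_ge0 ?(ltW nl0)//; apply: sumr_ge0 => i _; exact: sqr_ge0.
move=> /andP[_]; rewrite mulf_eq0 (gt_eqF nl0) /= psumr_eq0; last first.
  by move=> i _; exact: sqr_ge0.
move=> /allP H; apply/rowP => i; rewrite mxE; apply/eqP.
have := H i; rewrite mem_index_enum => /(_ isT).
by rewrite sqrf_eq0.
Qed.

Variable y : 'cV[R]_n.
Let a := invmx G *m y.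

Lemma ridge_normal_eq l :
  \sum_j a j ord0 * K (xs l) (xs j) + n%:R * lam * a l ord0 = y l ord0.
Proof.
have := congr1 (fun M : 'cV[R]_n => M l ord0) (mulKVmx regularized_gram_unit y).
rewrite /= -/a mxE => <-.
rewrite (bigD1 l)//= [RHS](bigD1 l)//= regularized_gramE eqxx mulr1n.
rewrite [X in _ = _ + X](eq_bigr (fun j => a j ord0 * K (xs l) (xs j))); last first.
  move=> j jl; rewrite regularized_gramE eq_sym (negPf jl) mulr0n addr0.
  by rewrite mulrC.
by ring.
Qed.

(** Fourier coefficients of the kernel ridge fit to the responses y. *)
Definition ridge_coef i := m i * \sum_j a j ord0 * psi i (xs j).
Local Notation c := ridge_coef.

Let Ca := 2 * \sum_j `|a j ord0|.

Let score_le i : `|\sum_j a j ord0 * psi i (xs j)| <= Ca.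
Proof.
rewrite /Ca mulr_sumr; apply: le_trans (ler_norm_sum _ _ _) _.
apply: ler_sum => j _; rewrite normrM mulrC ler_wpM2r//.
exact: normr_fourier_basis_le.
Qed.

Let Ca0 : 0 <= Ca. Proof. exact: le_trans (score_le 0). Qed.

Lemma ridge_coef_le i : `|c i| <= Ca * m i.
Proof.
by rewrite normrM (ger0_norm (ltW (m0 i))) mulrC ler_wpM2r// ltW.
Qed.

Lemma ridge_fitE t :
  limn (series (fun i => c i * psi i t)) = \sum_j a j ord0 * K t (xs j).
Proof.
have H := @lim_series_lincomb _ _ (index_enum _) (fun j : 'I_n => a j ord0)
  (fun j i => m i * psi i t * psi i (xs j)) (fun j => @cK _ _).
rewrite (eq_bigr (fun j => a j ord0 *
  limn (series (fun i => m i * psi i t * psi i (xs j))))); last first.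
  by move=> j _; rewrite KE.
rewrite -(cvg_lim _ H)//; congr (limn (series _)); apply/funext => i.
rewrite /c mulrAC mulr_sumr; apply: eq_bigr => j _; ring.
Qed.

Variable b : nat -> R.
Hypothesis cb : cvgn (series (fun i => `|b i|)).
Hypothesis cb2 : cvgn (series (fun i => b i ^+ 2 / m i)).

Definition ridge_error i := c i - b i.
Local Notation g := ridge_error.
Local Notation B := (fourier_series 0 b).
Local Notation Gf := (fourier_series 0 g).
Local Notation e l := (y l ord0 - B (xs l)).

Let cg : cvgn (series (fun i => `|g i|)).
Proof.
have h := is_cvg_series_add (is_cvg_series_mull (a := Ca) cm) cb.
apply: (@dominated_cvg_series _ _ _ _ h) => i; rewrite normr_id.
by apply: le_trans (ler_normB _ _) _; rewrite lerD2r ridge_coef_le.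
Qed.

Let cpsi (u : nat -> R) t : cvgn (series (fun i => `|u i|)) ->
  cvgn (series (fun i => u i * psi i t)).
Proof.
move=> cu; have h := is_cvg_series_mull (a := 2) cu.
apply: (@dominated_cvg_series _ _ _ _ h) => i.
by rewrite normrM mulrC ler_wpM2r// normr_fourier_basis_le.
Qed.

Let cc : cvgn (series (fun i => `|c i|)).
Proof.
have h := is_cvg_series_mull (a := Ca) cm.
apply: (@dominated_cvg_series _ _ _ _ h) => i; rewrite normr_id.
exact: ridge_coef_le.
Qed.

Let GfE t : Gf t = \sum_j a j ord0 * K t (xs j) - B t.
Proof.
rewrite -ridge_fitE /fourier_series -limB; [|exact: cpsi|exact: cpsi].
congr (limn _); apply/funext => N; rewrite !fctE /series /= -sumrB.
by apply: eq_bigr => i _; rewrite mulrBl.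
Qed.

Let residual l : n%:R * lam * a l ord0 = e l - Gf (xs l).
Proof. by rewrite GfE -(ridge_normal_eq l); ring. Qed.

Let cg2 : cvgn (series (fun i => g i ^+ 2 / m i)).
Proof.
have h := is_cvg_series_add (is_cvg_series_mull (a := 2 * Ca ^+ 2) cm)
  (is_cvg_series_mull (a := 2) cb2).
apply: (@dominated_cvg_series _ _ _ _ h) => i.
rewrite ger0_norm; last by rewrite mulr_ge0 ?sqr_ge0// invr_ge0 ltW.
have h1 : g i ^+ 2 <= 2 * (Ca ^+ 2 * m i ^+ 2) + 2 * b i ^+ 2.
  have : c i ^+ 2 <= Ca ^+ 2 * m i ^+ 2.
    rewrite -exprMn -[leLHS]real_normK ?num_real//.
    by rewrite lerXn2r ?nnegrE ?ridge_coef_le// mulr_ge0// ltW.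
  rewrite /g; have := sqr_ge0 (c i + b i); nra.
rewrite ler_pdivrMr// mulrDl; apply: le_trans h1 _.
rewrite le_eqVlt; apply/orP; left; apply/eqP; field.
by rewrite gt_eqF.
Qed.

Let score_series : series (fun i => g i * c i / m i) @ \oo -->
  \sum_j a j ord0 * Gf (xs j).
Proof.
have H := @lim_series_lincomb _ _ (index_enum _) (fun j : 'I_n => a j ord0)
  (fun j i => g i * psi i (xs j)) (fun j => @cpsi _ _ cg).
rewrite (_ : (fun i => g i * c i / m i) =
  (fun i => \sum_j a j ord0 * (g i * psi i (xs j)))) //.
apply/funext => i; rewrite /c mulrCA mulrAC mulfV ?gt_eqF// mul1r mulr_sumr.
by apply: eq_bigr => j _; rewrite mulrCA.
Qed.

Let cgb : cvgn (series (fun i => g i * b i / m i)).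
Proof.
have h1 : cvgn (series (fun i => g i * c i / m i)).
  by apply/cvg_ex; eexists; exact: score_series.
have h := is_cvg_series_add h1 (is_cvg_series_mull (a := -1) cg2).
rewrite (_ : (fun i => g i * b i / m i) =
  (fun i => g i * c i / m i + -1 * (g i ^+ 2 / m i))) //.
by apply/funext => i; rewrite /g; field; rewrite gt_eqF.
Qed.

Local Notation S u := (limn (series u)).

(** The normal equations tested against the error, in frequency coordinates. *)
Lemma ridge_energy :
  (\sum_l Gf (xs l) ^+ 2) / n%:R + lam * S (fun i => g i ^+ 2 / m i) =
  (\sum_l e l * Gf (xs l)) / n%:R - lam * S (fun i => g i * b i / m i).
Proof.
have E : S (fun i => g i * c i / m i) =
    S (fun i => g i ^+ 2 / m i) + S (fun i => g i * b i / m i).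
  rewrite -lim_series_add//; congr (limn (series _)); apply/funext => i.
  by rewrite /g; field; rewrite gt_eqF.
have := cvg_lim (@Rhausdorff R) score_series; rewrite E => E1.
have E2 : n%:R * lam * (\sum_j a j ord0 * Gf (xs j)) =
    \sum_l e l * Gf (xs l) - \sum_l Gf (xs l) ^+ 2.
  rewrite mulr_sumr -sumrB; apply: eq_bigr => l _.
  by rewrite mulrA residual; ring.
rewrite -E1 in E2; have nn : n%:R != 0 :> R by rewrite pnatr_eq0 -lt0n.
have -> : \sum_l Gf (xs l) ^+ 2 = \sum_l e l * Gf (xs l) - n%:R * lam *
  (S (fun i => g i ^+ 2 / m i) + S (fun i => g i * b i / m i)) by rewrite E2; ring.
by field.
Qed.

Definition shrinkage i := m i / (m i + lam).
Local Notation w := shrinkage.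

Let w0 i : 0 < w i. Proof. by rewrite divr_gt0 ?addr_gt0. Qed.

(** Since 1 / w = 1 + lam / m, this is the squared L2 norm plus lam times the
    squared norm of the reproducing kernel space. *)
Definition weighted_error := S (fun i => g i ^+ 2 / w i).
Local Notation A := weighted_error.

Let gw i : g i ^+ 2 / w i = g i ^+ 2 + lam * (g i ^+ 2 / m i).
Proof. by rewrite /w; field; rewrite !gt_eqF ?addr_gt0. Qed.

Let cgs : cvgn (series (fun i => g i ^+ 2)).
Proof.
have cg' := cg; have h := is_cvg_series_mull (a := limn (series (fun i => `|g i|))) cg'.
apply: (@dominated_cvg_series _ _ _ _ h) => i; rewrite normrX expr2.
apply: ler_wpM2r => //; apply: le_trans (series_le_lim i.+1 _ cg') => //.
by rewrite seriesSr lerDr /series /= sumr_ge0.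
Qed.

Lemma cvg_weighted_error : cvgn (series (fun i => g i ^+ 2 / w i)).
Proof.
rewrite (_ : (fun i => _) = fun i => g i ^+ 2 + lam * (g i ^+ 2 / m i)).
  by apply: is_cvg_series_add => //; exact: is_cvg_series_mull.
exact/funext/gw.
Qed.

Let AE : A = S (fun i => g i ^+ 2) + lam * S (fun i => g i ^+ 2 / m i).
Proof.
rewrite -lim_series_mull// -lim_series_add//; last exact: is_cvg_series_mull.
by congr (limn (series _)); apply/funext/gw.
Qed.

Let gw0 i : 0 <= g i ^+ 2 / w i.
Proof. by rewrite mulr_ge0 ?sqr_ge0// invr_ge0 ltW. Qed.

Lemma weighted_error_ge0 : 0 <= A.
Proof.
apply: le_trans (series_le_lim 0 gw0 cvg_weighted_error).
by rewrite /series /= big_geq.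
Qed.

Let A0 := weighted_error_ge0.

Let A_ge N : series (fun i => g i ^+ 2 / w i) N <= A.
Proof. exact: series_le_lim gw0 cvg_weighted_error. Qed.

Let limit_sqr_le (u : nat -> R) (C : R) : cvgn (series u) -> 0 <= C ->
  (forall N, (series u N) ^+ 2 <= C * series (fun i => g i ^+ 2 / w i) N) ->
  (S u) ^+ 2 <= C * A.
Proof.
move=> cu C0 uC.
have cu2 : (fun N => series u N ^+ 2) @ \oo --> (S u) ^+ 2.
  by apply: (@cvgM _ _ _ _ (series u) (series u)); exact: cu.
rewrite -(cvg_lim _ cu2)//; apply: limr_le; first by apply/cvg_ex; eexists; exact: cu2.
apply: nearW => N; apply: le_trans (uC N) _.
by apply: ler_wpM2l => //; exact: A_ge.
Qed.

Lemma bias_term_le (T : R) :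
  (forall N, lam ^+ 2 * series (fun i => w i * b i ^+ 2 / m i ^+ 2) N <= T) ->
  (lam * S (fun i => g i * b i / m i)) ^+ 2 <= T * A.
Proof.
move=> bT; rewrite -lim_series_mull//.
have T0 : 0 <= T.
  by apply: le_trans (bT 0%N); rewrite /series /= big_geq// mulr0.
apply: limit_sqr_le => // [|N]; first exact: is_cvg_series_mull.
rewrite /series /=.
have := @cauchy_schwarz_weighted R _ (index_iota 0 N) g (fun i => lam * b i / m i) w w0.
rewrite (eq_bigr (fun i => lam * (g i * b i / m i))); last by move=> i _; ring.
move=> /le_trans; apply; apply: ler_wpM2r; first by apply: sumr_ge0.
apply: le_trans (bT N); rewrite /series /= mulr_sumr.
apply: ler_sum => i _; rewrite le_eqVlt; apply/orP; left; apply/eqP.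
by field; rewrite gt_eqF.
Qed.

(** Expanding the error in the basis pairs its coefficients with the empirical
    Fourier coefficients of the residuals; the Cauchy-Schwarz inequality with
    weights w and 1 / w separates the two, as it does for the bias. *)
Lemma noise_term_le (E : R) :
  (forall N, series (fun i => w i *
     ((\sum_l e l * psi i (xs l)) / n%:R) ^+ 2) N <= E) ->
  ((\sum_l e l * Gf (xs l)) / n%:R) ^+ 2 <= E * A.
Proof.
move=> wE.
have H := @lim_series_lincomb _ _ (index_enum _) (fun l : 'I_n => e l / n%:R)
  (fun l i => g i * psi i (xs l)) (fun j => @cpsi _ _ cg).
have -> : (\sum_l e l * Gf (xs l)) / n%:R =
    S (fun i => \sum_l e l / n%:R * (g i * psi i (xs l))).
  rewrite (cvg_lim _ H)// mulr_suml.
  by apply: eq_bigr => l _; rewrite mulrAC.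
have E0 : 0 <= E by apply: le_trans (wE 0%N); rewrite /series /= big_geq.
apply: limit_sqr_le => // [|N]; first by apply/cvg_ex; eexists; exact: H.
rewrite /series /=.
have := @cauchy_schwarz_weighted R _ (index_iota 0 N) g
  (fun i => (\sum_l e l * psi i (xs l)) / n%:R) w w0.
rewrite (eq_bigr (fun i => \sum_l e l / n%:R * (g i * psi i (xs l)))); last first.
  by move=> i _; rewrite mulr_suml mulr_sumr; apply: eq_bigr => l _; ring.
move=> /le_trans; apply; apply: ler_wpM2r; first by apply: sumr_ge0.
exact: wE.
Qed.

(** Entries of the empirical Gram matrix of the basis minus the identity. *)
Definition gram_deviation (p q : nat) : R :=
  (\sum_l psi p (xs l) * psi q (xs l)) / n%:R - (p == q)%:R.

Hypothesis gram_close : forall N,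
  \sum_(0 <= p < N) \sum_(0 <= q < N) w p * w q * gram_deviation p q ^+ 2 <= 4^-1.

(** Replacing the empirical norm of the error by its L2 norm costs the quadratic
    form of the Gram deviation, which by the Cauchy-Schwarz inequality is at most
    the weighted Hilbert-Schmidt norm of the deviation, here 1 / 2, times the
    weighted error. *)
Lemma empirical_norm_ge :
  A / 2 <= (\sum_l Gf (xs l) ^+ 2) / n%:R + lam * S (fun i => g i ^+ 2 / m i).
Proof.
pose GN N l := series (fun i => g i * psi i (xs l)) N.
have fin N : series (fun i => g i ^+ 2) N - series (fun i => g i ^+ 2 / w i) N / 2
    <= (\sum_l GN N l ^+ 2) / n%:R.
  have E : (\sum_l GN N l ^+ 2) / n%:R - series (fun i => g i ^+ 2) N =
     \sum_(p <- index_iota 0 N) \sum_(q <- index_iota 0 N)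
       g p * g q * gram_deviation p q.
    transitivity (\sum_(p <- index_iota 0 N) \sum_(q <- index_iota 0 N)
       (g p * g q * ((\sum_l psi p (xs l) * psi q (xs l)) / n%:R) -
        g p * g q * (p == q)%:R)); last first.
      by apply: eq_bigr => p _; apply: eq_bigr => q _; rewrite /gram_deviation [RHS]mulrBr.
    rewrite [RHS](eq_bigr _ (fun p _ => sumrB _ _ _ _)) sumrB; congr (_ - _).
      rewrite mulr_suml.
      rewrite (eq_bigr (fun l => \sum_(p <- index_iota 0 N)
        \sum_(q <- index_iota 0 N)
        g p * g q * (psi p (xs l) * psi q (xs l) / n%:R))); last first.
        move=> l _; rewrite /GN /series /= expr2 mulr_suml mulr_suml.
        apply: eq_bigr => p _; rewrite mulr_sumr mulr_suml.
        by apply: eq_bigr => q _; ring.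
      rewrite exchange_big /=; apply: eq_bigr => p _.
      rewrite exchange_big /=; apply: eq_bigr => q _.
      by rewrite mulr_suml mulr_sumr.
    rewrite /series /=; apply: eq_big_nat => p /andP[_ pN].
    rewrite (bigD1_seq p) ?iota_uniq ?mem_index_iota//= eqxx mulr1 expr2.
    by rewrite big1 ?addr0// => q qp; rewrite eq_sym (negPf qp) mulr0.
  have CS := @cauchy_schwarz_weighted R _
    [seq (p, q) | p <- index_iota 0 N, q <- index_iota 0 N]
    (fun pq => g pq.1 * g pq.2) (fun pq => gram_deviation pq.1 pq.2)
    (fun pq => w pq.1 * w pq.2) (fun pq => mulr_gt0 (w0 pq.1) (w0 pq.2)).
  move: CS; rewrite !big_allpairs /= -E.
  have -> : \sum_(i <- index_iota 0 N) \sum_(j <- index_iota 0 N)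
      (g i * g j) ^+ 2 / (w i * w j) = (series (fun i => g i ^+ 2 / w i) N) ^+ 2.
    rewrite /series /= expr2 mulr_suml; apply: eq_bigr => i _.
    rewrite mulr_sumr; apply: eq_bigr => j _; field.
    by rewrite !gt_eqF.
  set D := _ - _; set AN := series _ N => CS.
  have AN0 : 0 <= AN by apply: sumr_ge0.
  have D2 : D ^+ 2 <= (AN / 2) ^+ 2.
    apply: le_trans CS _; rewrite exprMn mulrC ler_wpM2l ?sqr_ge0//.
    by apply: le_trans (gram_close N) _; rewrite exprVn; lra.
  have : `|D| <= AN / 2.
    by rewrite -(@ler_pXn2r _ 2)// ?nnegrE ?real_normK ?num_real// divr_ge0.
  rewrite ler_norml => /andP[+ _]; rewrite /D; lra.
have l1 : (fun N => series (fun i => g i ^+ 2) N - series (fun i => g i ^+ 2 / w i) N / 2)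
    @ \oo --> S (fun i => g i ^+ 2) - A / 2.
  apply: cvgB; first exact: cgs.
  by apply: cvgM; [exact: cvg_weighted_error|exact: cvg_cst].
have l2 : (fun N => (\sum_l GN N l ^+ 2) / n%:R) @ \oo -->
    (\sum_l Gf (xs l) ^+ 2) / n%:R.
  apply: cvgM; last exact: cvg_cst.
  apply: cvg_big => [|l _]; first exact: add_continuous.
  by apply: (@cvgM _ _ _ _ (GN ^~ l) (GN ^~ l)); exact: cpsi cg.
have : S (fun i => g i ^+ 2) - A / 2 <= (\sum_l Gf (xs l) ^+ 2) / n%:R.
  rewrite -(cvg_lim _ l1)// -(cvg_lim _ l2)//; apply: ler_lim.
  - by apply/cvg_ex; eexists; exact: l1.
  - by apply/cvg_ex; eexists; exact: l2.
  - exact: nearW.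
by rewrite AE; lra.
Qed.

(** Testing the error against itself bounds its square by a multiple of its
    norm, which cancels. *)
Lemma weighted_error_le (E T : R) :
  (forall N, series (fun i => w i *
     ((\sum_l e l * psi i (xs l)) / n%:R) ^+ 2) N <= E) ->
  (forall N, lam ^+ 2 * series (fun i => w i * b i ^+ 2 / m i ^+ 2) N <= T) ->
  A <= 8 * (E + T).
Proof.
move=> hE hT; have := noise_term_le hE; have := bias_term_le hT.
have := empirical_norm_ge; rewrite ridge_energy.
set U := _ / n%:R; set V := lam * _ => h1 h2 h3.
have [->|An] := eqVneq A 0.
  rewrite mulr_ge0// addr_ge0//.
    by apply: le_trans (hE 0%N); rewrite /series /= big_geq.
  by apply: le_trans (hT 0%N); rewrite /series /= big_geq// mulr0.
have Ap : 0 < A by rewrite lt_neqAle eq_sym An A0.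
have h4 : (A / 2) ^+ 2 <= (U - V) ^+ 2 by rewrite lerXn2r ?nnegrE//; lra.
have h5 : A * A <= 8 * (E + T) * A by have := sqr_ge0 (U + V); nra.
by rewrite -(ler_pM2r Ap).
Qed.

End ridge.

(** * Posterior mean and variance as ridge errors *)

Section posterior_formulas.
Variable R : realType.
Variables (mu : nat -> R) (k : nat).
Local Notation m := (fun i => mu i.+1).
Local Notation K := (series_kernel mu).
Local Notation psi i x := (fourier_deriv 0 i x).
Hypothesis mu0 : forall i, (1 <= i)%N -> 0 < mu i.
Hypothesis cmk : cvgn (series (fun i => mu i.+1 * i.+1%:R ^+ (2 * k))).

Let m0 i : 0 < mu i.+1. Proof. exact: mu0. Qed.

Let cmj j : (j <= 2 * k)%N -> cvgn (series (fun i => mu i.+1 * i.+1%:R ^+ j)).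
Proof.
move=> jk; apply: (@dominated_cvg_series _ _ _ _ cmk) => i.
rewrite ger0_norm; last by rewrite mulr_ge0 ?exprn_ge0// ltW.
apply: ler_wpM2l; first exact: ltW.
by apply: ler_weXn2l => //; rewrite ler1n.
Qed.

Lemma cvg_kernel_spectrum : cvgn (series m).
Proof.
apply: (@eq_cvg_series _ _ _ _ (@cmj 0%N (leq0n _))) => i.
by rewrite expr0 mulr1.
Qed.

Let summable_section j t : (j + k <= 2 * k)%N ->
  summable_order k (fun i => mu i.+1 * fourier_deriv j i t).
Proof.
move=> jk; have h := is_cvg_series_mull (a := 2 * 4 ^+ j) (cmj jk).
apply: (@dominated_cvg_series _ _ _ _ h) => i.
rewrite ger0_norm; last by rewrite mulr_ge0 ?exprn_ge0.
rewrite (normrM (mu _)) (ger0_norm (ltW (m0 i))) exprD.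
have := normr_fourier_deriv_le j i t; set z := `|_| => hz.
rewrite (_ : 2 * 4 ^+ j * _ = mu i.+1 *
  (2 * 4 ^+ j * i.+1%:R ^+ j * i.+1%:R ^+ k)); last by ring.
rewrite -(mulrA (mu _)); apply: ler_wpM2l; first exact: ltW.
by apply: ler_wpM2r; rewrite ?exprn_ge0.
Qed.

Lemma series_kernelE x x' :
  K x x' = limn (series (fun i => mu i.+1 * psi i x * psi i x')).
Proof.
have h0 : (0 + k <= 2 * k)%N by rewrite add0n mul2n -addnn leq_addr.
have sk := @summable_section 0%N x h0.
have s0 : summable_order 0 (fun i => mu i.+1 * psi i x).
  by elim: (k) sk => // j IH /summable_orderW.
have cv : cvgn (series (fun i => mu i.+1 * psi i x * psi i x')).
  exact: cvg_fourier_series s0.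
apply/cvg_lim => //; rewrite -cvg_shiftS /=.
suff -> : (fun N => \sum_(1 <= i < N.+1)
    mu i * fourier_basis i x * fourier_basis i x') =
  series (fun i => mu i.+1 * psi i x * psi i x') by exact: cv.
apply/funext => N; rewrite /series /= big_add1 /=.
by apply: eq_bigr => i _; rewrite !fourier_deriv0.
Qed.

Lemma series_kernel_sym x x' : K x x' = K x' x.
Proof.
rewrite !series_kernelE; congr (limn (series _)); apply/funext => i.
by rewrite mulrAC.
Qed.

Lemma derive1n_kernel x t : derive1n k (K x) t =
  limn (series (fun i => mu i.+1 * psi i x * fourier_deriv k i t)).
Proof.
have -> : K x = fourier_series 0 (fun i => mu i.+1 * psi i x).
  by apply/funext => t'; rewrite series_kernelE.
rewrite derive1n_fourier_series//; apply: summable_section.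
by rewrite add0n mul2n -addnn leq_addr.
Qed.

Lemma kernel_deriv0k x t : kernel_deriv K 0 k x t =
  limn (series (fun i => mu i.+1 * psi i x * fourier_deriv k i t)).
Proof. by rewrite /kernel_deriv derive1n0 derive1n_kernel. Qed.

Lemma kernel_derivk0 t x : kernel_deriv K k 0 t x =
  limn (series (fun i => mu i.+1 * psi i x * fourier_deriv k i t)).
Proof.
rewrite /kernel_deriv -derive1n_kernel; congr (derive1n k _ t).
by apply/funext => u; rewrite derive1n0 series_kernel_sym.
Qed.

Lemma kernel_derivkk t t' : kernel_deriv K k k t t' =
  limn (series (fun i => mu i.+1 * fourier_deriv k i t' * fourier_deriv k i t)).
Proof.
rewrite /kernel_deriv.
have -> : (fun u => derive1n k (K u) t') =
    fourier_series 0 (fun i => mu i.+1 * fourier_deriv k i t').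
  apply/funext => u; rewrite derive1n_kernel /fourier_series.
  by congr (limn (series _)); apply/funext => i; rewrite mulrAC.
rewrite derive1n_fourier_series//; apply: summable_section.
by rewrite mul2n addnn.
Qed.

Variables (sigma lam : R) (n : nat) (x : 'cV[R]_n).
Hypothesis n0 : (0 < n)%N.
Hypothesis lam0 : 0 < lam.

Let row_coef (y : 'cV[R]_n) t :
  (kernel_row K k x t *m invmx (regularized_gram K lam x) *m y) ord0 ord0 =
  fourier_series k (ridge_coef m K x lam y) t.
Proof.
rewrite -mulmxA mxE.
rewrite (eq_bigr (fun j => (invmx (regularized_gram K lam x) *m y) j ord0 *
  limn (series (fun i => mu i.+1 * psi i (x j ord0) * fourier_deriv k i t)))); last first.
  by move=> j _; rewrite !mxE kernel_derivk0 mulrC.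
have cv (j : 'I_n) : cvgn (series (fun i =>
    mu i.+1 * psi i (x j ord0) * fourier_deriv k i t)).
  apply: (@cvg_fourier_series _ k (fun i => mu i.+1 * psi i (x j ord0))).
  by apply: summable_section; rewrite add0n mul2n -addnn leq_addr.
have H := @lim_series_lincomb _ _ (index_enum _)
  (fun j : 'I_n => (invmx (regularized_gram K lam x) *m y) j ord0) _ cv.
rewrite -(cvg_lim _ H)//; congr (limn (series _)); apply/funext => i.
rewrite /ridge_coef mulr_sumr mulr_suml; apply: eq_bigr => j _.
by ring.
Qed.

Lemma summable_ridge_coef (y : 'cV[R]_n) :
  summable_order k (ridge_coef m K x lam y).
Proof.
have ck : cvgn (series (fun i => mu i.+1 * i.+1%:R ^+ k)).
  by apply: cmj; rewrite mul2n -addnn leq_addr.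
have h := is_cvg_series_mull (a := 2 * \sum_j
   `|(invmx (regularized_gram K lam x) *m y) j ord0|) ck.
apply: (@dominated_cvg_series _ _ _ _ h) => i.
rewrite ger0_norm; last by rewrite mulr_ge0 ?exprn_ge0.
rewrite mulrA ler_wpM2r ?exprn_ge0//.
by apply: (ridge_coef_le (m := m)).
Qed.

Lemma posterior_meanE (y : 'cV[R]_n) t :
  posterior_mean K lam k x y t = fourier_series k (ridge_coef m K x lam y) t.
Proof. exact: row_coef. Qed.

(** Coefficients of the representer of the evaluation of the k-th derivative at
    t; its values at the design points are the responses whose ridge error
    measures the posterior variance. *)
Definition representer_coef t i := mu i.+1 * fourier_deriv k i t.
Local Notation b := (representer_coef).

Lemma cvg_representer_coef t : cvgn (series (fun i => `|b t i|)).
Proof.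
have sk : summable_order k (b t).
  by apply: summable_section; rewrite mul2n addnn.
have s0 : summable_order 0 (b t) by elim: (k) sk => // j IH /summable_orderW.
by apply: (@eq_cvg_series _ _ _ _ s0) => i; rewrite expr0 mulr1.
Qed.

Lemma cvg_representer_coef2 t : cvgn (series (fun i => b t i ^+ 2 / mu i.+1)).
Proof.
have sk : summable_order k (b t).
  by apply: summable_section; rewrite mul2n addnn.
apply: (@eq_cvg_series _ _ _ _ (@cvg_fourier_series _ _ _ t sk)) => i.
by rewrite /representer_coef; field; rewrite gt_eqF.
Qed.

Lemma posterior_covE t : posterior_cov K sigma lam k x t t =
  sigma ^+ 2 / (n%:R * lam) *
  - limn (series (fun i =>
      ridge_error m K x lam (kernel_col K k x t) (b t) i * b t i / mu i.+1)).
Proof.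
rewrite /posterior_cov row_coef kernel_derivkk; congr (_ * _).
set y := kernel_col _ _ _ _; set c := ridge_coef _ _ _ _ y.
have sk : summable_order k (b t).
  by apply: summable_section; rewrite mul2n addnn.
have c1 := @cvg_fourier_series _ _ _ t sk.
have c2 := @cvg_fourier_series _ _ _ t (@summable_ridge_coef y).
rewrite /fourier_series -limB// -limN.
  congr (limn _); apply/funext => N; rewrite !fctE /series /= -sumrB -sumrN.
  by apply: eq_bigr => i _; rewrite /ridge_error -/y -/c /representer_coef;
    field; rewrite gt_eqF.
pose u i := c i * fourier_deriv k i t + -1 * (b t i * fourier_deriv k i t).
have cu : cvgn (series u) by apply: is_cvg_series_add => //; exact: is_cvg_series_mull.
apply: (@eq_cvg_series _ _ _ _ cu) => i.
by rewrite /u /ridge_error -/y -/c /representer_coef; field; rewrite gt_eqF.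
Qed.

End posterior_formulas.

Section posterior_bounds.
Variable R : realType.
Variables (mu : nat -> R) (k : nat).
Local Notation m := (fun i => mu i.+1).
Local Notation K := (series_kernel mu).
Local Notation psi i x := (fourier_deriv 0 i x).
Hypothesis mu0 : forall i, (1 <= i)%N -> 0 < mu i.
Hypothesis cmk : cvgn (series (fun i => mu i.+1 * i.+1%:R ^+ (2 * k))).
Variables (sigma lam : R) (n : nat) (x : 'cV[R]_n).
Hypothesis n0 : (0 < n)%N.
Hypothesis lam0 : 0 < lam.
Local Notation w := (shrinkage m lam).
Local Notation xs l := (x l ord0).
Hypothesis gram_close : forall N,
  \sum_(0 <= p < N) \sum_(0 <= q < N) w p * w q * gram_deviation x p q ^+ 2 <= 4^-1.

Let m0 i : 0 < m i. Proof. exact: mu0. Qed.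
Let cm := cvg_kernel_spectrum mu0 cmk.
Let KE := series_kernelE mu0 cmk.

(** The posterior variance at t is the noiseless ridge error of the representer
    of the k-th derivative at t, tested against that representer. *)
Lemma posterior_cov_bounds t (T : R) :
  (forall N, lam ^+ 2 * series (fun i => w i * fourier_deriv k i t ^+ 2) N <= T) ->
  0 <= posterior_cov K sigma lam k x t t <=
  sigma ^+ 2 / (n%:R * lam) * (3 * T / lam).
Proof.
move=> hT; rewrite posterior_covE//.
set y := kernel_col K k x t; set b := representer_coef mu k t.
have cb := cvg_representer_coef mu0 cmk (t := t).
have cb2 := cvg_representer_coef2 mu0 cmk (t := t).
have e0 l : y l ord0 - fourier_series 0 b (xs l) = 0.
  rewrite /y mxE kernel_deriv0k// /fourier_series; apply/eqP; rewrite subr_eq0.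
  by apply/eqP; congr (limn (series _)); apply/funext => i;
    rewrite /b /representer_coef mulrAC.
have hE N : series (fun i => w i * ((\sum_l
    (y l ord0 - fourier_series 0 b (xs l)) * psi i (xs l)) / n%:R) ^+ 2) N <= 0.
  rewrite /series /= big1// => i _; rewrite big1 ?mul0r ?expr0n ?mulr0// => l _.
  by rewrite e0 mul0r.
have hT' N : lam ^+ 2 * series (fun i => w i * b i ^+ 2 / m i ^+ 2) N <= T.
  rewrite (_ : (fun i => _) = fun i => w i * fourier_deriv k i t ^+ 2)//.
  by apply/funext => i; rewrite /b /representer_coef; field; rewrite gt_eqF.
have hA := weighted_error_le m0 cm KE n0 lam0 cb cb2 gram_close hE hT'.
have hB := bias_term_le K m0 cm x lam0 y cb cb2 hT'.
have hG := empirical_norm_ge K m0 cm lam0 y cb cb2 gram_close.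
have A0 := weighted_error_ge0 K m0 cm x lam0 y cb cb2.
have := ridge_energy m0 cm KE x n0 lam0 y cb cb2.
rewrite [X in X / n%:R - _]big1 ?mul0r ?sub0r; last by move=> l _; rewrite e0 mul0r.
move=> hE'; rewrite hE' in hG.
set Q := limn _ in hG hB *; set A := weighted_error _ _ _ _ _ _ in hA hB hG A0.
have T0 : 0 <= T.
  by apply: le_trans (hT 0%N); rewrite /series /= big_geq// mulr0.
have q0 : 0 <= lam * - Q by rewrite mulrN; lra.
(* lam Q is a bias term, so its square is at most T * A <= 8 T ^ 2. *)
have q1 : lam * - Q <= 3 * T.
  rewrite -(@ler_pXn2r _ 2)// ?nnegrE ?mulr_ge0// mulrN sqrrN.
  apply: (le_trans hB); nra.
have s0 : 0 <= sigma ^+ 2 / (n%:R * lam).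
  by rewrite divr_ge0 ?sqr_ge0// mulr_ge0// ltW.
apply/andP; split.
  by rewrite mulr_ge0//; rewrite pmulr_rge0 in q0.
by rewrite ler_wpM2l// ler_pdivlMr// mulrC.
Qed.

(** Parseval's bound turns the derivative of order k into weights freq ^ (2 k) on
    the squared coefficients, and kap is the price of comparing these with the
    weights 1 / w of the ridge error. *)
Lemma posterior_mean_error_le (b : nat -> R) (y : 'cV[R]_n) (kap E T : R) :
  summable_order k b -> cvgn (series (fun i => b i ^+ 2 / m i)) ->
  (forall N, series (fun i => w i * ((\sum_l
    (y l ord0 - fourier_series 0 b (xs l)) * psi i (xs l)) / n%:R) ^+ 2) N <= E) ->
  (forall N, lam ^+ 2 * series (fun i => w i * b i ^+ 2 / m i ^+ 2) N <= T) ->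
  0 <= kap -> (forall i, freq R i ^+ (2 * k) <= kap / w i) ->
  (\int[lebesgue_measure]_(t in `]0%R, 1%R[)
    ((posterior_mean K lam k x y t - fourier_series k b t) ^+ 2)%:E <=
   (kap * (8 * (E + T)))%:E)%E.
Proof.
move=> sb cb2 hE hT kap0 hkap.
have cb : cvgn (series (fun i => `|b i|)).
  have s0 : summable_order 0 b by elim: (k) sb => // j IH /summable_orderW.
  by apply: (@eq_cvg_series _ _ _ _ s0) => i; rewrite expr0 mulr1.
have hA := weighted_error_le m0 cm KE n0 lam0 cb cb2 gram_close hE hT.
pose g := ridge_error m K x lam y b.
have sc := summable_ridge_coef mu0 cmk (lam := lam) (x := x) (y := y).
have cc t := @cvg_fourier_series _ _ _ t sc.
have cb' t := @cvg_fourier_series _ _ _ t sb.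
have gE t i : g i * fourier_deriv k i t =
    ridge_coef m K x lam y i * fourier_deriv k i t + -1 * (b i * fourier_deriv k i t).
  by rewrite /g /ridge_error; ring.
have cg t : cvgn (series (fun i => g i * fourier_deriv k i t)).
  apply: (@eq_cvg_series _ _ _ _ (is_cvg_series_add (cc t)
    (is_cvg_series_mull (a := -1) (cb' t)))) => i.
  by rewrite gE.
have dE t : posterior_mean K lam k x y t - fourier_series k b t = fourier_series k g t.
  rewrite posterior_meanE// /fourier_series -limB//.
  congr (limn _); apply/funext => N; rewrite !fctE /series /= -sumrB.
  by apply: eq_bigr => i _; rewrite gE mulN1r.
under eq_integral do rewrite dE.
apply: (@integral_sqr_fourier_series_le _ k g (kap * (8 * (E + T))) `]0, 1[) => //.
  by move=> t /=; rewrite !in_itv/= => /andP[t0 t1]; rewrite !ltW.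
move=> N; apply: (@le_trans _ _ (kap * series (fun i => g i ^+ 2 / w i) N)).
  rewrite /series /= mulr_sumr; apply: ler_sum => i _.
  rewrite mulrCA; apply: ler_wpM2l; [exact: sqr_ge0|exact: hkap].
apply: ler_wpM2l => //; apply: le_trans hA.
apply: series_le_lim; last exact: cvg_weighted_error.
move=> i; rewrite mulr_ge0 ?sqr_ge0// invr_ge0 /shrinkage.
by rewrite divr_ge0// ltW// addr_gt0.
Qed.

End posterior_bounds.

(** * Spectral sums and rates *)

Section spectral_sums.
Variable R : realType.

Variables (alpha C lam : R) (m : nat -> R).
Hypothesis C1 : 1 <= C.
Hypothesis lam01 : 0 < lam <= 1.
Hypothesis m0 : forall i, 0 < m i.
Hypothesis mC : forall i, m i <= C * i.+1%:R `^ (- (2 * alpha)).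

(** The frequency at which eigenvalues of order i ^ (- 2 alpha) fall below lam. *)
Definition cutoff : R := lam `^ (- (2 * alpha)^-1).
Local Notation z := cutoff.

Lemma cutoff_ge1 : 0 < alpha -> 1 <= z.
Proof.
move=> a0; have /andP[l0 l1] := lam01; rewrite /cutoff powRN.
rewrite invr_ge1; last 2 first.
- by rewrite unitfE gt_eqF// powR_gt0.
- by rewrite powR_gt0.
rewrite [leRHS](_ : _ = 1 `^ (2 * alpha)^-1); last by rewrite powR1.
apply: ge0_ler_powR => //; rewrite ?nnegrE//; last exact: ltW.
by rewrite invr_ge0 mulr_ge0// ltW.
Qed.

Lemma cutoff_powR : 0 < alpha -> z `^ (2 * alpha) = lam^-1.
Proof.
move=> a0; have /andP[l0 l1] := lam01.
by rewrite /cutoff -powRrM mulNr mulVf ?mulf_neq0 ?gt_eqF// powR_inv1// ltW.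
Qed.

Lemma shrinkage_gt0 i : 0 < shrinkage m lam i.
Proof.
have /andP[l0 l1] := lam01.
by rewrite /shrinkage divr_gt0// addr_gt0.
Qed.

(** The shrinkage factors are at most 1, and beyond the cutoff frequency they
    decay faster than the weights grow. *)
Lemma weighted_shrinkage_le k i : k%:R + 1 <= alpha ->
  i.+1%:R ^+ (2 * k) * shrinkage m lam i <=
  4 * C * z ^+ (2 * k) * (z ^+ 2 * (z + i.+1%:R) ^- 2).
Proof.
move=> ka; have /andP[l0 l1] := lam01.
have k0 : 0 <= k%:R :> R by [].
have a0 : 0 < alpha by lra.
have z1 := cutoff_ge1 a0; have z0 : 0 < z by exact: lt_le_trans z1.
set p : R := i.+1%:R; have p0 : 0 < p by rewrite ltr0n.
have w1 : shrinkage m lam i <= 1.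
  by rewrite /shrinkage ler_pdivrMr ?addr_gt0// mul1r lerDl ltW.
have w0 : 0 <= shrinkage m lam i by exact/ltW/shrinkage_gt0.
have C0 : 0 < C by exact: lt_le_trans C1.
have zp : 0 < z + p by rewrite addr_gt0.
have [pz|zp'] := leP p z.
  apply: (@le_trans _ _ (z ^+ (2 * k) * 1)).
    apply: ler_pM => //; first by rewrite exprn_ge0// ltW.
    by rewrite lerXn2r// nnegrE ltW.
  rewrite (mulrC (4 * C)) -(mulrA (z ^+ _)); apply: ler_wpM2l; first by rewrite exprn_ge0 ?ltW.
  rewrite mulrA ler_pdivlMr ?exprn_gt0// mul1r.
  apply: (@le_trans _ _ (4 * z ^+ 2)).
    rewrite -subr_ge0 (_ : _ - _ = (z - p) * (3 * z + p)); last by ring.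
    by rewrite mulr_ge0//; lra.
  by apply: ler_wpM2r; [exact: sqr_ge0|rewrite ler_peMr].
have w2 : shrinkage m lam i <= C * (z / p) ^+ (2 * k + 2).
  apply: (@le_trans _ _ (m i / lam)).
    by rewrite /shrinkage ler_wpM2l ?(ltW (m0 i))// lef_pV2 ?posrE ?addr_gt0// lerDr ltW.
  apply: (@le_trans _ _ (C * (z / p) `^ (2 * alpha))).
    have pi0 : 0 <= p^-1 by rewrite invr_ge0 ltW.
    rewrite (powRM _ (ltW z0) pi0) cutoff_powR// -(powR_inv1 (ltW p0)) -powRrM mulN1r.
    by rewrite [leRHS]mulrCA [leLHS]mulrC ler_wpM2l ?invr_ge0 ?(ltW l0)// mC.
  apply: ler_wpM2l; first exact: ltW.
  rewrite -powR_mulrn; last by rewrite divr_ge0 ?ltW.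
  have zp1 : 0 < z / p <= 1.
    by rewrite divr_gt0//= ler_pdivrMr// mul1r ltW.
  have := @ger_powR _ _ zp1 (2 * k + 2)%:R (2 * alpha); apply.
  by rewrite natrD natrM; lra.
apply: (@le_trans _ _ (p ^+ (2 * k) * (C * (z / p) ^+ (2 * k + 2)))).
  by rewrite ler_wpM2l ?exprn_ge0// ltW.
have -> : p ^+ (2 * k) * (C * (z / p) ^+ (2 * k + 2)) =
    C * z ^+ (2 * k) * (z ^+ 2 * p ^- 2).
  by rewrite exprD exprMn exprVn exprMn exprVn; field; rewrite expf_neq0 ?gt_eqF.
have -> : 4 * C * z ^+ (2 * k) * (z ^+ 2 * (z + p) ^- 2) =
    C * z ^+ (2 * k) * (z ^+ 2 * (4 / (z + p) ^+ 2)) by ring.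
apply: ler_wpM2l; first by rewrite mulr_ge0 ?exprn_ge0// ltW.
apply: ler_wpM2l; first by rewrite sqr_ge0.
rewrite -div1r ler_pdivrMr ?exprn_gt0// mulrAC ler_pdivlMr ?exprn_gt0//.
rewrite -subr_ge0 (_ : _ - _ = (p - z) * (3 * p + z)); last by ring.
by rewrite mulr_ge0//; lra.
Qed.

Lemma weighted_shrinkage_sum_le k N : k%:R + 1 <= alpha ->
  series (fun i => i.+1%:R ^+ (2 * k) * shrinkage m lam i) N <=
  4 * C * z ^+ (2 * k) * z.
Proof.
move=> ka; have k0 : 0 <= k%:R :> R by [].
have a0 : 0 < alpha by lra.
have z1 := cutoff_ge1 a0; have z0 : 0 < z by exact: lt_le_trans z1.
have C0 : 0 < C by exact: lt_le_trans C1.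
apply: (@le_trans _ _ (4 * C * z ^+ (2 * k) * (z ^+ 2 *
    series (fun i => (z + i.+1%:R) ^- 2) N))).
  rewrite /series /= !mulr_sumr; apply: ler_sum => i _.
  exact: weighted_shrinkage_le.
apply: ler_wpM2l; first by rewrite !mulr_ge0 ?exprn_ge0// ltW.
apply: (@le_trans _ _ (z ^+ 2 * z^-1)).
  by rewrite ler_wpM2l ?sqr_ge0// sum_shifted_inv_sqr.
by rewrite expr2 mulfK ?gt_eqF.
Qed.

Lemma weighted_shrinkage_sup_le k i : k%:R + 1 <= alpha ->
  i.+1%:R ^+ (2 * k) <= 4 * C * z ^+ (2 * k) / shrinkage m lam i.
Proof.
move=> ka; have k0 : 0 <= k%:R :> R by [].
have a0 : 0 < alpha by lra.
have z1 := cutoff_ge1 a0; have z0 : 0 < z by exact: lt_le_trans z1.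
have C0 : 0 < C by exact: lt_le_trans C1.
rewrite ler_pdivlMr ?shrinkage_gt0//.
apply: le_trans (weighted_shrinkage_le _ ka) _.
rewrite -[leRHS]mulr1; apply: ler_wpM2l; first by rewrite !mulr_ge0 ?exprn_ge0// ltW.
rewrite ler_pdivrMr ?exprn_gt0 ?addr_gt0// mul1r lerXn2r ?nnegrE ?addr_ge0 ?ltW//.
by rewrite ltrDl.
Qed.

End spectral_sums.

Section regularization_rates.
Variable R : realType.

Lemma cvg_powR0 (u : nat -> R) (p : R) : 0 < p ->
  (\forall n \near \oo, 0 <= u n) -> u @ \oo --> (0 : R) ->
  (fun n => u n `^ p) @ \oo --> (0 : R).
Proof.
move=> p0 u0 cu; apply/cvgrPdist_le => e e0.
have ep : 0 < e `^ p^-1 by rewrite powR_gt0.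
move: cu => /cvgrPdist_le/(_ _ ep); apply: filterS2 u0 => n u0.
rewrite sub0r normrN ger0_norm// sub0r normrN ger0_norm ?powR_ge0// => un.
rewrite -[leRHS]powRr1 ?(ltW e0)// -(mulVf (lt0r_neq0 p0)) powRrM.
by apply: ge0_ler_powR; rewrite ?nnegrE ?powR_ge0// ltW.
Qed.

Let r (n : nat) : R := ln n%:R / n%:R.

Lemma ln_div_cvg0 : r @ \oo --> (0 : R).
Proof.
apply: (@squeeze_cvgr _ _ _ _ (cst 0) (fun n => 2 * (Num.sqrt n%:R)^-1)).
- near=> n; have n1 : (1 <= n)%N by near: n; exact: nbhs_infty_ge.
  have n0 : 0 < n%:R :> R by rewrite ltr0n.
  apply/andP; split; first by rewrite divr_ge0 ?ln_ge0// ler1n.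
  set s := Num.sqrt _; have s0 : 0 < s by rewrite sqrtr_gt0.
  have ss : n%:R = s * s by rewrite -expr2 sqr_sqrtr// ltW.
  have l : ln n%:R <= 2 * s.
    by rewrite ss lnM ?posrE//; have := ln_sublinear s0; lra.
  apply: (@le_trans _ _ (2 * s / n%:R)).
    by rewrite /r ler_wpM2r// invr_ge0 ltW.
  rewrite le_eqVlt; apply/orP; left; apply/eqP; rewrite ss; field.
  by rewrite gt_eqF.
- exact: cvg_cst.
- apply/cvgrPdist_le => e e0; near=> n.
  rewrite sub0r normrN ger0_norm ?mulr_ge0 ?invr_ge0 ?sqrtr_ge0//.
  have n0 : (0 < n)%N by near: n; exact: nbhs_infty_gt.
  rewrite ler_pdivrMr ?sqrtr_gt0 ?ltr0n// mulrC -ler_pdivrMr//.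
  rewrite -(@ler_pXn2r _ 2)// ?nnegrE ?sqrtr_ge0//; last by rewrite divr_ge0// ltW.
  rewrite sqr_sqrtr//; near: n; exact: nbhs_infty_ger.
Unshelve. all: by end_near. Qed.

Lemma ln_ge1_near : \forall n \near \oo, 1 <= ln (n%:R : R).
Proof.
near=> n; rewrite -[leLHS](@expRK R).
have n0 : (0 < n)%N by near: n; exact: nbhs_infty_gt.
rewrite ler_ln ?posrE ?expR_gt0 ?ltr0n//; near: n; exact: nbhs_infty_ger.
Unshelve. all: by end_near. Qed.

Variables (alpha : R) (lam : nat -> R).
Hypothesis alpha32 : 3 / 2 < alpha.
Hypothesis lam0 : forall n, 0 < lam n.
Hypothesis lam_rate : asymp lam (rate (2 * alpha / (2 * alpha + 1))).
Local Notation z n := (cutoff alpha (lam n)).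

Let a0 : 0 < alpha. Proof. by move: alpha32; lra. Qed.
Let d0 : 0 < 2 * alpha + 1. Proof. by move: a0; lra. Qed.

Let r_gt0 : \forall n \near \oo, 0 < r n.
Proof.
near=> n; have : 1 <= ln (n%:R : R) by near: n; exact: ln_ge1_near.
have n0 : (0 < n)%N by near: n; exact: nbhs_infty_gt.
by move=> h; rewrite divr_gt0 ?ltr0n// (lt_le_trans ltr01).
Unshelve. all: by end_near. Qed.

Lemma regularization_cvg0 : lam @ \oo --> (0 : R).
Proof.
have [C C0 H] := lam_rate.
have s0 : 0 < 2 * alpha / (2 * alpha + 1) by rewrite divr_gt0// mulr_gt0.
have cr := cvg_powR0 s0 (filterS (fun n => @ltW _ _ _ _) r_gt0) ln_div_cvg0.
apply: (@squeeze_cvgr _ _ _ _ (cst 0) (fun n => C * r n `^ (2 * alpha / (2 * alpha + 1)))).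
- by apply: filterS H => n [h _]; rewrite (ltW (lam0 n)) h.
- exact: cvg_cst.
- by rewrite -[X in _ --> X](mulr0 C); apply: cvgM; [exact: cvg_cst|exact: cr].
Qed.

Lemma cutoff_gt0 n : 0 < z n.
Proof. by rewrite powR_gt0. Qed.

Let cutoff_le : exists2 C : R, 0 < C &
  \forall n \near \oo, z n <= C * r n `^ (- (2 * alpha + 1)^-1).
Proof.
have [C C0 H] := lam_rate.
exists (C^-1 `^ (- (2 * alpha)^-1)); first by rewrite powR_gt0 ?invr_gt0.
apply: filterS2 r_gt0 H => n rn [_ h].
have rp : 0 < r n `^ (2 * alpha / (2 * alpha + 1)) by rewrite powR_gt0.
have h' : C^-1 * r n `^ (2 * alpha / (2 * alpha + 1)) <= lam n.
  by rewrite mulrC ler_pdivrMr// (mulrC (lam n)).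
have -> : r n `^ (- (2 * alpha + 1)^-1) =
    (r n `^ (2 * alpha / (2 * alpha + 1))) `^ (- (2 * alpha)^-1).
  rewrite -powRrM; congr (_ `^ _); field.
  by rewrite (gt_eqF d0) (gt_eqF a0).
rewrite -powRM ?invr_ge0 ?(ltW C0) ?(ltW rp)// /cutoff !powRN.
rewrite lef_pV2 ?posrE ?powR_gt0 ?mulr_gt0 ?invr_gt0//.
apply: ge0_ler_powR => //; rewrite ?nnegrE ?(ltW (lam0 n))//.
  by rewrite invr_ge0 mulr_ge0// ltW.
by rewrite mulr_ge0// ltW// invr_gt0.
Qed.

(** The choice of lam makes the variance no larger than the squared bias; the
    logarithm in it is used only through ln n >= 1. *)
Lemma cutoff_div_le : exists2 C : R, 0 < C &
  \forall n \near \oo, z n / n%:R <= C * lam n.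
Proof.
have [C1 C10 H1] := cutoff_le; have [C C0 H] := lam_rate.
exists (C1 * C); first exact: mulr_gt0.
near=> n; have rn : 0 < r n by near: n; exact: r_gt0.
have h1 : z n <= C1 * r n `^ (- (2 * alpha + 1)^-1) by near: n.
have [_ h2] : lam n <= C * rate (2 * alpha / (2 * alpha + 1)) n /\
  rate (2 * alpha / (2 * alpha + 1)) n <= C * lam n by near: n.
have ln1 : 1 <= ln (n%:R : R) by near: n; exact: ln_ge1_near.
have n0 : (0 < n)%N by near: n; exact: nbhs_infty_gt.
have nr : n%:R^-1 <= r n by rewrite /r mulrC ler_peMr// invr_ge0.
apply: (@le_trans _ _ (C1 * r n `^ (- (2 * alpha + 1)^-1) * r n)).
  by apply: ler_pM => //; exact/ltW/cutoff_gt0.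
rewrite -!mulrA ler_wpM2l ?(ltW C10)//; apply: le_trans h2.
rewrite /rate -/(r n) -[X in _ * X]powRr1 ?(ltW rn)// -powRD ?(gt_eqF rn) ?implybT//.
rewrite le_eqVlt; apply/orP; left; apply/eqP; congr (_ `^ _); field.
by rewrite gt_eqF.
Unshelve. all: by end_near. Qed.

Lemma cutoff_sqr_div_cvg0 : (fun n => z n ^+ 2 / n%:R) @ \oo --> (0 : R).
Proof.
have [C C0 H] := cutoff_div_le.
pose p := 1 - (2 * alpha)^-1.
have p0 : 0 < p.
  rewrite subr_gt0 invf_lt1 ?mulr_gt0//; move: alpha32; lra.
have l0 : \forall n \near \oo, 0 <= lam n by apply: nearW => n; exact: ltW.
have cl := cvg_powR0 p0 l0 regularization_cvg0.
apply: (@squeeze_cvgr _ _ _ _ (cst 0) (fun n => C * lam n `^ p)).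
- apply: filterS H => n h; rewrite divr_ge0 ?sqr_ge0//=.
  rewrite expr2 -mulrA; apply: (@le_trans _ _ (z n * (C * lam n))).
    by rewrite ler_wpM2l// ltW// cutoff_gt0.
  rewrite mulrCA ler_wpM2l ?(ltW C0)// /p powRD ?(gt_eqF (lam0 n)) ?implybT//.
  by rewrite powRr1 ?(ltW (lam0 n))// mulrC.
- exact: cvg_cst.
- by rewrite -[X in _ --> X](mulr0 C); apply: cvgM; [exact: cvg_cst|exact: cl].
Qed.

Lemma cutoff_power_rate_le k : exists2 C : R, 0 < C &
  \forall n \near \oo, 0 < rate ((alpha - k%:R) / (2 * alpha + 1)) n /\
    z n ^+ (2 * k) * lam n <=
    C * rate ((alpha - k%:R) / (2 * alpha + 1)) n ^+ 2.
Proof.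
have [C1 C10 H1] := cutoff_le; have [C C0 H] := lam_rate.
exists (C1 ^+ (2 * k) * C); first by rewrite mulr_gt0 ?exprn_gt0.
near=> n; have rn : 0 < r n by near: n; exact: r_gt0.
have h1 : z n <= C1 * r n `^ (- (2 * alpha + 1)^-1) by near: n.
have [h2 _] : lam n <= C * rate (2 * alpha / (2 * alpha + 1)) n /\
  rate (2 * alpha / (2 * alpha + 1)) n <= C * lam n by near: n.
split; first by rewrite powR_gt0.
have z0 := cutoff_gt0 n.
apply: (@le_trans _ _ ((C1 * r n `^ (- (2 * alpha + 1)^-1)) ^+ (2 * k) *
   (C * rate (2 * alpha / (2 * alpha + 1)) n))).
  apply: ler_pM => //; rewrite ?exprn_ge0 ?(ltW z0) ?(ltW (lam0 n))//.
  by rewrite lerXn2r ?nnegrE ?(ltW z0)// mulr_ge0 ?powR_ge0// ltW.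
rewrite exprMn mulrACA ler_wpM2l//.
  by rewrite mulr_ge0 ?exprn_ge0// ltW.
rewrite -!powR_mulrn ?powR_ge0// /rate -/(r n) -!powRrM -powRD ?(gt_eqF rn) ?implybT//.
rewrite le_eqVlt; apply/orP; left; apply/eqP; congr (_ `^ _).
rewrite natrM; field.
by rewrite gt_eqF.
Unshelve. all: by end_near. Qed.

End regularization_rates.

(** The finitely many ratios outside the eventual range are absorbed in the
    constant. *)
Lemma asymp_positive (R : realType) (a b : nat -> R) :
  (forall i, (1 <= i)%N -> 0 < a i) -> (forall i, (1 <= i)%N -> 0 < b i) ->
  asymp a b -> exists2 C : R, 1 <= C &
    forall i, (1 <= i)%N -> a i <= C * b i /\ b i <= C * a i.
Proof.
move=> ap bp [C C0 [N _ HN]].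
pose S := \sum_(1 <= j < N) (a j / b j + b j / a j).
have pos j : (1 <= j)%N -> 0 <= a j / b j /\ 0 <= b j / a j.
  by move=> j1; split; rewrite divr_ge0 ?ltW ?ap ?bp.
have S0 : 0 <= S.
  rewrite /S big_seq; apply: sumr_ge0 => j; rewrite mem_index_iota => /andP[j1 _].
  by have [h1 h2] := pos j j1; rewrite addr_ge0.
exists (C + S + 1); first by rewrite lerDr addr_ge0// ltW.
move=> i i1; have ai := ap i i1; have bi := bp i i1.
have [Ni|iN] := leqP N i.
  have [h1 h2] := HN i Ni; split.
    by apply: (le_trans h1); rewrite ler_wpM2r ?(ltW bi)//; lra.
  by apply: (le_trans h2); rewrite ler_wpM2r ?(ltW ai)//; lra.
have iS : a i / b i + b i / a i <= S.
  rewrite /S (bigD1_seq i) ?iota_uniq ?mem_index_iota ?i1//= lerDl.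
  rewrite big_seq_cond; apply: sumr_ge0 => j; rewrite mem_index_iota => /andP[/andP[j1 _] _].
  by have [h1 h2] := pos j j1; rewrite addr_ge0.
have [h1 h2] := pos i i1.
by split; [rewrite -ler_pdivrMr|rewrite -ler_pdivrMr]; rewrite //; lra.
Qed.

(** * Gaussian process tails *)

Section gaussian_tail.
Variable R : realType.
Local Notation leb := (@lebesgue_measure R).

Variables (m : R -> R) (V : R -> R -> R) (gp : gaussian_process m V).
Local Notation P := (gp_prob gp).
Local Notation path := (@gp_path _ _ _ gp).

Lemma gp_marginal t : t \in `[0, 1] -> has_law P (path ^~ t) (normal_law (m t) (V t t)).
Proof.
move=> t01 A mA.
have := @gp_normal _ _ _ gp 1%N (fun=> t) (fun=> 1) (fun=> t01) A mA.
rewrite !big_ord1 !mul1r /= => <-; congr (P _).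
by apply/seteqP; split => w /=; rewrite big_ord1 mul1r.
Qed.

(** Extending paths by 0 outside the open interval gives a measurable function on
    the whole product, to which Tonelli's theorem applies. *)
Lemma gp_measurable_oo : measurable_fun
  ([set: measurableTypeR R * gp_space gp])
  ((fun p : measurableTypeR R * gp_space gp => path p.2 p.1) \_
     (`]0, 1[%classic `*` setT)).
Proof.
apply/(measurable_restrict _ _ _).1 => //.
  by apply: measurableX => //; exact: measurable_itv.
rewrite setTI; apply: measurable_funS (@gp_measurable _ _ _ gp).
  by apply: measurableX => //; exact: measurable_itv.
by move=> [t w] /= [t01 _]; split => //; move: t01; rewrite /= !in_itv/= => /andP[a b]; rewrite !ltW.
Qed.

Lemma gp_measurable_at t : 0 < t < 1 -> measurable_fun setT (path ^~ t).
Proof.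
move=> t01; have := measurable_fun_pair2 t gp_measurable_oo.
congr (measurable_fun _ _); apply/funext => w; by rewrite patchE mem_set.
Qed.

(** Only the marginal laws enter: a crude second-moment bound for a normal
    variable about an arbitrary centre. *)
Lemma gp_second_moment_le t c : 0 < t < 1 -> 0 <= V t t ->
  (\int[P]_w ((path w t - c) ^+ 2)%:E <= (2 * V t t + 2 * (m t - c) ^+ 2)%:E)%E.
Proof.
move=> t01 V0; have mp := gp_measurable_at t01.
have tin : t \in `[0, 1] by rewrite in_itv/= !ltW//; case/andP: t01.
have lp := gp_marginal tin.
have mq : measurable_fun setT (fun x : R => ((x - m t) ^+ 2)%:E).
  apply/measurable_EFinP; apply: measurable_funX.
  by apply: measurable_funB.
have q0 (x : R) : (0 <= ((x - m t) ^+ 2)%:E)%E by rewrite lee_fin sqr_ge0.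
have var : (\int[P]_w ((path w t - m t) ^+ 2)%:E <= (V t t)%:E)%E.
  move: lp; rewrite /normal_law; case: eqVneq => [->|Vn] lp.
    rewrite (@integral_has_law _ _ _ P (@dirac _ (measurableTypeR R) (m t) R) _ mp lp _ mq q0).
    rewrite integral_dirac// diracT mul1e subrr expr0n.
    by [].
  rewrite (@integral_has_law _ _ _ P (normal_prob (m t) (Num.sqrt (V t t))) _ mp lp _ mq q0).
  have sn : Num.sqrt (V t t) != 0 by rewrite sqrtr_eq0 -ltNge lt_neqAle eq_sym Vn.
  have := normal_second_moment_le (m t) sn.
  by rewrite sqr_sqrtr.
have m1 : measurable_fun setT (fun w => ((path w t - m t) ^+ 2)%:E).
  by apply/measurable_EFinP; apply: measurable_funX; exact: measurable_funB.
apply: (@le_trans _ _ (\int[P]_w (2%:E * ((path w t - m t) ^+ 2)%:E +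
    (2 * (m t - c) ^+ 2)%:E))%E).
  apply: ge0_le_integral => //.
  - by move=> w _; rewrite lee_fin sqr_ge0.
  - by apply/measurable_EFinP; apply: measurable_funX; exact: measurable_funB.
  - by apply: emeasurable_funD => //; exact: measurable_funeM.
  - move=> w _; rewrite -EFinM -EFinD lee_fin.
    rewrite -subr_ge0 (_ : _ - _ = (path w t - 2 * m t + c) ^+ 2); last by ring.
    exact: sqr_ge0.
rewrite ge0_integralD//; last 3 first.
- by move=> w _; rewrite mule_ge0// lee_fin ?sqr_ge0.
- exact: measurable_funeM.
- by move=> w _; rewrite lee_fin mulr_ge0// sqr_ge0.
have -> : (\int[P]_w (2%:E * ((path w t - m t) ^+ 2)%:E) =
    2%:E * \int[P]_w ((path w t - m t) ^+ 2)%:E)%E.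
  by rewrite ge0_integralZl// => w _; rewrite lee_fin sqr_ge0.
rewrite integral_cst//= probability_setT mule1 [leRHS]EFinD leeD2r// [leRHS]EFinM.
by apply: lee_wpmul2l.
Qed.

(** By Tonelli's theorem the expected squared L2 distance is the integral of the
    pointwise second moments; Markov's inequality does the rest. *)
Lemma gp_L2_tail (d dd : R -> R) (B1 B2 r : R) :
  measurable_fun setT m -> measurable_fun setT dd ->
  (forall t, 0 < t < 1 -> d t = dd t) ->
  (\int[leb]_(t in `]0%R, 1%R[) ((m t - dd t) ^+ 2)%:E <= B1%:E)%E ->
  (forall t, 0 < t < 1 -> 0 <= V t t <= B2) -> 0 < r ->
  (P [set z | (r%:E < L2norm (fun t => (path z t - d t)%R))%E] <=
   ((2 * B2 + 2 * B1) / r ^+ 2)%:E)%E.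
Proof.
move=> mm mdd ddE hB1 hB2 r0.
pose D : set R := `]0, 1[%classic.
pose H (p : measurableTypeR R * gp_space gp) : R :=
  ((fun p : measurableTypeR R * gp_space gp => path p.2 p.1) \_ (D `*` setT)) p -
  (dd \_ D) p.1.
have mdD : measurable_fun [set: measurableTypeR R] (dd \_ D).
  apply/(measurable_restrict _ _ _).1 => //; first exact: measurable_itv.
  exact: measurable_funTS.
have mH : measurable_fun setT (fun p => (H p ^+ 2)%:E).
  apply/measurable_EFinP; apply: measurable_funX; apply: measurable_funB.
    exact: gp_measurable_oo.
  by apply: (measurableT_comp mdD); exact: measurable_fst.
have H0 p : (0 <= (H p ^+ 2)%:E)%E by rewrite lee_fin sqr_ge0.
have HE t z : H (t, z) = if t \in D then path z t - dd t else 0.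
  rewrite /H !patchE; have [tD|tD] := boolP (t \in D).
    by rewrite mem_set//=; move: tD; rewrite inE.
  rewrite memNset ?subr0//= => -[tD' _]; move: tD; rewrite notin_setE; exact.
pose J z := (\int[leb]_t (H (t, z) ^+ 2)%:E)%E.
have mJ : measurable_fun setT J := measurable_fun_fubini_tonelli_G (m1 := leb) _ mH H0.
have J0 z : (0 <= J z)%E by apply: integral_ge0 => t _.
have mHt z : measurable_fun [set: measurableTypeR R] (fun t => (H (t, z) ^+ 2)%:E).
  exact: measurable_fun_pair1 mH.
have L2E z : L2norm (fun t => path z t - d t) = (J z `^ 2^-1)%E.
  rewrite /L2norm /J; congr (_ `^ _)%E.
  have E : {in D, (fun t => ((path z t - d t) ^+ 2)%:E) =1 (fun t => (H (t, z) ^+ 2)%:E)}.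
    move=> t tD; rewrite HE tD ddE//.
    by move: tD; rewrite inE /D /= in_itv.
  have mD : measurable_fun D (fun t => ((path z t - d t) ^+ 2)%:E).
    apply: eq_measurable_fun (measurable_funTS (mHt z)) => t tD.
    by rewrite E.
  have mD' : measurable_fun (`]0, 1[%classic : set R) (fun t => (path z t - d t) ^+ 2).
    exact/measurable_EFinP.
  rewrite integral_itv_bndoo//.
  transitivity (\int[leb]_(t in D) (H (t, z) ^+ 2)%:E)%E.
    exact: eq_integral.
  rewrite [LHS]integral_mkcond; apply: eq_integral => t _; rewrite patchE.
  by case: ifPn => // tD; rewrite HE (negPf tD) expr0n.
have SE : [set z | (r%:E < L2norm (fun t => (path z t - d t)%R))%E] =
    [set z | ((r ^+ 2)%:E < J z)%E].
  apply/seteqP; split => z /=; rewrite L2E; have := J0 z; case: (J z) => [j|_|]//.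
  - rewrite lee_fin => j0; rewrite poweR_EFin !lte_fin powR12_sqrt// => rj.
    by rewrite -(sqr_sqrtr j0) (@ltr_pXn2r _ 2)// nnegrE ?sqrtr_ge0 ?(ltW r0).
  - by rewrite !ltry.
  - rewrite lee_fin => j0; rewrite poweR_EFin !lte_fin powR12_sqrt// => rj.
    by rewrite -(@ltr_pXn2r _ 2)// ?nnegrE ?sqrtr_ge0 ?(ltW r0)// sqr_sqrtr.
  - by move=> _; rewrite poweRyr ?ltry ?invr_eq0 ?pnatr_eq0.
rewrite SE; have r20 : 0 < r ^+ 2 by rewrite exprn_gt0.
have := markov_ge0 P mJ J0 r20.
rewrite /J -(@fubini_tonelli _ _ _ _ _ leb P _ mH H0) => hM.
rewrite [leRHS]EFinM lee_pdivlMr// muleC; apply: (le_trans hM).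
have -> : (\int[leb]_t \int[P]_z (H (t, z) ^+ 2)%:E =
    \int[leb]_(t in D) \int[P]_z ((path z t - dd t) ^+ 2)%:E)%E.
  rewrite [RHS]integral_mkcond; apply: eq_integral => t _; rewrite patchE.
  case: ifPn => tD; first by apply: eq_integral => z _; rewrite HE tD.
  by apply: integral0_eq => z _; rewrite HE (negPf tD) expr0n.
have mF : measurable_fun D (fun t => \int[P]_z ((path z t - dd t) ^+ 2)%:E)%E.
  have := measurable_fun_fubini_tonelli_F (m2 := P) _ mH H0.
  move=> /(measurable_funTS (D := D)); apply: eq_measurable_fun => t tD.
  by apply: eq_integral => w _; rewrite HE tD.
have mmd : measurable_fun D (fun t => ((m t - dd t) ^+ 2)%:E).
  apply/measurable_EFinP; apply: measurable_funX; apply: measurable_funTS.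
  exact: measurable_funB.
apply: (@le_trans _ _ (\int[leb]_(t in D)
    ((2 * B2)%:E + 2%:E * ((m t - dd t) ^+ 2)%:E))%E).
  apply: ge0_le_integral => //.
  - exact: measurable_itv.
  - by move=> t _; apply: integral_ge0 => w _; rewrite lee_fin sqr_ge0.
  - by apply: emeasurable_funD => //; exact: measurable_funeM.
  - move=> t; rewrite /D /= in_itv/= => t01; have /andP[V0 VB] := hB2 t t01.
    apply: le_trans (gp_second_moment_le _ t01 V0) _.
    by rewrite -EFinM -EFinD lee_fin lerD2r ler_wpM2l.
have B20 : 0 <= B2.
  have h : 0 < (2^-1 : R) < 1 by rewrite invr_gt0 invf_lt1//; apply/andP; split => //; lra.
  by have /andP[] := hB2 _ h; exact: le_trans.
have mDD : measurable D by exact: measurable_itv.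
rewrite ge0_integralD//; last 3 first.
- by move=> t _; rewrite lee_fin mulr_ge0.
- by move=> t _; rewrite mule_ge0// lee_fin sqr_ge0.
- exact: measurable_funeM.
have -> : (\int[leb]_(t in D) (2%:E * ((m t - dd t) ^+ 2)%:E) =
    2%:E * \int[leb]_(t in D) ((m t - dd t) ^+ 2)%:E)%E.
  by rewrite ge0_integralZl// => t _; rewrite lee_fin sqr_ge0.
have lD : leb D = 1%E.
  by rewrite /D lebesgue_measure_itv/= lte_fin ltr01 -EFinB subr0.
rewrite integral_cst//.  rewrite [X in (_ * X)%E]lD mule1.
by rewrite [leRHS]EFinD leeD2l// [leRHS]EFinM lee_wpmul2l.
Qed.

End gaussian_tail.

(** * Concentration of the noise and of the Gram matrix *)

Section concentration.
Variables (R : realType) (d : measure_display) (Omega : measurableType d).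
Variables (P : probability Omega R) (sigma : R) (n : nat).
Variables (X eps : 'I_n -> {RV P >-> R}).
Hypothesis sigma0 : 0 < sigma.
Hypothesis design : regression_design sigma X eps.
Hypothesis n0 : (0 < n)%N.
Variables (a : nat -> R) (S : R).
Hypothesis a0 : forall i, 0 <= a i.
Hypothesis aS : forall N, series a N <= S.

Let integral_series_le (h : nat -> Omega -> R) (v : R) N :
  (forall i, measurable_fun setT (h i)) -> (forall i w, 0 <= h i w) -> 0 <= v ->
  (forall i, (\int[P]_w (h i w)%:E <= v%:E)%E) ->
  (\int[P]_w (series (fun i => a i * h i w) N)%:E <= (S * v)%:E)%E.
Proof.
move=> mh h0 v0 hv; under eq_integral do rewrite /series /= -sumEFin.
rewrite ge0_integral_sum//; last 2 first.
- by move=> i; apply/measurable_EFinP; exact: measurable_funM.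
- by move=> i w _; rewrite lee_fin mulr_ge0.
apply: (@le_trans _ _ (\sum_(0 <= i < N) (a i * v)%:E)%E).
  apply: lee_sum => i _; under eq_integral do rewrite EFinM.
  rewrite ge0_integralZl//; last 3 first.
  - by apply/measurable_EFinP; exact: mh.
  - by move=> w _; rewrite lee_fin.
  - by rewrite lee_fin.
  rewrite [leRHS]EFinM; apply: lee_wpmul2l; [by rewrite lee_fin|exact: hv].
rewrite sumEFin lee_fin -mulr_suml; apply: ler_wpM2r => //; exact: aS.
Qed.

Let measurable_statistic (f g : R -> R) : measurable_fun setT f ->
  measurable_fun setT g ->
  measurable_fun setT (fun w => ((\sum_l f (X l w) * g (eps l w)) / n%:R) ^+ 2).
Proof.
move=> mf mg; apply: measurable_funX; apply: measurable_funM => //.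
apply: measurable_sum => l; apply: measurable_funM.
  by apply: measurableT_comp => //; exact: measurable_funPT.
by apply: measurableT_comp => //; exact: measurable_funPT.
Qed.

Let measurable_series (h : nat -> Omega -> R) N :
  (forall i, measurable_fun setT (h i)) ->
  measurable_fun setT (fun w => series (fun i => a i * h i w) N).
Proof.
by move=> mh; apply: measurable_sum => i; exact: measurable_funM.
Qed.

Let mpsi i : measurable_fun setT (fourier_deriv (R := R) 0 i).
Proof. by apply: continuous_measurable_fun; exact: continuous_fourier_deriv. Qed.

(** The noise is centred and independent of the covariates, so its empirical
    Fourier coefficients all have variance of order 1/n. *)
Lemma noise_event (c : R) : 0 < c -> exists B : set Omega,
  [/\ measurable B, (P B <= (S * (4 * sigma ^+ 2 / n%:R) / c)%:E)%E &
   forall w, ~ B w -> forall N, series (fun i => a i *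
     ((\sum_l fourier_deriv 0 i (X l w) * eps l w) / n%:R) ^+ 2) N <= c].
Proof.
move=> c0; have [_ eps_law _] := design.
pose h i w := ((\sum_l fourier_deriv 0 i (X l w) * id (eps l w)) / n%:R) ^+ 2.
have mh i : measurable_fun setT (h i).
  by apply: measurable_statistic => //; exact: mpsi.
have h0 i w : 0 <= h i w by exact: sqr_ge0.
have v0 : 0 <= 4 * sigma ^+ 2 / n%:R by rewrite divr_ge0// mulr_ge0// sqr_ge0.
have hv i : (\int[P]_w (h i w)%:E <= (4 * sigma ^+ 2 / n%:R)%:E)%E.
  rewrite (_ : 4 = 2 ^+ 2); last by ring.
  apply: (@empirical_mean_sqr_le _ _ _ _ _ _ _ _ design (fourier_deriv 0 i) id) => //.
  - by move=> x; exact: normr_fourier_basis_le.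
  - by move=> l; apply: noise_second_moment.
  - by move=> l; right; apply: (noise_mean0 sigma0 (eps_law l)).
have [|||||mB PB] := @markov_nondecreasing R _ _ P
    (fun N w => series (fun i => a i * h i w) N) (S * (4 * sigma ^+ 2 / n%:R)) c.
- by move=> N; exact: measurable_series.
- by move=> N w; rewrite /series /=; apply: sumr_ge0 => i _; rewrite mulr_ge0.
- by move=> w N N' NN'; apply: nonneg_series_le => // i; rewrite mulr_ge0.
- by [].
- by move=> N; exact: integral_series_le.
eexists; split; [exact: mB|exact: PB|].
move=> w nB N; rewrite leNgt; apply/negP => cN; apply: nB.
by exists N.
Qed.

(** The same computation for the entries of the empirical Gram matrix of the
    basis, centred by orthonormality under the uniform law. *)
Lemma gram_event : exists B : set Omega,
  [/\ measurable B, (P B <= (S * (S * (25 / n%:R)) / 4^-1)%:E)%E &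
   forall w, ~ B w -> forall N, \sum_(0 <= p < N) \sum_(0 <= q < N)
     a p * a q * gram_deviation (covariates X w) p q ^+ 2 <= 4^-1].
Proof.
have [X_law _ _] := design.
pose f p q (x : R) : R := fourier_deriv 0 p x * fourier_deriv 0 q x - (p == q)%:R.
pose h p q w := ((\sum_l f p q (X l w) * cst 1 (eps l w)) / n%:R) ^+ 2.
have mf p q : measurable_fun setT (f p q).
  by apply: measurable_funB => //; apply: measurable_funM; exact: mpsi.
have mh p q : measurable_fun setT (h p q).
  by apply: measurable_statistic => //; exact: mf.
have h0 p q w : 0 <= h p q w by exact: sqr_ge0.
have v0 : 0 <= 25 / n%:R :> R by rewrite divr_ge0.
have hE p q w : h p q w = gram_deviation (covariates X w) p q ^+ 2.
  rewrite /h /gram_deviation; congr (_ ^+ 2).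
  under eq_bigr do rewrite mulr1.
  rewrite sumrB sumr_const card_ord mulrBl -[(_ == _)%:R *+ n]mulr_natr mulfK ?pnatr_eq0 -?lt0n//.
  by congr (_ / _ - _); apply: eq_bigr => l _; rewrite mxE.
have fpsi (p q : nat) x : `|fourier_deriv 0 p x * fourier_deriv 0 q x : R| <= 4.
  rewrite normrM (_ : 4 = 2 * 2); last by ring.
  by apply: ler_pM; rewrite ?normr_fourier_basis_le.
have ctpsi p q : continuous (fun x : R => fourier_deriv 0 p x * fourier_deriv 0 q x).
  by apply: continuous_mulR; exact: continuous_fourier_deriv.
have f5 p q x : `|f p q x| <= 5.
  apply: (le_trans (ler_normB _ _)); rewrite [leRHS](_ : _ = 4 + 1); last by ring.
  by apply: lerD => //; case: (_ == _); rewrite ?normr1 ?normr0.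
(* Products of two basis functions are at most 4, and 25 = (4 + 1) ^ 2. *)
have hv p q : (\int[P]_w (h p q w)%:E <= (25 / n%:R)%:E)%E.
  have -> : 25 / n%:R = 5 ^+ 2 * 1 / n%:R :> R by rewrite mulr1; congr (_ / _); ring.
  apply: (@empirical_mean_sqr_le _ _ _ _ _ _ _ _ design (f p q) (cst 1)) => //.
  - by move=> l; rewrite /= expr1n integral_cst//= probability_setT mule1.
  - move=> l; left.
    rewrite (@expectation_uniform_law _ _ _ _ _ (X_law l) (f p q) 5)//; last first.
      by move=> x; apply: cvgB; [exact: ctpsi|exact: cvg_cst].
    rewrite /f Rintegral01D; [|exact: ctpsi|by move=> x; exact: cvg_cst].
    rewrite fourier_deriv_orthogonal Rintegral01_cst muln0 expr0.
    by case: (_ == _); rewrite ?subrr// subr0.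
have [|||||mB PB] := @markov_nondecreasing R _ _ P
    (fun N w => series (fun p => a p * series (fun q => a q * h p q w) N) N)
    (S * (S * (25 / n%:R))) 4^-1.
- move=> N; apply: measurable_series => p; exact: measurable_series.
- move=> N w; rewrite /series /=; apply: sumr_ge0 => p _; rewrite mulr_ge0//.
  by apply: sumr_ge0 => q _; rewrite mulr_ge0.
- move=> w N N' NN'.
  have aux p K : 0 <= series (fun q => a q * h p q w) K.
    by rewrite /series /=; apply: sumr_ge0 => q _; rewrite mulr_ge0.
  apply: (@le_trans _ _ (series (fun p => a p * series (fun q => a q * h p q w) N) N')).
    by apply: nonneg_series_le => // p; rewrite mulr_ge0.
  rewrite /series /=; apply: ler_sum => p _; apply: ler_wpM2l => //.
  by apply: nonneg_series_le => // q; rewrite mulr_ge0.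
- by rewrite invr_gt0.
- have S0 : 0 <= S by apply: le_trans (aS 0); rewrite /series /= big_geq.
  move=> N; apply: integral_series_le => //.
  + by move=> p; exact: measurable_series.
  + by move=> p w; rewrite /series /=; apply: sumr_ge0 => q _; rewrite mulr_ge0.
  + by rewrite mulr_ge0.
  + by move=> p; apply: integral_series_le.
eexists; split; [exact: mB|exact: PB|].
move=> w nB N; rewrite leNgt; apply/negP => cN; apply: nB.
exists N => //=; apply: (lt_le_trans cN); rewrite /series /=.
rewrite le_eqVlt; apply/orP; left; apply/eqP; apply: eq_bigr => p _.
by rewrite mulr_sumr; apply: eq_bigr => q _; rewrite hE mulrA.
Qed.

(** The covariates are finitely many and have a density, so almost surely none
    of them meets a given null set. *)
Lemma ae_eq_covariates_event (f g : R -> R) :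
  {ae lebesgue_measure, forall x, x \in `[0, 1] -> g x = f x} ->
  exists B : set Omega, [/\ measurable B, P B = 0%E &
    forall w, ~ B w -> forall l, g (X l w) = f (X l w)].
Proof.
move=> fg; have [X_law _ _] := design.
pose Q l B := [/\ measurable B, P B = 0%E & forall w, ~ B w -> g (X l w) = f (X l w)].
have /choice[B HB] l : exists B, Q l B := uniform_law_ae (X_law l) fg.
have [mB PB] : measurable (\big[setU/set0]_l B l) /\ P (\big[setU/set0]_l B l) = 0%E.
  elim/big_rec: _ => [|l A _ [mA PA]]; first by rewrite measure0.
  have [mBl PBl _] := HB l; split; first exact: measurableU.
  by rewrite measureU0.
exists (\big[setU/set0]_l B l); split => // w nB l.
have [_ _] := HB l; apply => wB; apply: nB.
by rewrite (bigD1 l)//; left.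
Qed.

End concentration.

(** * Contraction of the posterior *)

Section posterior_tail.
Variables (R : realType) (alpha C : R) (mu : nat -> R) (k : nat).
Hypothesis k_lt : k%:R < alpha - 3 / 2.
Hypothesis C1 : 1 <= C.
Hypothesis mu0 : forall i, (1 <= i)%N -> 0 < mu i.
Hypothesis mu_le : forall i, (1 <= i)%N -> mu i <= C * i%:R `^ (- (2 * alpha)).
Local Notation m := (fun i => mu i.+1).

(** The condition on k leaves room for convergence like the series of 1 / i ^ 2. *)
Lemma cvg_spectrum_order : cvgn (series (fun i => m i * i.+1%:R ^+ (2 * k))).
Proof.
apply: (@dominated_cvg_series _ _ _ _ (is_cvg_series_mull (a := C) (@cvg_series_inv_sqr R))) => i.
rewrite ger0_norm ?mulr_ge0 ?exprn_ge0 ?(ltW (mu0 _))//.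
have i0 : 0 < i.+1%:R :> R by rewrite ltr0n.
apply: (@le_trans _ _ (C * i.+1%:R `^ (- (2 * alpha)) * i.+1%:R ^+ (2 * k))).
  by apply: ler_wpM2r; [exact: exprn_ge0|exact: mu_le].
rewrite -mulrA; apply: ler_wpM2l; first by move: C1; lra.
rewrite -!powR_mulrn// -powRN -powRD ?(gt_eqF i0) ?implybT//.
apply: ler_powR; first by rewrite ler1n.
by rewrite natrM; move: k_lt; lra.
Qed.

Variables (sigma lam : R) (n : nat) (x y : 'cV[R]_n).
Hypothesis n0 : (0 < n)%N.
Hypothesis lam01 : 0 < lam <= 1.
Variables (b : nat -> R) (F E : R).
Local Notation w := (shrinkage m lam).
Local Notation z := (cutoff alpha lam).
Hypothesis gram_close : forall N,
  \sum_(0 <= p < N) \sum_(0 <= q < N) w p * w q * gram_deviation x p q ^+ 2 <= 4^-1.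
Hypothesis noise_small : forall N, series (fun i => w i *
  ((\sum_l (y l ord0 - fourier_series 0 b (x l ord0)) *
     fourier_deriv 0 i (x l ord0)) / n%:R) ^+ 2) N <= E.
Local Notation A := (16 ^+ k * (4 * C)).
Hypothesis b_order : summable_order k b.
Hypothesis b_norm : forall N, series (fun i => b i ^+ 2 / m i) N <= F.

(** On the event where the Gram matrix is close to the identity and the noise is
    small: the first summand bounds the posterior variance, the second one the
    squared distance of the posterior mean from the target. *)
Lemma posterior_tail_le
    (gp : gaussian_process (posterior_mean (series_kernel mu) lam k x y)
       (posterior_cov (series_kernel mu) sigma lam k x)) (d : R -> R) (r : R) :
  (forall t, 0 < t < 1 -> d t = fourier_series k b t) -> 0 < r ->
  (gp_prob gp [set s | (r%:E < L2norm (fun t => (gp_path s t - d t)%R))%E] <=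
   ((2 * (12 * sigma ^+ 2 * A * (z ^+ (2 * k) * (z / n%:R))) +
     2 * (8 * A * (z ^+ (2 * k) * (E + lam * F)))) / r ^+ 2)%:E)%E.
Proof.
move=> dE r0; have /andP[lam0 lam1] := lam01.
have cmk := cvg_spectrum_order.
have m0 i : 0 < m i by exact: mu0.
have mC i : m i <= C * i.+1%:R `^ (- (2 * alpha)) by exact: mu_le.
have ka : k%:R + 1 <= alpha by move: k_lt; lra.
have w0 i : 0 < w i by exact: shrinkage_gt0.
have A0 : 0 <= A by rewrite mulr_ge0 ?exprn_ge0// mulr_ge0//; move: C1; lra.
have z0 : 0 < z by rewrite powR_gt0.
have cb2 : cvgn (series (fun i => b i ^+ 2 / m i)).
  by apply: bounded_cvg_series b_norm => i; rewrite divr_ge0 ?sqr_ge0// ltW.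
have bias N : lam ^+ 2 * series (fun i => w i * b i ^+ 2 / m i ^+ 2) N <= lam * F.
  apply: (@le_trans _ _ (lam * series (fun i => b i ^+ 2 / m i) N)).
    rewrite /series /= !mulr_sumr; apply: ler_sum => i _.
    have -> : lam ^+ 2 * (w i * b i ^+ 2 / m i ^+ 2) =
        lam * (b i ^+ 2 / m i) * (lam / (m i + lam)).
      by rewrite /shrinkage; field; rewrite !gt_eqF ?addr_gt0.
    rewrite ler_piMr//; first by rewrite mulr_ge0 ?divr_ge0 ?sqr_ge0 ?ltW.
    by rewrite ler_pdivrMr ?addr_gt0// mul1r lerDr ltW.
  by apply: ler_wpM2l; [exact: ltW|exact: b_norm].
have freq_kap i : freq R i ^+ (2 * k) <= (A * z ^+ (2 * k)) / w i.
  apply: (@le_trans _ _ ((4 * i.+1%:R) ^+ (2 * k))).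
    by rewrite lerXn2r ?nnegrE ?freq_ge0 ?mulr_ge0 ?freq_le.
  rewrite exprMn exprM (_ : 4 ^+ 2 = 16); last by ring.
  rewrite -!mulrA; apply: ler_wpM2l; first exact: exprn_ge0.
  by rewrite !mulrA; apply: (weighted_shrinkage_sup_le C1 lam01).
have variance t N : lam ^+ 2 * series (fun i => w i * fourier_deriv k i t ^+ 2) N <=
    lam ^+ 2 * (4 * A * (z ^+ (2 * k) * z)).
  apply: ler_wpM2l; first exact: sqr_ge0.
  apply: (@le_trans _ _ (4 * 16 ^+ k *
      series (fun i => i.+1%:R ^+ (2 * k) * w i) N)).
    rewrite /series /= mulr_sumr; apply: ler_sum => i _.
    rewrite [leRHS](_ : _ = w i * (4 * 16 ^+ k * i.+1%:R ^+ (2 * k))); last by ring.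
    apply: ler_wpM2l; first exact: ltW.
    rewrite -[leLHS]real_normK ?num_real//.
    rewrite (_ : 4 * _ * _ = (2 * 4 ^+ k * i.+1%:R ^+ k) ^+ 2); last first.
      rewrite !exprMn -!exprM !(mulnC k 2) (exprM 4).
      by rewrite (_ : 2 ^+ 2 = 4) 1?(_ : 4 ^+ 2 = 16); [|ring..].
    by rewrite lerXn2r ?nnegrE ?mulr_ge0 ?exprn_ge0 ?normr_fourier_deriv_le.
  rewrite [leRHS](_ : _ = 4 * 16 ^+ k * (4 * C * z ^+ (2 * k) * z)); last first.
    by ring.
  apply: ler_wpM2l; first by rewrite mulr_ge0 ?exprn_ge0.
  exact: (weighted_shrinkage_sum_le C1 lam01).
have mfs (c : nat -> R) : summable_order k c -> measurable_fun setT (fourier_series k c).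
  by move=> /continuous_fourier_series; exact: continuous_measurable_fun.
have mm : measurable_fun setT (posterior_mean (series_kernel mu) lam k x y).
  rewrite (_ : posterior_mean _ _ _ _ _ = fourier_series k
    (ridge_coef m (series_kernel mu) x lam y)); last first.
    by apply/funext => t; rewrite posterior_meanE.
  by apply: mfs; exact: summable_ridge_coef.
have kap0 : 0 <= A * z ^+ (2 * k) by rewrite mulr_ge0 ?exprn_ge0 ?(ltW z0).
have B1 := posterior_mean_error_le mu0 cmk n0 lam0 gram_close b_order cb2
  noise_small bias kap0 freq_kap.
have B2 t (_ : 0 < t < 1) := posterior_cov_bounds mu0 cmk sigma n0 lam0 gram_close
  (variance t).
apply: le_trans (@gp_L2_tail _ _ _ gp d (fourier_series k b) _ _ r mm
  (mfs b b_order) dE B1 B2 r0) _.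
rewrite lee_fin le_eqVlt; apply/orP; left; apply/eqP.
by field; rewrite !gt_eqF// ltr0n.
Qed.

End posterior_tail.

Lemma outer_measure_le3 (R : realType) (d : measure_display)
    (T : measurableType d) (P : probability T R) (A B0 B1 B2 : set T) (p1 p2 : R) :
  measurable B0 -> measurable B1 -> measurable B2 ->
  P B0 = 0%E -> (P B1 <= p1%:E)%E -> (P B2 <= p2%:E)%E ->
  A `<=` B0 `|` (B1 `|` B2) -> (P^*%mu A <= (p1 + p2)%:E)%E.
Proof.
move=> m0 m1 m2 P0 P1 P2 AB; apply: (le_trans (le_mu_ext P AB)).
have m12 : measurable (B1 `|` B2) by exact: measurableU.
rewrite measurable_mu_extE; last exact: measurableU.
apply: (le_trans (measureU2 _ _ _)) => //.
rewrite [X in (X + _)%E]P0 add0e; apply: (le_trans (measureU2 _ _ _)) => //.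
by rewrite EFinD; exact: leeD.
Qed.

Lemma cvg_inv_pinfty (R : realType) (M : nat -> R) :
  M n @[n --> \oo] --> +oo -> (M n)^-1 @[n --> \oo] --> (0 : R).
Proof.
move=> /cvgryPge hM; apply/cvgrPdist_le => e e0.
apply: filterS (hM e^-1) => n en.
have M0 : 0 < M n by apply: lt_le_trans en; rewrite invr_gt0.
by rewrite sub0r normrN ger0_norm ?invr_ge0 ?(ltW M0)// invf_ple.
Qed.

Theorem theorem4 (R : realType) (alpha sigma : R) (f0 : R -> R)
    (mu lam : nat -> R)
    (d : nat -> measure_display) (Omega : forall n, measurableType (d n))
    (P : forall n, probability (Omega n) R)
    (X eps : forall n, 'I_n -> {RV (P n) >-> R})
    (k : nat)
    (Pi : forall (n : nat) (x y : 'cV[R]_n),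
       gaussian_process
         (posterior_mean (series_kernel mu) (lam n) k x y)
         (posterior_cov (series_kernel mu) sigma (lam n) k x))
    (M : nat -> R) :
  3 / 2 < alpha ->
  0 < sigma ->
  W_class alpha f0 \/ H_class alpha f0 ->
  (forall i, (1 <= i)%N -> 0 < mu i) ->
  (forall i j, (1 <= i <= j)%N -> mu j <= mu i) ->
  asymp mu (fun i => i%:R `^ (- (2 * alpha))) ->
  (forall n, 0 < lam n) ->
  asymp lam (rate (2 * alpha / (2 * alpha + 1))) ->
  (forall n, regression_design sigma (X n) (eps n)) ->
  k%:R < alpha - 3 / 2 ->
  M n @[n --> \oo] --> +oo ->
  cvg0_in_probability P
    (fun n w =>
       let post := Pi n (covariates (X n) w) (responses f0 (X n) (eps n) w) in
       gp_prob post
         [set z : gp_space post |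
           ((M n * rate ((alpha - k%:R) / (2 * alpha + 1)) n)%:E <
            L2norm (fun t => (gp_path z t - deriv_class k f0 t)%R))%E]).
Proof.
move=> alpha32 sigma0 f0class mu0 _ mu_asymp lam0 lam_rate design k_lt Minfty eta eta0.
have pow_pos i : (1 <= i)%N -> 0 < (i%:R : R) `^ (- (2 * alpha)).
  by move=> i1; rewrite powR_gt0// ltr0n.
have [C C1 muC] := asymp_positive mu0 pow_pos mu_asymp.
have mu_le i (i1 : (1 <= i)%N) : mu i <= C * i%:R `^ (- (2 * alpha)).
  by have [] := muC i i1.
have C0 : 0 < C by move: C1; lra.
pose m i := mu i.+1; have m0 i : 0 < m i by exact: mu0.
pose b i := fourier_coef f0 i.+1.
have [_ b_sobolev] := sobolev_coef_summable f0class.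
have b_order : summable_order k b.
  by apply: (coef_summable_order b_sobolev); move: k_lt; lra.
have cb2 : cvgn (series (fun i => b i ^+ 2 / m i)).
  apply: (@dominated_cvg_series _ _ _ _ (is_cvg_series_mull (a := C) b_sobolev)) => i.
  rewrite ger0_norm ?divr_ge0 ?sqr_ge0 ?(ltW (m0 i))// ler_pdivrMr//.
  have [_] := muC i.+1 isT; rewrite powRN -/(m i) -/(b i).
  have i2 : 0 < i.+1%:R `^ (2 * alpha) :> R by rewrite powR_gt0 ?ltr0n.
  rewrite -[leLHS]div1r ler_pdivrMr// => h.
  rewrite [leRHS](_ : _ = (C * m i * i.+1%:R `^ (2 * alpha)) * b i ^+ 2); last by ring.
  by rewrite -[leLHS]mul1r; apply: ler_wpM2r => //; exact: sqr_ge0.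
pose F := limn (series (fun i => b i ^+ 2 / m i)).
have b_norm N : series (fun i => b i ^+ 2 / m i) N <= F.
  by apply: series_le_lim => // i; rewrite divr_ge0 ?sqr_ge0// ltW.
have F0 : 0 <= F by apply: le_trans (b_norm 0%N); rewrite /series /= big_geq.
have [C2 C20 z_div] := cutoff_div_le alpha32 lam0 lam_rate.
have [C4 C40 z_rate] := cutoff_power_rate_le alpha32 lam0 lam_rate k.
pose z n := cutoff alpha (lam n).
pose A := 16 ^+ k * (4 * C).
have A0 : 0 < A by rewrite mulr_gt0 ?exprn_gt0// mulr_gt0.
(* The posterior mass outside the ball of radius M r is at most D / M on the
   good event, whose complement has probability at most delta. *)
pose D := 24 * sigma ^+ 2 * A * C2 * C4 + 16 * A * C4 * (1 + F).
have D0 : 0 < D.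
  by rewrite addr_gt0// !mulr_gt0 ?exprn_gt0//; move: F0; lra.
pose delta n := 1600 * C ^+ 2 * (z n ^+ 2 / n%:R) + 16 * C * sigma ^+ 2 * C2 * (M n)^-1.
apply: (@squeeze_cvge _ _ _ _ (fun=> 0%E) _ (fun n => (delta n)%:E)); last 2 first.
- exact: cvg_cst.
- apply: cvg_EFin; first exact: nearW.
  rewrite -[X in _ --> X]addr0 -[X in _ --> X + _](mulr0 (1600 * C ^+ 2)).
  rewrite -[X in _ --> _ + X](mulr0 (16 * C * sigma ^+ 2 * C2)).
  apply: cvgD; (apply: cvgM; first exact: cvg_cst).
    exact: (cutoff_sqr_div_cvg0 alpha32 lam0 lam_rate).
  exact: cvg_inv_pinfty.
near=> n; apply/andP; split; first exact: mu_ext_ge0.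
have n0 : (0 < n)%N by near: n; exact: nbhs_infty_gt.
have lam1 : lam n <= 1.
  near: n; have := regularization_cvg0 alpha32 lam0 lam_rate.
  by move=> /cvgrPdist_le/(_ 1 ltr01); apply: filterS => n;
    rewrite sub0r normrN ger0_norm// ltW.
have zn : z n / n%:R <= C2 * lam n by near: n.
have [rn zr] : 0 < rate ((alpha - k%:R) / (2 * alpha + 1)) n /\
  z n ^+ (2 * k) * lam n <=
  C4 * rate ((alpha - k%:R) / (2 * alpha + 1)) n ^+ 2 by near: n.
have M1 : 1 <= M n by near: n; move/cvgryPge : Minfty; exact.
have MD : D / eta <= M n by near: n; move/cvgryPge : Minfty; exact.
set rt := rate _ n in rn zr *.
have M0 : 0 < M n by exact: lt_le_trans M1.
have lam01 : 0 < lam n <= 1 by rewrite lam0.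
have z0 : 0 < z n by exact: cutoff_gt0.
pose a i := shrinkage m (lam n) i.
have a0 i : 0 <= a i by apply/ltW; apply: shrinkage_gt0.
have aS N : series a N <= 4 * C * z n.
  have a1 : 0%:R + 1 <= alpha by have := alpha32; lra.
  have := weighted_shrinkage_sum_le C1 lam01 m0 (fun i => mu_le i.+1 isT) N a1.
  rewrite muln0 !expr0 mulr1; congr (_ <= _).
  by congr (series _ _); apply/funext => i; rewrite mul1r.
have [B0 [mB0 PB0 on_series]] :=
  ae_eq_covariates_event (design n) (fourier_inversion alpha32 f0class).
have [B1 [mB1 PB1 gram_close]] := gram_event (design n) n0 a0 aS.
have Ml0 : 0 < M n * lam n by exact: mulr_gt0.
(* The noise energy has expectation of order z / n = O(lam), so allowing it to
   reach M lam leaves an exceptional probability O(1 / M); it then enters the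
   squared error of the mean with a factor M, against M ^ 2 in Markov's bound. *)
have [B2 [mB2 PB2 noise_small]] := noise_event sigma0 (design n) a0 aS Ml0.
apply: (@le_trans _ _ (4 * C * z n * (4 * C * z n * (25 / n%:R)) / 4^-1 +
    4 * C * z n * (4 * sigma ^+ 2 / n%:R) / (M n * lam n))%:E%E); last first.
  rewrite lee_fin /delta; apply: lerD.
    rewrite le_eqVlt; apply/orP; left; apply/eqP; field.
    by rewrite pnatr_eq0 -lt0n.
  rewrite [leLHS](_ : _ = 16 * C * sigma ^+ 2 * (z n / n%:R / lam n) * (M n)^-1); last first.
    by field; rewrite !gt_eqF// ltr0n.
  apply: ler_wpM2r; first by rewrite invr_ge0 ltW.
  apply: ler_wpM2l; first by rewrite !mulr_ge0 ?sqr_ge0// ltW.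
  by rewrite ler_pdivrMr.
apply: (outer_measure_le3 mB0 mB1 mB2 PB0 PB1 PB2).
move=> w; apply: contraPP => /not_orP[nB0 /not_orP[nB1 nB2]] /=.
apply/negP; rewrite -leNgt.
pose x := covariates (X n) w; pose y := responses f0 (X n) (eps n) w.
have noise N : series (fun i => a i *
    ((\sum_l (y l ord0 - fourier_series 0 b (x l ord0)) *
       fourier_deriv 0 i (x l ord0)) / n%:R) ^+ 2) N <= M n * lam n.
  apply: le_trans (noise_small w nB2 N).
  rewrite le_eqVlt; apply/orP; left; apply/eqP.
  congr (series _ _); apply/funext => i; congr (_ * (_ / _) ^+ 2).
  apply: eq_bigr => l _; rewrite !mxE on_series//.
  by rewrite addrAC subrr add0r mulrC.
have Mr0 : 0 < M n * rt by exact: mulr_gt0.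
have dE t : 0 < t < 1 -> deriv_class k f0 t = fourier_series k b t.
  exact: (deriv_classE alpha32 f0class k_lt).
have := posterior_tail_le k_lt C1 mu0 mu_le n0 lam01 (gram_close w nB1) noise
  b_order b_norm (Pi n x y) dE Mr0.
move/le_trans; apply; rewrite lee_fin -/A -/(z n).
have zk0 : 0 <= z n ^+ (2 * k) by rewrite exprn_ge0// ltW.
have variance : z n ^+ (2 * k) * (z n / n%:R) <= C2 * C4 * rt ^+ 2.
  apply: (@le_trans _ _ (z n ^+ (2 * k) * (C2 * lam n))); first exact: ler_wpM2l.
  by rewrite mulrCA -mulrA; apply: ler_wpM2l => //; exact: ltW.
have bias : z n ^+ (2 * k) * (M n * lam n + lam n * F) <= C4 * rt ^+ 2 * (M n * (1 + F)).
  rewrite [leLHS](_ : _ = z n ^+ (2 * k) * lam n * (M n + F)); last by ring.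
  apply: ler_pM => //; first by rewrite mulr_ge0// ltW.
    by rewrite addr_ge0// ltW.
  by rewrite mulrDr mulr1 lerD2l ler_peMl.
apply: (@le_trans _ _ (D * M n * rt ^+ 2 / (M n * rt) ^+ 2)); last first.
  rewrite [leLHS](_ : _ = D / M n); last by field; rewrite !gt_eqF.
  by rewrite ler_pdivrMr// mulrC -ler_pdivrMr.
apply: ler_wpM2r; first by rewrite invr_ge0 sqr_ge0.
rewrite /D !mulrDl; apply: lerD.
  rewrite [leLHS](_ : _ = 24 * sigma ^+ 2 * A * (z n ^+ (2 * k) * (z n / n%:R))); last by ring.
  apply: (@le_trans _ _ (24 * sigma ^+ 2 * A * (C2 * C4 * rt ^+ 2))).
    by apply: ler_wpM2l => //; rewrite !mulr_ge0 ?sqr_ge0// ltW.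
  rewrite [leRHS](_ : _ = M n * (24 * sigma ^+ 2 * A * (C2 * C4 * rt ^+ 2))); last by ring.
  by rewrite ler_peMl// !mulr_ge0 ?sqr_ge0// ltW.
rewrite [leLHS](_ : _ = 16 * A * (z n ^+ (2 * k) * (M n * lam n + lam n * F))); last by ring.
rewrite [leRHS](_ : _ = 16 * A * (C4 * rt ^+ 2 * (M n * (1 + F)))); last by ring.
by apply: ler_wpM2l => //; rewrite mulr_ge0// ltW.
Unshelve. all: by end_near. Qed.
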